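(* Let $c\in\mathbb{R}$ with $c^2\neq 1$, let $\hat U$ be a periodic (modulo $2\pi$) standing wave of the sine-Gordon equation with fundamental period $T$, and let $\mathbb{H}(T;\zeta)$ be the monodromy matrix of the associated Hill's equation (all as in the context). Then the function $$D_{2}(\zeta;\theta) := \operatorname{tr}(\mathbb{H}(T;\zeta)) - 2\cos\left(\frac{c\zeta T}{c^{2}-1} + \theta\right),\qquad \zeta\in\mathbb{C},\ \theta\in[0,2\pi),$$ is an Evans function for the characteristic values of the pencil $\mathcal{L}_{SG}(\zeta)$, parametrised by the Floquet exponent $\theta$. That is, for each $\theta\in[0,2\pi)$, the function $\zeta\mapsto D_2(\zeta;\theta)$ is entire, its zeros are exactly the characteristic values of $\mathcal{L}_{SG}$ for the Floquet exponent $\theta$, and its order of vanishing at each such characteristic value $\zeta_0$ equals the algebraic multiplicity of $\zeta_0$.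
   Context: Standing wave: $\hat U:\mathbb{R}\to\mathbb{R}$ is a non-constant solution of $(c^2-1)\hat U_{zz}+\sin(\hat U)=0$ that is periodic modulo $2\pi$ with fundamental period $T>0$, i.e. $\hat U(z+T)=\hat U(z)\ (\mathrm{mod}\ 2\pi)$ for all $z$. In particular $\cos(\hat U)$ is $T$-periodic. Pencil: for $\zeta\in\mathbb{C}$, $$\mathcal{L}_{SG}(\zeta) := -\frac{\zeta^2}{c^2-1}\mathbb{I} - \frac{2ic\zeta}{c^2-1}\partial_{z}+\left(\partial_{z}^2 + \frac{\cos(\hat{U})}{c^2-1}\right),$$ so $\mathcal{L}_{SG}(\zeta)p=0$ is the linearised sine-Gordon equation. For a Floquet exponent $\theta\in[0,2\pi)$ it acts in $L^2([0,T])$ on the domain of complex-valued $p\in C^2([0,T])$ satisfying the quasi-periodicity condition $p(z)=e^{i\theta}p(z+T)$, that is, $p(T)=e^{-i\theta}p(0)$ and $p'(T)=e^{-i\theta}p'(0)$. Characteristic values: $\zeta_0\in\mathbb{C}$ is a characteristic value (for the Floquet exponent $\theta$) if there is $p\neq 0$ in this domain with $\mathcal{L}_{SG}(\zeta_0)p=0$. Its algebraic multiplicity is the supremum over $m\ge1$ of the dimension of the space of tuples $(p_0,\dots,p_{m-1})$ of elements of the domain satisfying $\sum_{j=0}^{k}\frac{1}{j!}\mathcal{L}_{SG}^{(j)}(\zeta_0)p_{k-j}=0$ for $k=0,\dots,m-1$, where $\mathcal{L}_{SG}^{(j)}$ is the $j$-th derivative in $\zeta$. For real $\zeta_0$ this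 equals the sum of the orders of vanishing at $\zeta_0$ of the analytic eigenvalue branches $\mu_i(\zeta)$, i.e. solutions of $\mathcal{L}_{SG}(\zeta)u(\zeta)=\mu(\zeta)u(\zeta)$ with $u,\mu$ analytic near $\zeta_0$, $u\ne0$, that vanish at $\zeta_0$. Hill's equation and monodromy matrix: let $q_1(z;\zeta),q_2(z;\zeta)$ be the solutions of $$q'' + \left(\frac{\zeta^{2}}{(c^2-1)^{2}} + \frac{\cos(\hat{U})}{c^2-1}\right)q = 0$$ with $q_1(0;\zeta)=1,\ q_1'(0;\zeta)=0,\ q_2(0;\zeta)=0,\ q_2'(0;\zeta)=1$, and set $\mathbb{H}(z;\zeta)=\begin{pmatrix} q_1(z;\zeta)&q_2(z;\zeta)\\ q_1'(z;\zeta)&q_2'(z;\zeta)\end{pmatrix}$. The monodromy matrix is $\mathbb{H}(T;\zeta)$. *)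

(* Defs.v *)
From Stdlib Require Import Reals Factorial Lra Lia.
From Coquelicot Require Import Coquelicot.

Open Scope R_scope.

Definition periodic_mod_2PI (f : R -> R) (T : R) : Prop :=
  forall z : R, exists k : Z, f (z + T) = f z + 2 * PI * IZR k.

Definition standing_wave (c : R) (U : R -> R) : Prop :=
  (forall z : R, ex_derive U z) /\
  (forall z : R, ex_derive (Derive U) z) /\
  (forall z : R, (c ^ 2 - 1) * Derive (Derive U) z + sin (U z) = 0) /\
  (exists z1 z2 : R, U z1 <> U z2).

Definition fundamental_period_mod_2PI (U : R -> R) (T : R) : Prop :=
  0 < T /\ periodic_mod_2PI U T /\
  (forall S : R, 0 < S < T -> ~ periodic_mod_2PI U S).

(* A function on [0,T] is a total function [R -> C] of which only the values
   on [0,T] matter; derivatives at the endpoints are one-sided. *)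

Definition on_I (T z : R) : Prop := 0 <= z <= T.

Definition diff_quot (p : R -> C) (z y : R) : C :=
  ((p y - p z) / RtoC (y - z))%C.

Definition derivable_I (T : R) (p : R -> C) : Prop :=
  forall z : R, on_I T z ->
  exists l : C,
    filterlim (diff_quot p z) (within (on_I T) (locally' z)) (locally l).

(* Meaningful at points where the limit exists, see [derive_I_unique]. *)
Definition derive_I (T : R) (p : R -> C) (z : R) : C :=
  lim (T := C_CompleteNormedModule)
    (filtermap (diff_quot p z) (within (on_I T) (locally' z))).

Definition C2_I (T : R) (p : R -> C) : Prop :=
  derivable_I T p /\
  derivable_I T (derive_I T p) /\
  continuous_on (on_I T) (derive_I T (derive_I T p)).

Definition Cexp (z : C) : C :=
  (RtoC (exp (Re z)) * (cos (Im z), sin (Im z)))%C.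

Definition Ccos (z : C) : C :=
  ((Cexp (Ci * z) + Cexp (- (Ci * z))) / 2)%C.

Definition in_domain (T theta : R) (p : R -> C) : Prop :=
  C2_I T p /\
  p T = (Cexp (- (Ci * theta)) * p 0)%C /\
  derive_I T p T = (Cexp (- (Ci * theta)) * derive_I T p 0)%C.

Definition LSG (c T : R) (U : R -> R) (zeta : C) (p : R -> C) (z : R) : C :=
  (- (zeta ^ 2 / (c ^ 2 - 1)%R) * p z
   - (2 * Ci * c * zeta) / (c ^ 2 - 1)%R * derive_I T p z
   + (derive_I T (derive_I T p) z
      + RtoC (cos (U z) / (c ^ 2 - 1)) * p z))%C.

(* The j-th derivative of the pencil in zeta, computed pointwise in p and z.
   [C_derive] only takes a limit along the real direction, which is the complex
   derivative here since the pencil is polynomial in zeta; the closed form is given by [LSG_deriv_0] to [LSG_deriv_ge3]. *)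
Definition LSG_deriv (c T : R) (U : R -> R) (j : nat) (zeta : C)
    (p : R -> C) (z : R) : C :=
  Nat.iter j C_derive (fun w : C => LSG c T U w p z) zeta.

Definition characteristic_value (c T : R) (U : R -> R) (theta : R)
    (zeta0 : C) : Prop :=
  exists p : R -> C,
    in_domain T theta p /\
    (exists z : R, on_I T z /\ p z <> 0) /\
    (forall z : R, on_I T z -> LSG c T U zeta0 p z = 0).

(* A tuple (p_0, ..., p_(m-1)) is encoded as a sequence of functions of which
   only the first m terms matter. *)
Definition jordan_tuple (c T : R) (U : R -> R) (theta : R) (zeta0 : C)
    (m : nat) (p : nat -> R -> C) : Prop :=
  (forall k : nat, (k < m)%nat -> in_domain T theta (p k)) /\
  (forall k : nat, (k < m)%nat -> forall z : R, on_I T z ->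
     sum_n (fun j : nat =>
              (/ RtoC (INR (fact j))
               * LSG_deriv c T U j zeta0 (p (k - j)%nat) z)%C) k = RtoC 0).

(* Tuples are identified when their first m terms agree on [0,T]; modulo this,
   e_1, ..., e_d is a basis of [W]. *)
Definition has_dim (T : R) (m : nat) (W : (nat -> R -> C) -> Prop)
    (d : nat) : Prop :=
  exists e : nat -> nat -> R -> C,
    (forall i : nat, (1 <= i <= d)%nat -> W (e i)) /\
    (forall p : nat -> R -> C, W p ->
       exists a : nat -> C, forall (k : nat) (z : R), (k < m)%nat -> on_I T z ->
         p k z = sum_n_m (fun i : nat => (a i * e i k z)%C) 1 d) /\
    (forall a : nat -> C,
       (forall (k : nat) (z : R), (k < m)%nat -> on_I T z ->
          sum_n_m (fun i : nat => (a i * e i k z)%C) 1 d = RtoC 0) ->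
       forall i : nat, (1 <= i <= d)%nat -> a i = 0).

(* n is the supremum over m >= 1 of the dimensions; a finite supremum of
   natural numbers is attained. *)
Definition algebraic_multiplicity (c T : R) (U : R -> R) (theta : R)
    (zeta0 : C) (n : nat) : Prop :=
  (forall m : nat, (1 <= m)%nat ->
     exists d : nat,
       has_dim T m (jordan_tuple c T U theta zeta0 m) d /\ (d <= n)%nat) /\
  (exists m : nat, (1 <= m)%nat /\
     has_dim T m (jordan_tuple c T U theta zeta0 m) n).

Definition hill_solution (c : R) (U : R -> R) (zeta : C) (q dq : R -> C)
    : Prop :=
  (forall z : R, is_derive (K := R_AbsRing) (V := C_R_NormedModule) q z (dq z))
  /\
  (forall z : R, is_derive (K := R_AbsRing) (V := C_R_NormedModule) dq z
     (- ((zeta ^ 2 / ((c ^ 2 - 1) ^ 2)%R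
          + RtoC (cos (U z) / (c ^ 2 - 1))) * q z))%C).

Definition hill_matrix (q1 dq1 q2 dq2 : R -> C -> C) (z : R) (zeta : C)
    : @matrix C 2 2 :=
  mk_matrix 2 2 (fun i j : nat =>
    match i, j with
    | O, O => q1 z zeta
    | O, _ => q2 z zeta
    | _, O => dq1 z zeta
    | _, _ => dq2 z zeta
    end).

Definition trace {n : nat} (A : @matrix C n n) : C :=
  sum_n_m (fun i : nat => coeff_mat (RtoC 0) A (i - 1) (i - 1)) 1 n.

Definition D2 (c T : R) (HT : C -> @matrix C 2 2) (zeta : C) (theta : R) : C :=
  (trace (HT zeta) - 2 * Ccos (c * zeta * T / (c ^ 2 - 1)%R + theta))%C.

Definition entire (f : C -> C) : Prop :=
  forall z : C, ex_derive (K := C_AbsRing) (V := C_NormedModule) f z.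

Definition vanishing_order (f : C -> C) (z0 : C) (n : nat) : Prop :=
  exists g : C -> C,
    locally z0 (fun z : C =>
      ex_derive (K := C_AbsRing) (V := C_NormedModule) g z /\
      f z = ((z - z0) ^ n * g z)%C) /\
    g z0 <> 0.

Lemma within_I_proper (T z : R) : 0 < T -> on_I T z ->
  ProperFilter (within (on_I T) (locally' z)).
Proof.
intros HT Hz. split.
- intros P [eps HP].
  assert (He := cond_pos eps).
  set (h := Rmin (eps / 2) (T / 2)).
  assert (Hh : 0 < h) by (apply Rmin_pos; lra).
  assert (h1 : h <= eps / 2) by apply Rmin_l.
  assert (h2 : h <= T / 2) by apply Rmin_r.
  unfold on_I in *.
  assert (Hy : exists y, 0 <= y <= T /\ y <> z /\ Rabs (y - z) < eps).
  { destruct (Rle_lt_dec z (T / 2)).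
    - exists (z + h). repeat split; try lra.
      rewrite Rabs_right; lra.
    - exists (z - h). repeat split; try lra.
      rewrite Rabs_left; lra. }
  destruct Hy as [y [Hy1 [Hy2 Hy3]]].
  exists y. apply (HP y); assumption.
- apply within_filter. apply within_filter. apply locally_filter.
Qed.

Lemma derive_I_unique (T : R) (p : R -> C) (z : R) (l : C) :
  0 < T -> on_I T z ->
  filterlim (diff_quot p z) (within (on_I T) (locally' z)) (locally l) ->
  derive_I T p z = l.
Proof.
intros HT Hz Hl.
assert (PF := within_I_proper T z HT Hz).
assert (PG : ProperFilter
   (filtermap (diff_quot p z) (within (on_I T) (locally' z))))
  by now apply filtermap_proper_filter.
apply (filterlim_locally_unique (K := C_AbsRing) (V := C_NormedModule)
         (F := within (on_I T) (locally' z)) (diff_quot p z));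
  [ | exact Hl].
apply filterlim_locally. intros eps.
apply (complete_cauchy (T := C_CompleteNormedModule) _ PG).
intros e. exists l.
apply Hl. exists e. intros y Hy. exact Hy.
Qed.

Lemma LSG_deriv_0 (c T : R) (U : R -> R) (zeta : C) (p : R -> C) (z : R) :
  LSG_deriv c T U 0 zeta p z = LSG c T U zeta p z.
Proof. reflexivity. Qed.

Lemma is_derive_quadratic (a b d z : C) :
  is_derive (K := C_AbsRing) (V := C_NormedModule)
    (fun w : C => (a * w ^ 2 + b * w + d)%C) z (2 * a * z + b)%C.
Proof.
split; [apply is_linear_scal_l | ].
intros x Hx.
apply (is_filter_lim_locally_unique (K := C_AbsRing)
         (V := AbsRing_NormedModule C_AbsRing)) in Hx.
subst x. intros eps.
assert (He := cond_pos eps).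
assert (Ha := Cmod_ge_0 a).
assert (Hd : 0 < eps / (Cmod a + 1)) by (apply Rdiv_lt_0_compat; lra).
exists (mkposreal _ Hd). intros y Hy.
change (Cmod (y - z) < eps / (Cmod a + 1)) in Hy.
change (Cmod ((a * y ^ 2 + b * y + d) - (a * z ^ 2 + b * z + d)
   - (y - z) * (2 * a * z + b)) <= eps * Cmod (y - z)).
replace ((a * y ^ 2 + b * y + d) - (a * z ^ 2 + b * z + d)
   - (y - z) * (2 * a * z + b))%C with (a * (y - z) * (y - z))%C by ring.
rewrite !Cmod_mult.
apply Rmult_le_compat_r; [apply Cmod_ge_0 | ].
apply Rle_trans with ((Cmod a + 1) * (eps / (Cmod a + 1))).
- apply Rmult_le_compat; try apply Cmod_ge_0; lra.
- right. field. lra.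
Qed.

Lemma LSG_deriv_1 (c T : R) (U : R -> R) (zeta : C) (p : R -> C) (z : R) :
  LSG_deriv c T U 1 zeta p z =
  (- (2 * zeta / (c ^ 2 - 1)%R) * p z
   - (2 * Ci * c) / (c ^ 2 - 1)%R * derive_I T p z)%C.
Proof.
apply is_C_derive_unique.
eapply is_derive_ext; [ | evar_last; [
  apply (is_derive_quadratic (- (/ (c ^ 2 - 1)%R) * p z)%C
    (- ((2 * Ci * c) / (c ^ 2 - 1)%R * derive_I T p z))%C
    (derive_I T (derive_I T p) z
      + RtoC (cos (U z) / (c ^ 2 - 1)) * p z)%C) | ]].
- intros w. simpl Nat.iter. unfold LSG, Cdiv. symmetry. simpl; ring.
- unfold Cdiv. ring.
Qed.

Lemma LSG_deriv_2 (c T : R) (U : R -> R) (zeta : C) (p : R -> C) (z : R) :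
  LSG_deriv c T U 2 zeta p z = (- (2 / (c ^ 2 - 1)%R) * p z)%C.
Proof.
apply is_C_derive_unique.
eapply is_derive_ext; [ | evar_last; [
  apply (is_derive_quadratic 0
    (- (2 / (c ^ 2 - 1)%R) * p z)%C
    (- ((2 * Ci * c) / (c ^ 2 - 1)%R * derive_I T p z))%C) | ]].
- intros w. symmetry.
  change (LSG_deriv c T U 1 w p z = (0 * w ^ 2
    + - (2 / (c ^ 2 - 1)%R) * p z * w
    + - ((2 * Ci * c) / (c ^ 2 - 1)%R * derive_I T p z))%C).
  rewrite LSG_deriv_1. unfold Cdiv. ring.
- ring.
Qed.

Lemma LSG_deriv_ge3 (c T : R) (U : R -> R) (j : nat) (zeta : C)
    (p : R -> C) (z : R) : (3 <= j)%nat ->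
  LSG_deriv c T U j zeta p z = 0.
Proof.
intros Hj. replace j with (S (S (S (j - 3)))) by lia. clear Hj.
revert zeta. induction (j - 3)%nat as [ | n IH]; intros zeta;
  apply is_C_derive_unique.
- eapply is_derive_ext; [ | evar_last; [
    apply (is_derive_quadratic 0 0 (- (2 / (c ^ 2 - 1)%R) * p z)%C) | ]].
  + intros w. symmetry.
    change (LSG_deriv c T U 2 w p z =
      (0 * w ^ 2 + 0 * w + - (2 / (c ^ 2 - 1)%R) * p z)%C).
    rewrite LSG_deriv_2. ring.
  + ring.
- eapply is_derive_ext; [ | evar_last; [
    apply (is_derive_quadratic 0 0 0) | ]].
  + intros w. symmetry.
    change (LSG_deriv c T U (S (S (S n))) w p z =
      (0 * w ^ 2 + 0 * w + 0)%C).
    rewrite IH. ring.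
  + ring.
Qed.

Lemma trace_2 (A : @matrix C 2 2) :
  trace A = (coeff_mat (RtoC 0) A 0 0 + coeff_mat (RtoC 0) A 1 1)%C.
Proof. unfold trace. now rewrite sum_n_Sm, sum_n_n by lia. Qed.

(* Main.v *)
(** Write [p = exp (i c zeta z / (c^2 - 1)) q]: then [L_SG(zeta) p = 0] becomes Hill's equation for [q], so
   the normalised solutions of [L_SG(zeta) p = 0] have a fundamental matrix [Phi(z; zeta)] expressed by [q1], [q2],
   and [det (Phi(T; zeta) - exp(-i theta))] is [D2] times a zero-free entire function.
   The Taylor coefficients in [h] of [Phi(z; zeta0 + h)] satisfy the recursion of the Jordan chains at [zeta0]. Hence
   every solution of length [m] of the chain equations is the product of this Taylor series with a unique vector of series modulo [h^m],
   and the boundary conditions say that [Phi(T) - exp(-i theta)] sends this vector to [0] modulo [h^m].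
   For a 2x2 matrix of power series whose entries have least order [a] and whose determinant has order [n],
   the Smith form [diag (h^a, h^(n-a))] gives a kernel of dimension [min(a, m) + min(n - a, m)], whose supremum is [n].
   An energy estimate shows that the Taylor series converge for all [h], so the determinant has a finite
   order at [zeta0] unless it vanishes everywhere. The latter is impossible: for [c^2 < 1] a monotone
   quantity excludes [zeta = 2i], and for [c^2 > 1] the cosine outgrows the trace along the imaginary axis. *)

Require Import Defs.
From Stdlib Require Import Reals Factorial Lra Lia Psatz FunctionalExtensionality Wf_nat Classical.
From Coquelicot Require Import Coquelicot.
Open Scope R_scope.

(** * Complex-valued functions of a real variable *)

(** The solutions [q1] and [q2] are given for each [zeta] separately, so their analytic dependence
    on [zeta] has to be derived. One construction serves for this and for the multiplicity: the
    formal solution in h at a fixed [zeta0], built order by order. Summed, it gives the local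
    expansion of the determinant; truncated at h^m, it parametrises the chains of length m. Chains
    are studied for the pencil itself rather than for Hill's equation because the multiplier exp(-i
    theta) of p does not depend on [zeta], so the boundary condition holds coefficient by
    coefficient; the multiplier of q does depend on [zeta]. Convergence is recorded as an explicit
    remainder bound for every geometric rate. This replaces the identity theorem and the removable
    singularity theorem. The case distinction at the end follows the sign of c^2 - 1. On the
    imaginary axis, far enough out, the zero-order coefficient is positive for c^2 < 1 and negative
    for c^2 > 1, which limits the monotone quantity to the first case. In the second case the cosine
    grows with |c| > 1 times the leading rate of the trace. *)

Definition rderiv (f : R -> C) (z : R) (l : C) : Prop :=
  is_derive (K := R_AbsRing) (V := C_R_NormedModule) f z l.

Lemma norm_C_R (x : C) : norm (x : C_R_NormedModule) = Cmod x.
Proof.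
change (sqrt (Rabs (fst x) ^ 2 + Rabs (snd x) ^ 2) = sqrt (fst x ^ 2 + snd x ^ 2)).
now rewrite !pow2_abs.
Qed.

(** An epsilon-delta form in [Cmod], in which two-sided derivatives can be compared with one-sided
    ones on [0,T]. *)
Lemma rderiv_eps (f : R -> C) (z : R) (l : C) :
  rderiv f z l <-> forall eps : posreal, exists delta : posreal, forall y : R,
    Rabs (y - z) < delta -> Cmod (f y - f z - RtoC (y - z) * l)%C <= eps * Rabs (y - z).
Proof.
assert (E : forall y : R, minus (minus (f y) (f z) : C_R_NormedModule) (scal (minus y z : R_AbsRing) l)
   = (f y - f z - RtoC (y - z) * l)%C).
{ intros y. rewrite scal_R_Cmult. reflexivity. }
split.
- intros [_ H] eps.
  destruct (H z (fun P HP => HP) eps) as [d Hd].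
  exists d. intros y Hy. specialize (Hd y Hy).
  change (norm (minus (minus (f y) (f z) : C_R_NormedModule) (scal (minus y z : R_AbsRing) l)) <= eps * Rabs (y - z)) in Hd.
  rewrite E, norm_C_R in Hd. exact Hd.
- intros H. split; [apply is_linear_scal_l | ].
  intros x Hx. apply (is_filter_lim_locally_unique (V := R_NormedModule)) in Hx. subst x.
  intros eps. destruct (H eps) as [d Hd]. exists d. intros y Hy.
  change (norm (minus (minus (f y) (f z) : C_R_NormedModule) (scal (minus y z : R_AbsRing) l)) <= eps * Rabs (y - z)).
  rewrite E, norm_C_R. apply Hd. exact Hy.
Qed.

Lemma Rabs_fst_Cmod (x : C) : Rabs (fst x) <= Cmod x.
Proof. eapply Rle_trans; [apply Rmax_l | apply Rmax_Cmod]. Qed.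

Lemma Rabs_snd_Cmod (x : C) : Rabs (snd x) <= Cmod x.
Proof. eapply Rle_trans; [apply Rmax_r | apply Rmax_Cmod]. Qed.

Lemma Cmod_le_sum (x : C) : Cmod x <= Rabs (fst x) + Rabs (snd x).
Proof.
destruct x as [a b].
replace (a, b) with (RtoC a + Ci * RtoC b)%C by (unfold Ci, RtoC, Cplus, Cmult; simpl; f_equal; ring).
eapply Rle_trans; [apply Cmod_triangle | ].
rewrite Cmod_mult, Cmod_Ci, !Cmod_R. simpl.
right. rewrite Rmult_1_l. f_equal; f_equal; ring.
Qed.

Lemma is_derive_eps (f : R -> R) (z l : R) :
  is_derive f z l <-> forall eps : posreal, exists delta : posreal, forall y : R,
    Rabs (y - z) < delta -> Rabs (f y - f z - (y - z) * l) <= eps * Rabs (y - z).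
Proof.
split.
- intros [_ H] eps.
  destruct (H z (fun P HP => HP) eps) as [d Hd].
  exists d. intros y Hy. exact (Hd y Hy).
- intros H. split; [apply is_linear_scal_l | ].
  intros x Hx. apply (is_filter_lim_locally_unique (V := R_NormedModule)) in Hx. subst x.
  intros eps. destruct (H eps) as [d Hd]. exists d. intros y Hy. exact (Hd y Hy).
Qed.

Lemma rderiv_components (f : R -> C) (z : R) (l : C) :
  rderiv f z l <-> is_derive (fun x => fst (f x)) z (fst l) /\ is_derive (fun x => snd (f x)) z (snd l).
Proof.
rewrite rderiv_eps, !is_derive_eps. split.
- intros H. split; intros eps; destruct (H eps) as [d Hd]; exists d; intros y Hy;
    (eapply Rle_trans; [ | apply Hd; exact Hy]).
  + eapply Rle_trans; [ | apply Rabs_fst_Cmod]. right. f_equal. simpl. ring.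
  + eapply Rle_trans; [ | apply Rabs_snd_Cmod]. right. f_equal. simpl. ring.
- intros [H1 H2] eps.
  assert (He : 0 < eps / 2) by (destruct eps; simpl; lra).
  destruct (H1 (mkposreal _ He)) as [d1 Hd1]. destruct (H2 (mkposreal _ He)) as [d2 Hd2].
  exists (mkposreal _ (Rmin_stable_in_posreal d1 d2)). simpl. intros y Hy.
  assert (Hy1 := Hd1 y (Rlt_le_trans _ _ _ Hy (Rmin_l _ _))).
  assert (Hy2 := Hd2 y (Rlt_le_trans _ _ _ Hy (Rmin_r _ _))). simpl in *.
  eapply Rle_trans; [apply Cmod_le_sum | ].
  replace (fst (f y - f z - RtoC (y - z) * l)%C) with (fst (f y) - fst (f z) - (y - z) * fst l) by (simpl; ring).
  replace (snd (f y - f z - RtoC (y - z) * l)%C) with (snd (f y) - snd (f z) - (y - z) * snd l) by (simpl; ring).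
  lra.
Qed.

Lemma rderiv_ext (f g : R -> C) (z : R) (l : C) : (forall x, f x = g x) -> rderiv f z l -> rderiv g z l.
Proof. intros E. apply (is_derive_ext (V := C_R_NormedModule) f g z l E). Qed.

Lemma rderiv_eq (f : R -> C) (z : R) (l l' : C) : rderiv f z l -> l = l' -> rderiv f z l'.
Proof. now intros H <-. Qed.

Lemma rderiv_const (a : C) (z : R) : rderiv (fun _ => a) z 0.
Proof. apply (is_derive_const (V := C_R_NormedModule)). Qed.

Lemma rderiv_RtoC (z : R) : rderiv RtoC z 1.
Proof.
apply rderiv_components. split; simpl.
- apply (is_derive_id (K := R_AbsRing)).
- apply (is_derive_const (V := R_NormedModule)).
Qed.

Lemma rderiv_plus (f g : R -> C) (z : R) (l m : C) :
  rderiv f z l -> rderiv g z m -> rderiv (fun x => f x + g x)%C z (l + m)%C.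
Proof. apply (is_derive_plus (V := C_R_NormedModule)). Qed.

Lemma rderiv_opp (f : R -> C) (z : R) (l : C) : rderiv f z l -> rderiv (fun x => - f x)%C z (- l)%C.
Proof. apply (is_derive_opp (V := C_R_NormedModule)). Qed.

Lemma rderiv_minus (f g : R -> C) (z : R) (l m : C) :
  rderiv f z l -> rderiv g z m -> rderiv (fun x => f x - g x)%C z (l - m)%C.
Proof. intros Hf Hg. apply rderiv_plus; [exact Hf | now apply rderiv_opp]. Qed.

Lemma is_derive_Rmult (f g : R -> R) (z l m : R) :
  is_derive f z l -> is_derive g z m -> is_derive (fun x => f x * g x) z (l * g z + f z * m).
Proof. intros Hf Hg. apply (is_derive_mult f g z l m Hf Hg Rmult_comm). Qed.

Lemma rderiv_mult (f g : R -> C) (z : R) (l m : C) :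
  rderiv f z l -> rderiv g z m -> rderiv (fun x => f x * g x)%C z (l * g z + f z * m)%C.
Proof.
rewrite !rderiv_components. intros [f1 f2] [g1 g2]. simpl. split.
- evar_last.
  + apply (is_derive_minus (fun x => fst (f x) * fst (g x)) (fun x => snd (f x) * snd (g x)));
      apply is_derive_Rmult; eassumption.
  + unfold minus, plus, opp; simpl. ring.
- evar_last.
  + apply (is_derive_plus (fun x => fst (f x) * snd (g x)) (fun x => snd (f x) * fst (g x)));
      apply is_derive_Rmult; eassumption.
  + unfold plus; simpl. ring.
Qed.

Lemma rderiv_scal (a : C) (f : R -> C) (z : R) (l : C) : rderiv f z l -> rderiv (fun x => a * f x)%C z (a * l)%C.
Proof.
intros H. eapply rderiv_eq; [apply rderiv_mult; [apply rderiv_const | exact H] | cbv beta; ring].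
Qed.

Lemma Cexp_plus (a b : C) : Cexp (a + b) = (Cexp a * Cexp b)%C.
Proof.
unfold Cexp. destruct a as [a1 a2], b as [b1 b2]. unfold Re, Im, Cmult, RtoC; simpl.
rewrite exp_plus, cos_plus, sin_plus. apply injective_projections; simpl; ring.
Qed.

Lemma Cexp_0 : Cexp 0 = 1.
Proof. unfold Cexp, Re, Im, Cmult, RtoC; simpl. rewrite exp_0, cos_0, sin_0. f_equal; ring. Qed.

Lemma Cexp_neq_0 (a : C) : Cexp a <> 0.
Proof.
intros H. apply C1_nz. rewrite <- Cexp_0. replace (RtoC 0) with (a + - a)%C by ring.
rewrite Cexp_plus, H. ring.
Qed.

Lemma Cexp_opp (a : C) : Cexp (- a) = (/ Cexp a)%C.
Proof.
assert (H := Cexp_neq_0 a).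
assert (E : (Cexp (- a) * Cexp a)%C = 1).
{ rewrite <- Cexp_plus, <- Cexp_0. f_equal. ring. }
replace (Cexp (- a)) with (Cexp (- a) * Cexp a * / Cexp a)%C by (field; exact H).
rewrite E. ring.
Qed.

Lemma Cmod_Cexp (a : C) : Cmod (Cexp a) = exp (Re a).
Proof.
unfold Cexp. rewrite Cmod_mult, Cmod_R, Rabs_right by (left; apply exp_pos).
unfold Cmod; simpl. replace (cos (Im a) * (cos (Im a) * 1) + sin (Im a) * (sin (Im a) * 1)) with 1.
- rewrite sqrt_1. ring.
- generalize (sin2_cos2 (Im a)). unfold Rsqr. lra.
Qed.

Lemma rderiv_Cexp (k : C) (z : R) : rderiv (fun x => Cexp (k * RtoC x)%C) z (k * Cexp (k * RtoC z))%C.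
Proof.
apply rderiv_components. destruct k as [a b]. unfold Cexp, Re, Im; simpl. split.
- apply (is_derive_ext (fun x => exp (a * x) * cos (b * x))).
  + intros t. rewrite !Rmult_0_r, Rminus_0_r, Rplus_0_l, Rmult_0_l, Rminus_0_r. reflexivity.
  + auto_derive; [exact I | ].
    rewrite !Rmult_0_r, !Rminus_0_r, !Rplus_0_l, !Rmult_0_l, !Rminus_0_r, ?Rplus_0_r. ring.
- apply (is_derive_ext (fun x => exp (a * x) * sin (b * x))).
  + intros t. rewrite !Rmult_0_r, Rminus_0_r, Rplus_0_l, Rmult_0_l, Rplus_0_r. reflexivity.
  + auto_derive; [exact I | ].
    rewrite !Rmult_0_r, !Rminus_0_r, !Rplus_0_l, !Rmult_0_l, !Rminus_0_r, ?Rplus_0_r. ring.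
Qed.

(** * Gronwall's inequality, the energy of a state, and mean value estimates *)

Lemma is_derive_nonpos_le (f df : R -> R) (a b : R) : a <= b ->
  (forall z, a <= z <= b -> is_derive f z (df z) /\ df z <= 0) -> f b <= f a.
Proof.
intros Hab H.
destruct (MVT_gen f a b df) as [x [Hx E]].
- intros x Hx. rewrite Rmin_left, Rmax_right in Hx by lra. apply H; lra.
- intros x Hx. rewrite Rmin_left, Rmax_right in Hx by lra.
  apply derivable_continuous_pt. exists (df x). apply is_derive_Reals. apply H; lra.
- rewrite Rmin_left, Rmax_right in Hx by lra. destruct (H x Hx) as [_ Hn]. nra.
Qed.

(** The function (e + F) exp(-K z) is nonincreasing. The constant [F] absorbs a bounded forcing
    term; [F] = 0 is the homogeneous case. *)
Lemma gronwall (e : R -> R) (K F T : R) :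
  (forall z, 0 <= z <= T -> exists d, is_derive e z d /\ d <= K * (e z + F)) ->
  forall z, 0 <= z <= T -> e z + F <= (e 0 + F) * exp (K * z).
Proof.
intros H z Hz.
assert (L : (e z + F) * exp (- K * z) <= (e 0 + F) * exp (- K * 0)).
(* The hypothesis only gives some derivative at each point; [Derive e] collects these values into a
   function. *)
{ apply (is_derive_nonpos_le (fun z => (e z + F) * exp (- K * z))
    (fun z => (Derive e z - K * (e z + F)) * exp (- K * z))); [lra | ].
  intros x Hx. destruct (H x) as [d [H1 H2]]; [lra | ].
  assert (Ed : Derive e x = d) by now apply is_derive_unique. rewrite Ed. split.
  - evar_last.
    + apply is_derive_Rmult with (l := d) (m := - K * exp (- K * x)).
      * evar_last; [apply (is_derive_plus e (fun _ => F) x d 0 H1); apply (is_derive_const (V := R_NormedModule)) | ].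
        unfold plus; simpl; ring.
      * auto_derive; [exact I | ring].
    + cbv beta; ring.
  - assert (He := exp_pos (- K * x)). nra. }
rewrite Rmult_0_r, exp_0, Rmult_1_r in L.
assert (E : exp (- K * z) * exp (K * z) = 1).
{ rewrite <- exp_plus. replace (- K * z + K * z) with 0 by ring. apply exp_0. }
assert (He := exp_pos (K * z)).
replace (e z + F) with ((e z + F) * exp (- K * z) * exp (K * z)) by (rewrite Rmult_assoc, E; ring).
apply Rmult_le_compat_r; lra.
Qed.

(** Squared norm of the state (y, y') of a second-order equation; the square stays differentiable
    where the state vanishes. *)
Definition energy (a b : C) : R := Cmod a ^ 2 + Cmod b ^ 2.

Lemma energy_ge_0 (a b : C) : 0 <= energy a b.
Proof. unfold energy. assert (H := pow2_ge_0 (Cmod a)). assert (H' := pow2_ge_0 (Cmod b)). lra. Qed.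

Lemma Cmod_sq (a : C) : Cmod a ^ 2 = fst a ^ 2 + snd a ^ 2.
Proof. rewrite Cmod2_alt. reflexivity. Qed.

Lemma is_derive_Cmod_sq (f : R -> C) (z : R) (l : C) :
  rderiv f z l -> is_derive (fun x => Cmod (f x) ^ 2) z (2 * (fst (f z) * fst l + snd (f z) * snd l)).
Proof.
rewrite rderiv_components. intros [H1 H2].
apply (is_derive_ext (fun x => fst (f x) * fst (f x) + snd (f x) * snd (f x))).
- intros x. rewrite Cmod_sq. simpl. lra.
- evar_last; [apply (is_derive_plus (fun x => fst (f x) * fst (f x)) (fun x => snd (f x) * snd (f x)));
    apply is_derive_Rmult; eassumption | ].
  unfold plus; simpl. ring.
Qed.

Lemma Cdot_le (a b : C) : Rabs (fst a * fst b + snd a * snd b) <= Cmod a * Cmod b.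
Proof.
replace (fst a * fst b + snd a * snd b) with (fst (a * Cconj b)%C) by (simpl; ring).
eapply Rle_trans; [apply Rabs_fst_Cmod | ]. rewrite Cmod_mult, Cmod_conj. lra.
Qed.

(** The derivative is 2<a,b> + 2<b,l>. Cauchy-Schwarz and 2xy <= x^2 + y^2 bound each term, so |b|^2
    is counted twice. *)
Lemma is_derive_energy (a b : R -> C) (z : R) (l : C) :
  rderiv a z (b z) -> rderiv b z l ->
  exists de, is_derive (fun x => energy (a x) (b x)) z de /\
    Rabs de <= energy (a z) (b z) + energy (b z) l.
Proof.
intros Ha Hb. eexists. split.
- apply (is_derive_plus (fun x => Cmod (a x) ^ 2) (fun x => Cmod (b x) ^ 2));
    apply is_derive_Cmod_sq; eassumption.
- unfold plus; simpl.
  assert (H1 := Cdot_le (a z) (b z)). assert (H2 := Cdot_le (b z) l).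
  unfold energy. apply Rabs_le_between in H1. apply Rabs_le_between in H2. apply Rabs_le_between.
  assert (G1 := pow2_ge_0 (Cmod (a z) - Cmod (b z))). assert (G2 := pow2_ge_0 (Cmod (b z) - Cmod l)).
  split; nra.
Qed.

Lemma rderiv_continuous (f : R -> C) (z : R) (l : C) : rderiv f z l -> continuous (U := C_R_NormedModule) f z.
Proof. intros H. apply (ex_derive_continuous (V := C_R_NormedModule)). now exists l. Qed.

Lemma rderiv_zero_const (f : R -> C) : (forall z, rderiv f z 0) -> forall z, f z = f 0.
Proof.
assert (Z : forall g : R -> R, (forall z, is_derive g z 0) -> forall z, g z = g 0).
{ intros g Hg z. destruct (MVT_gen g 0 z (fun _ => 0)) as [x [_ E]].
  - intros x _. apply Hg.
  - intros x _. apply derivable_continuous_pt. exists 0. apply is_derive_Reals, Hg.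
  - lra. }
intros H z. apply injective_projections.
- apply (Z (fun x => fst (f x))). intros x. apply (proj1 (rderiv_components f x 0) (H x)).
- apply (Z (fun x => snd (f x))). intros x. apply (proj1 (rderiv_components f x 0) (H x)).
Qed.

Definition antideriv (f : R -> C) (z : R) : C := RInt (V := C_R_CompleteNormedModule) f 0 z.

Lemma antideriv_0 (f : R -> C) : antideriv f 0 = 0.
Proof. unfold antideriv. now rewrite RInt_point. Qed.

Lemma rderiv_antideriv (f : R -> C) :
  (forall z, continuous (U := C_R_NormedModule) f z) -> forall z, rderiv (antideriv f) z (f z).
Proof.
intros Hf z. apply (is_derive_RInt (V := C_R_CompleteNormedModule) f (antideriv f) 0 z); [ | apply Hf].
apply filter_forall. intros x. apply (RInt_correct (V := C_R_CompleteNormedModule)).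
apply (ex_RInt_continuous (V := C_R_CompleteNormedModule)). intros y _. apply Hf.
Qed.

(** Real and imaginary parts need not share a mean value point, so each is treated alone; adding the
    two bounds gives the factor 2. *)
Lemma rderiv_mvt (f df : R -> C) (K : R) :
  (forall t, 0 <= t <= 1 -> rderiv f t (df t) /\ Cmod (df t) <= K) -> Cmod (f 1 - f 0)%C <= 2 * K.
Proof.
intros H.
assert (G : forall g dg : R -> R, (forall t, 0 <= t <= 1 -> is_derive g t (dg t) /\ Rabs (dg t) <= K) ->
  Rabs (g 1 - g 0) <= K).
{ intros g dg Hg. destruct (MVT_gen g 0 1 dg) as [x [Hx E]].
  - intros x Hx. rewrite Rmin_left, Rmax_right in Hx by lra. apply Hg; lra.
  - intros x Hx. rewrite Rmin_left, Rmax_right in Hx by lra.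
    apply derivable_continuous_pt. exists (dg x). apply is_derive_Reals, Hg; lra.
  - rewrite Rmin_left, Rmax_right in Hx by lra.
    rewrite E, Rminus_0_r, Rmult_1_r. apply Hg; lra. }
eapply Rle_trans; [apply Cmod_le_sum | ].
assert (G1 := G (fun t => fst (f t)) (fun t => fst (df t))).
assert (G2 := G (fun t => snd (f t)) (fun t => snd (df t))).
change (fst (f 1 - f 0)%C) with (fst (f 1) - fst (f 0)).
change (snd (f 1 - f 0)%C) with (snd (f 1) - snd (f 0)).
apply Rle_trans with (K + K); [ | lra].
apply Rplus_le_compat; [apply G1 | apply G2]; intros t Ht; destruct (H t Ht) as [H1 H2];
  apply rderiv_components in H1; (split; [apply H1 | ]).
- eapply Rle_trans; [apply Rabs_fst_Cmod | exact H2].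
- eapply Rle_trans; [apply Rabs_snd_Cmod | exact H2].
Qed.

Lemma rderiv_is_derive (f : R -> C) (z : R) (l : C) :
  is_derive (K := R_AbsRing) (V := C_R_NormedModule) f z l -> rderiv f z l.
Proof. intros H; exact H. Qed.

Global Opaque rderiv.

(** * Formal power series and kernels of 2x2 matrices of series *)

(* [ring] does not recognise [C] when it is displayed as the carrier of a Coquelicot structure. *)
Ltac cring := cbv beta; apply Ceq_minus; ring.

Notation series := (nat -> C).

(** Cauchy product. Splitting off the head of the first factor makes the recursion structural, with
    the tail as new first factor; the inductions on [k] therefore generalise over [p]. *)
Fixpoint conv (p q : series) (k : nat) : C :=
  match k with
  | O => (p O * q O)%C
  | S k' => (p O * q (S k') + conv (fun j => p (S j)) q k')%C
  end.

Definition sadd (p q : series) : series := fun k => (p k + q k)%C.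
Definition sopp (p : series) : series := fun k => (- p k)%C.
Definition ssub (p q : series) : series := fun k => (p k - q k)%C.
Definition szero : series := fun _ => RtoC 0.
Definition sconst (a : C) : series := fun k => match k with O => a | S _ => RtoC 0 end.

Lemma conv_sadd_l (p q r : series) : conv (sadd p q) r = sadd (conv p r) (conv q r).
Proof.
apply functional_extensionality; intros k. revert p q.
induction k as [ | k IH]; intros p q; simpl; unfold sadd; simpl; [ring | ].
change (fun j => (p (S j) + q (S j))%C) with (sadd (fun j => p (S j)) (fun j => q (S j))).
rewrite IH. unfold sadd. ring.
Qed.

Lemma conv_S_r (p q : series) (k : nat) :
  conv p q (S k) = (conv p (fun j => q (S j)) k + p (S k) * q O)%C.
Proof.
revert p; induction k as [ | k IH]; intros p; [simpl; ring | ].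
change (conv p q (S (S k))) with (p O * q (S (S k)) + conv (fun j => p (S j)) q (S k))%C.
rewrite IH. simpl. ring.
Qed.

Lemma conv_comm (p q : series) : conv p q = conv q p.
Proof.
apply functional_extensionality; intros k. revert p q.
induction k as [ | k IH]; intros p q; [simpl; ring | ].
rewrite conv_S_r, IH. simpl. ring.
Qed.

Lemma conv_scal_l (a : C) (p q : series) (k : nat) :
  conv (fun j => a * p j)%C q k = (a * conv p q k)%C.
Proof.
revert p; induction k as [ | k IH]; intros p; simpl; [ring | ].
rewrite (IH (fun j => p (S j))). ring.
Qed.

Lemma conv_assoc (p q r : series) : conv p (conv q r) = conv (conv p q) r.
Proof.
apply functional_extensionality; intros k. revert p.
induction k as [ | k IH]; intros p; [simpl; ring | ].
change (conv (conv p q) r (S k)) with (p O * q O * r (S k) +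
  conv (sadd (fun j => p O * q (S j))%C (conv (fun j => p (S j)) q)) r k)%C.
rewrite conv_sadd_l. unfold sadd. rewrite (conv_scal_l (p O) (fun j => q (S j))), <- IH. simpl. ring.
Qed.

Lemma conv_sconst_l (a : C) (p : series) : conv (sconst a) p = fun k => (a * p k)%C.
Proof.
apply functional_extensionality; intros k.
assert (Z : forall q k, conv (fun _ => RtoC 0) q k = RtoC 0).
{ intros q; induction k0 as [ | k0 IH]; simpl; [ring | rewrite IH; ring]. }
destruct k as [ | k]; simpl; [ring | rewrite Z; ring].
Qed.

(** The ring laws hold for Leibniz equality, by functional extensionality. Hence [ring] proves
    identities of determinants and matrix products of series, and rewriting with them is
    unrestricted. *)
Lemma series_ring :
  ring_theory szero (sconst 1) sadd conv ssub sopp (@eq series).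
Proof.
constructor.
- intros; apply functional_extensionality; intros k; unfold sadd, szero; ring.
- intros; apply functional_extensionality; intros k; unfold sadd; ring.
- intros; apply functional_extensionality; intros k; unfold sadd; ring.
- intros; rewrite conv_sconst_l; apply functional_extensionality; intros k; ring.
- apply conv_comm.
- apply conv_assoc.
- apply conv_sadd_l.
- intros; apply functional_extensionality; intros k; unfold sadd, ssub, sopp; ring.
- intros; apply functional_extensionality; intros k; unfold sadd, sopp, szero; ring.
Qed.

Add Ring series_ring : series_ring.

(** Multiplication by the formal parameter h. *)
Definition sh (p : series) : series := fun k => match k with O => RtoC 0 | S j => p j end.

Lemma conv_sh_l (p q : series) : conv (sh p) q = sh (conv p q).
Proof.
apply functional_extensionality; intros [ | k]; simpl; [ring | ].
change (fun j => p j) with p. ring.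
Qed.

(** Division by h^a, exact when the first [a] coefficients vanish. *)
Definition drop (a : nat) (p : series) : series := fun k => p (a + k)%nat.
Definition vanish (m : nat) (p : series) : Prop := forall k, (k < m)%nat -> p k = 0.

Lemma vanish_conv (a b : nat) (p q : series) :
  vanish a p -> vanish b q -> vanish (a + b) (conv p q).
Proof.
revert p; induction a as [ | a IH]; intros p Hp Hq.
- intros k Hk. revert p Hp.
  induction k as [ | k IHk]; intros p Hp; simpl.
  + rewrite (Hq O Hk). ring.
  + rewrite (Hq (S k) Hk), IHk; [ring | lia | intros j Hj; lia].
- intros [ | k] Hk; simpl; rewrite (Hp O) by lia; [ring | ].
  rewrite (IH (fun j => p (S j))); [ring | | exact Hq | lia].
  intros j Hj; apply Hp; lia.
Qed.

Lemma vanish_conv_r (m : nat) (p q : series) : vanish m q -> vanish m (conv p q).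
Proof. intros H. apply (vanish_conv 0 m); [intros k Hk; lia | exact H]. Qed.

Lemma vanish_sadd (m : nat) (p q : series) : vanish m p -> vanish m q -> vanish m (sadd p q).
Proof. intros Hp Hq k Hk. unfold sadd. rewrite Hp, Hq by exact Hk. ring. Qed.

Lemma vanish_ssub (m : nat) (p q : series) : vanish m p -> vanish m q -> vanish m (ssub p q).
Proof. intros Hp Hq k Hk. unfold ssub. rewrite Hp, Hq by exact Hk. ring. Qed.

Lemma conv_drop_l (a : nat) (p q : series) (k : nat) :
  vanish a p -> conv p q (a + k) = conv (drop a p) q k.
Proof.
revert p; induction a as [ | a IH]; intros p Hp; [reflexivity | ].
simpl. rewrite (Hp O) by lia. rewrite (IH (fun j => p (S j))).
- unfold drop; simpl. ring.
- intros j Hj; apply Hp; lia.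
Qed.

(** Removing a factor h^a lowers the truncation order by [a]. For m <= a the subtraction gives 0 and
    both sides hold trivially. *)
Lemma vanish_conv_drop (a m : nat) (p q : series) :
  vanish a p -> (vanish m (conv p q) <-> vanish (m - a) (conv (drop a p) q)).
Proof.
intros Hp. split; intros H k Hk.
- rewrite <- conv_drop_l by exact Hp. apply H. lia.
- destruct (Nat.lt_ge_cases k a) as [L | L].
  + apply (vanish_conv a 0 p q Hp); [intros j Hj; lia | lia].
  + replace k with (a + (k - a))%nat by lia. rewrite conv_drop_l by exact Hp. apply H. lia.
Qed.

Definition order (p : series) (n : nat) : Prop := vanish n p /\ p n <> 0.

Lemma order_drop (p : series) (n : nat) : order p n -> drop n p O <> 0.
Proof. intros [_ H]. unfold drop. now rewrite Nat.add_0_r. Qed.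

Lemma order_conv (p q : series) (a b : nat) : order p a -> order q b -> order (conv p q) (a + b).
Proof.
intros [Hp Hpa] [Hq Hqb]. split; [now apply vanish_conv | ].
rewrite conv_drop_l, conv_comm by exact Hp.
rewrite <- (Nat.add_0_r b), conv_drop_l by exact Hq.
simpl. unfold drop. rewrite !Nat.add_0_r. now apply Cmult_neq_0.
Qed.

Lemma order_unique (p : series) (a b : nat) : order p a -> order p b -> a = b.
Proof.
intros [H1 H2] [H3 H4]. destruct (Nat.lt_trichotomy a b) as [L | [L | L]]; [ | exact L | ].
- now elim H2; apply H3.
- now elim H4; apply H1.
Qed.

Lemma least_nat (P : nat -> Prop) (k : nat) : P k -> exists n, P n /\ forall j, (j < n)%nat -> ~ P j.
Proof.
induction k as [k IH] using lt_wf_ind. intros Hk.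
destruct (classic (exists j, (j < k)%nat /\ P j)) as [[j [Hj Hp]] | N].
- now apply (IH j).
- exists k. split; [exact Hk | intros j Hj Hp; apply N; now exists j].
Qed.

Lemma order_exists (p : series) (k : nat) : p k <> 0 -> exists n, order p n.
Proof.
intros Hk. destruct (least_nat (fun k => p k <> 0) k Hk) as [n [Hn Hl]].
exists n. split; [intros j Hj; now apply NNPP, Hl | exact Hn].
Qed.

(* Geometric series: [inv_partial x n = 1 + x + ... + x^n] inverts [1 - x] modulo [h^(n+1)] when [x] has no constant term. *)
Fixpoint inv_partial (x : series) (n : nat) : series :=
  match n with
  | O => sconst 1
  | S n' => sadd (sconst 1) (conv x (inv_partial x n'))
  end.

Lemma inv_partial_step (x : series) (n : nat) : vanish 1 x ->
  vanish (S n) (ssub (inv_partial x (S n)) (inv_partial x n)).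
Proof.
intros Hx. induction n as [ | n IH].
- simpl. replace (ssub (sadd (sconst 1) (conv x (sconst 1))) (sconst 1)) with x by ring. exact Hx.
- simpl in *.
  replace (ssub _ _) with (conv x (ssub (sadd (sconst 1) (conv x (inv_partial x n))) (inv_partial x n))) by ring.
  now apply (vanish_conv 1 (S n)).
Qed.

Lemma inv_partial_stable (x : series) (n k : nat) : vanish 1 x -> (k <= n)%nat ->
  inv_partial x n k = inv_partial x k k.
Proof.
intros Hx Hk. induction Hk as [ | n Hk IH]; [reflexivity | ].
rewrite <- IH. apply Ceq_minus. now apply (inv_partial_step x n Hx k); lia.
Qed.

Lemma series_inverse (p : series) : p O <> 0 -> exists w, conv w p = sconst 1.
Proof.
intros Hp. set (x := ssub (sconst 1) (conv (sconst (/ p O)) p)).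
assert (Hx : vanish 1 x).
{ intros k Hk. replace k with O by lia. unfold x, ssub. simpl. now field. }
(* Here p = p(0) (1 - x). Coefficient [k] of the geometric series in [x] no longer changes after [k]
   steps, so the diagonal is its formal limit. *)
set (w := fun k => inv_partial x k k).
assert (E : conv x w = ssub w (sconst 1)).
{ apply functional_extensionality; intros k.
  assert (V : vanish (S k) (conv x (ssub w (inv_partial x k)))).
  { apply vanish_conv_r. intros j Hj. unfold ssub, w. rewrite (inv_partial_stable x k j) by (assumption || lia). ring. }
  replace (conv x w) with (sadd (conv x (ssub w (inv_partial x k))) (ssub (inv_partial x (S k)) (sconst 1)))
    by (simpl; ring).
  unfold sadd at 1. rewrite V by lia. unfold ssub. rewrite (inv_partial_stable x (S k) k) by (assumption || lia).
  fold (w k). ring. }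
exists (conv w (sconst (/ p O))).
replace (conv (conv w (sconst (/ p O))) p) with (ssub w (conv x w)) by (unfold x; ring).
rewrite E. ring.
Qed.

Definition mono (a : nat) : series := fun k => if Nat.eq_dec k a then RtoC 1 else RtoC 0.

Lemma mono_eq (a : nat) : mono a a = 1.
Proof. unfold mono. destruct (Nat.eq_dec a a); [reflexivity | lia]. Qed.

Lemma mono_neq (a k : nat) : k <> a -> mono a k = 0.
Proof. unfold mono. destruct (Nat.eq_dec k a); [lia | reflexivity]. Qed.

Lemma vanish_mono (a : nat) : vanish a (mono a).
Proof. intros k Hk. apply mono_neq. lia. Qed.

Lemma drop_mono (a : nat) : drop a (mono a) = sconst 1.
Proof.
apply functional_extensionality; intros k. unfold drop.
destruct k as [ | k]; [rewrite Nat.add_0_r; apply mono_eq | apply mono_neq; lia].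
Qed.

Lemma conv_mono_drop (a : nat) (p : series) : vanish a p -> p = conv (mono a) (drop a p).
Proof.
intros Hp. apply functional_extensionality; intros k.
destruct (Nat.lt_ge_cases k a) as [L | L].
- rewrite (Hp k L). symmetry. apply (vanish_conv a 0); [apply vanish_mono | intros j Hj; lia | lia].
- replace k with (a + (k - a))%nat by lia. rewrite conv_drop_l by apply vanish_mono.
  rewrite drop_mono. replace (conv (sconst 1) (drop a p)) with (drop a p) by ring. reflexivity.
Qed.

Lemma vanish_conv_mono (a m : nat) (p : series) : vanish m (conv (mono a) p) <-> vanish (m - a) p.
Proof.
rewrite (vanish_conv_drop a m) by apply vanish_mono. rewrite drop_mono.
now replace (conv (sconst 1) p) with p by ring.
Qed.

(* Pairs of series are identified when their first [m] coefficients agree, as in [has_dim]. *)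
Definition kdim (m : nat) (P : series -> series -> Prop) (d : nat) : Prop :=
  exists e1 e2 : nat -> series,
    (forall i, (1 <= i <= d)%nat -> P (e1 i) (e2 i)) /\
    (forall u v, P u v -> exists a : nat -> C, forall k, (k < m)%nat ->
       u k = sum_n_m (fun i => (a i * e1 i k)%C) 1 d /\
       v k = sum_n_m (fun i => (a i * e2 i k)%C) 1 d) /\
    (forall a : nat -> C,
       (forall k, (k < m)%nat ->
          sum_n_m (fun i => (a i * e1 i k)%C) 1 d = RtoC 0 /\
          sum_n_m (fun i => (a i * e2 i k)%C) 1 d = RtoC 0) ->
       forall i, (1 <= i <= d)%nat -> a i = 0).

Lemma kdim_iff (m : nat) (P Q : series -> series -> Prop) (d : nat) :
  (forall u v, P u v <-> Q u v) -> kdim m P d -> kdim m Q d.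
Proof.
intros E [e1 [e2 [H1 [H2 H3]]]]. exists e1, e2. split; [ | split; [ | exact H3]].
- intros i Hi. now apply E, H1.
- intros u v H. now apply H2, E.
Qed.

Lemma kdim_swap (m : nat) (P : series -> series -> Prop) (d : nat) :
  kdim m P d -> kdim m (fun u v => P v u) d.
Proof.
intros [e1 [e2 [H1 [H2 H3]]]]. exists e2, e1. split; [exact H1 | split].
- intros u v H. destruct (H2 v u H) as [a Ha]. exists a. intros k Hk. destruct (Ha k Hk); now split.
- intros a Ha. apply H3. intros k Hk. destruct (Ha k Hk); now split.
Qed.

Lemma kdim_0 (m : nat) (P : series -> series -> Prop) :
  (forall u v, P u v -> vanish m u /\ vanish m v) -> kdim m P 0.
Proof.
intros H. exists (fun _ => szero), (fun _ => szero). split; [intros i Hi; lia | split].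
- intros u v Huv. exists szero. intros k Hk. destruct (H u v Huv) as [Hu Hv].
  rewrite !sum_n_m_zero by lia. now rewrite Hu, Hv.
- intros a Ha i Hi; lia.
Qed.

Lemma sum_n_m_C_Sm (f : nat -> C) (d : nat) : sum_n_m f 1 (S d) = (sum_n_m f 1 d + f (S d))%C.
Proof. apply (sum_n_Sm f 1 d). lia. Qed.

Lemma sum_n_m_zero_C (f : nat -> C) (d : nat) : (forall i, (1 <= i <= d)%nat -> f i = 0) -> sum_n_m f 1 d = RtoC 0.
Proof.
induction d as [ | d IH]; intros H; [apply (sum_n_m_zero f 1 0); lia | ].
rewrite sum_n_m_C_Sm, IH by (intros i Hi; apply H; lia). rewrite H by lia. apply Cplus_0_r.
Qed.

Definition side (b : bool) (u v : series) : series := if b then u else v.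

(** One coefficient of [u] or of [v], as chosen by [b], is a linear functional on [P], and [P'] is
    its kernel. A vector on which it takes the value 1 completes a basis of [P'] to one of [P]. *)
Lemma kdim_step (m : nat) (P P' : series -> series -> Prop) (d : nat)
    (b : bool) (i : nat) (x1 x2 : series) : (i < m)%nat ->
  (forall u v, P' u v <-> P u v /\ side b u v i = 0) ->
  (forall u v a, P u v -> P (fun k => u k - a * x1 k)%C (fun k => v k - a * x2 k)%C) ->
  P x1 x2 -> side b x1 x2 i = 1 ->
  kdim m P' d -> kdim m P (S d).
Proof.
intros Hi HP Hsub Hx Hone [e1 [e2 [H1 [H2 H3]]]].
set (ext := fun (e : nat -> series) (x : series) j => if Nat.eq_dec j (S d) then x else e j).
assert (Ein : forall e x j, (1 <= j <= d)%nat -> ext e x j = e j).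
{ intros e x j Hj. unfold ext. destruct (Nat.eq_dec j (S d)); [lia | reflexivity]. }
assert (Eout : forall e x, ext e x (S d) = x).
{ intros e x. unfold ext. destruct (Nat.eq_dec (S d) (S d)); [reflexivity | lia]. }
assert (Esum : forall e x (a : nat -> C) k, sum_n_m (fun j => (a j * ext e x j k)%C) 1 (S d) =
   (sum_n_m (fun j => (a j * e j k)%C) 1 d + a (S d) * x k)%C).
{ intros e x a k. rewrite sum_n_m_C_Sm, Eout. f_equal.
  apply sum_n_m_ext_loc. intros j Hj. now rewrite Ein. }
exists (ext e1 x1), (ext e2 x2). split; [ | split].
- intros j Hj. destruct (Nat.eq_dec j (S d)) as [-> | N]; [now rewrite !Eout | ].
  rewrite !Ein by lia. now apply HP, H1; lia.
(* Subtracting [l] times the new vector kills the tested coefficient, so the basis of [P'] expresses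
   the remainder. *)
- intros u v Huv. set (l := side b u v i).
  destruct (H2 (fun k => u k - l * x1 k)%C (fun k => v k - l * x2 k)%C) as [a Ha].
  { apply HP. split; [now apply Hsub | ]. unfold l.
    destruct b; simpl in *; rewrite Hone; cring. }
  exists (fun j => if Nat.eq_dec j (S d) then l else a j). intros k Hk.
  assert (S1 : forall e, sum_n_m (fun j => ((if Nat.eq_dec j (S d) then l else a j) * e j k)%C) 1 d =
     sum_n_m (fun j => (a j * e j k)%C) 1 d).
  { intros e. apply sum_n_m_ext_loc. intros j Hj. destruct (Nat.eq_dec j (S d)); [lia | reflexivity]. }
  destruct (Ha k Hk) as [Hu Hv].
  rewrite !Esum, !S1, <- Hu, <- Hv. destruct (Nat.eq_dec (S d) (S d)); [split; cring | lia].
- intros a Ha.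
  assert (Hl : a (S d) = 0).
  { destruct (Ha i Hi) as [Hu Hv]. rewrite Esum in Hu, Hv.
    assert (Z : forall j, (1 <= j <= d)%nat -> side b (e1 j) (e2 j) i = 0) by (intros j Hj; now apply HP, H1).
    destruct b; simpl in *.
    - rewrite sum_n_m_zero_C in Hu by (intros j Hj; rewrite Z by exact Hj; cring).
      rewrite Hone in Hu. rewrite <- Hu. cring.
    - rewrite sum_n_m_zero_C in Hv by (intros j Hj; rewrite Z by exact Hj; cring).
      rewrite Hone in Hv. rewrite <- Hv. cring. }
  intros j Hj. destruct (Nat.eq_dec j (S d)) as [-> | N]; [exact Hl | ].
  apply H3; [ | lia]. intros k Hk. destruct (Ha k Hk) as [Hu Hv].
  rewrite Esum, Hl in Hu, Hv. split; [rewrite <- Hu | rewrite <- Hv]; cring.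
Qed.

Lemma conv_sub_scal (g v x : series) (a : C) :
  conv g (fun k => v k - a * x k)%C = fun k => (conv g v k - a * conv g x k)%C.
Proof.
change (fun k => v k - a * x k)%C with (ssub v (fun k => a * x k)%C).
rewrite <- conv_sconst_l.
replace (conv g (ssub v (conv (sconst a) x))) with (ssub (conv g v) (conv (sconst a) (conv g x))) by ring.
rewrite (conv_sconst_l a (conv g x)). reflexivity.
Qed.

(** Modulo h^m, [v] runs over the multiples of h^m2, and then [u] is -g v plus any multiple of h^m1.
    This leaves m - m2 and m - m1 free coefficients. *)
Lemma kdim_triangular (m m1 m2 : nat) (g : series) : (m2 <= m1 <= m)%nat ->
  kdim m (fun u v => vanish m1 (sadd u (conv g v)) /\ vanish m2 v) ((m - m1) + (m - m2)).
Proof.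
intros Hm.
set (K := fun u v => vanish m1 (sadd u (conv g v)) /\ vanish m2 v).
(* A filtration of [K] by the degrees still allowed in [u] and [v]. It is climbed one coefficient at
   a time: [A] releases those of [u] while [v] is zero modulo h^m, then [B] releases those of
   [v]. *)
set (Q := fun i j u v => K u v /\ (forall k, (i <= k < m)%nat -> u k = 0) /\ (forall k, (j <= k < m)%nat -> v k = 0)).
assert (Ksub : forall u v x y a, K u v -> K x y -> K (fun k => u k - a * x k)%C (fun k => v k - a * y k)%C).
{ intros u v x y a [H1 H2] [H3 H4]. split; intros k Hk.
  - assert (E1 := H1 k Hk). assert (E2 := H3 k Hk). unfold sadd in *. rewrite conv_sub_scal.
    replace (u k - a * x k + (conv g v k - a * conv g y k))%C
      with ((u k + conv g v k) - a * (x k + conv g y k))%C by ring.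
    rewrite E1, E2. ring.
  - rewrite H2, H4 by exact Hk. ring. }
assert (A : forall i, (m1 + i <= m)%nat -> kdim m (Q (m1 + i)%nat m2) i).
{ induction i as [ | i IH]; intros Hi.
  - apply kdim_0. intros u v [[H1 H2] [H3 H4]].
    assert (Hv : vanish m v).
    { intros k Hk. destruct (Nat.lt_ge_cases k m2); [now apply H2 | apply H4; lia]. }
    split; [ | exact Hv]. intros k Hk. destruct (Nat.lt_ge_cases k m1) as [L | L]; [ | apply H3; lia].
    assert (E := H1 k L). unfold sadd in E. rewrite (vanish_conv_r m g v Hv k Hk) in E. rewrite <- E. ring.
  - apply (kdim_step m _ (Q (m1 + i)%nat m2) i true (m1 + i)%nat (mono (m1 + i)) szero); simpl.
    + lia.
    + intros u v. split.
      * intros [H1 [H2 H3]]. split; [ | apply H2; lia]. split; [exact H1 | split; [ | exact H3]]. intros k Hk; apply H2; lia.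
      * intros [[H1 [H2 H3]] H4]. split; [exact H1 | split; [ | exact H3]]. intros k Hk.
        destruct (Nat.eq_dec k (m1 + i)) as [-> | N]; [exact H4 | apply H2; lia].
    + intros u v a [H1 [H2 H3]]. split; [ | split].
      * apply Ksub; [exact H1 | ]. split; [ | intros k Hk; reflexivity].
        intros k Hk. unfold sadd. rewrite mono_neq by lia.
        rewrite (vanish_conv_r m1 g szero) by (assumption || (intros j Hj; reflexivity)). ring.
      * intros k Hk. rewrite H2, mono_neq by lia. ring.
      * intros k Hk. rewrite H3 by lia. unfold szero. ring.
    + split; [ | split].
      * split; [ | intros k Hk; reflexivity].
        intros k Hk. unfold sadd. rewrite mono_neq by lia.
        rewrite (vanish_conv_r m1 g szero) by (assumption || (intros j Hj; reflexivity)). ring.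
      * intros k Hk. apply mono_neq. lia.
      * intros k Hk. reflexivity.
    + apply mono_eq.
    + apply IH. lia. }
assert (B : forall j, (m2 + j <= m)%nat -> kdim m (Q m (m2 + j)%nat) (m - m1 + j)).
{ induction j as [ | j IH]; intros Hj.
  - rewrite !Nat.add_0_r. specialize (A (m - m1)%nat). replace (m1 + (m - m1))%nat with m in A by lia. apply A; lia.
  - rewrite !Nat.add_succ_r.
    (* The vector that releases coefficient m2 + j of [v]: the choice u = -g v satisfies the first
       condition exactly. *)
    assert (Kx : K (sopp (conv g (mono (m2 + j)))) (mono (m2 + j))).
    { split; intros k Hk; [unfold sadd, sopp; ring | apply mono_neq; lia]. }
    apply (kdim_step m _ (Q m (m2 + j)%nat) _ false (m2 + j)%nat (sopp (conv g (mono (m2 + j)))) (mono (m2 + j))); simpl.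
    + lia.
    + intros u v. split.
      * intros [H1 [H2 H3]]. split; [ | apply H3; lia]. split; [exact H1 | split; [exact H2 | ]]. intros k Hk; apply H3; lia.
      * intros [[H1 [H2 H3]] H4]. split; [exact H1 | split; [exact H2 | ]]. intros k Hk.
        destruct (Nat.eq_dec k (m2 + j)) as [-> | N]; [exact H4 | apply H3; lia].
    + intros u v a [H1 [H2 H3]]. split; [now apply Ksub | split]; intros k Hk; [lia | ].
      rewrite H3, mono_neq by lia. ring.
    + split; [exact Kx | split]; intros k Hk; [lia | apply mono_neq; lia].
    + apply mono_eq.
    + apply IH. lia. }
specialize (B (m - m2)%nat). replace (m2 + (m - m2))%nat with m in B by lia.
apply (kdim_iff m (Q m m)); [ | apply B; lia].
intros u v. split; [now intros [H _] | intros H; split; [exact H | split; intros k Hk; lia]].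
Qed.

(** Kernel modulo h^m of the matrix with rows (A, B) and (E, D); the lower left entry is named [E]
    because [C] denotes the complex numbers. *)
Definition Ker (m : nat) (A B E D : series) (u v : series) : Prop :=
  vanish m (sadd (conv A u) (conv B v)) /\ vanish m (sadd (conv E u) (conv D v)).

Definition sdet (A B E D : series) : series := ssub (conv A D) (conv B E).

(* After division by [h^a] the corner entry is a unit, and eliminating with it leaves the Schur complement, of order [n - 2a]. *)
Lemma kdim_Ker_corner (m n a : nat) (A B E D : series) :
  vanish a A -> vanish a B -> vanish a E -> vanish a D -> A a <> 0 ->
  order (sdet A B E D) n ->
  (a <= n - a)%nat /\ kdim m (Ker m A B E D) (Nat.min a m + Nat.min (n - a) m).
Proof.
intros HA HB HE HD Ha Hn.
set (p := drop a A). set (q := drop a B). set (r := drop a E). set (t := drop a D).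
set (X := mono a).
assert (EA : A = conv X p) by now apply conv_mono_drop.
assert (EB : B = conv X q) by now apply conv_mono_drop.
assert (EE : E = conv X r) by now apply conv_mono_drop.
assert (ED : D = conv X t) by now apply conv_mono_drop.
destruct (series_inverse p) as [w Hw]; [unfold p, drop; now rewrite Nat.add_0_r | ].
set (de := ssub t (conv r (conv w q))).
assert (Edet : sdet A B E D = conv A (conv X de)).
{ unfold sdet. rewrite EA, EB, EE, ED. unfold de.
  replace (conv (conv X q) (conv X r)) with (conv (conv w p) (conv (conv X q) (conv X r))) by (rewrite Hw; ring).
  ring. }
assert (Hs : exists s, order de s).
{ apply NNPP. intros N. destruct Hn as [_ Hn]. apply Hn.
  assert (Z : forall k, de k = 0).
  { intros k. apply NNPP. intros Hk. apply N. now apply (order_exists de k). }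
  rewrite Edet. apply (vanish_conv_r (S n)); [ | lia]. apply vanish_conv_r. intros k _; apply Z. }
destruct Hs as [s Hs].
assert (HX : order X a) by (split; [apply vanish_mono | unfold X; rewrite mono_eq; apply C1_nz]).
assert (Hns : n = (a + (a + s))%nat).
{ apply (order_unique (sdet A B E D)); [exact Hn | ]. rewrite Edet.
  apply order_conv; [now split | now apply order_conv]. }
split; [lia | ].
assert (Ede : de = conv (mono s) (drop s de)) by (apply conv_mono_drop, Hs).
destruct (series_inverse (drop s de)) as [w' Hw']; [now apply order_drop | ].
(* Brings the count into the shape of [kdim_triangular] with m1 = m - a and m2 = m - a - s, using n
   - a = a + s. *)
replace (Nat.min a m + Nat.min (n - a) m)%nat with ((m - (m - a)) + (m - (m - a - s)))%nat by lia.
apply (kdim_iff m (fun u v => vanish (m - a) (sadd u (conv (conv w q) v)) /\ vanish (m - a - s) v));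
  [ | apply kdim_triangular; lia].
intros u v. unfold Ker.
replace (sadd (conv A u) (conv B v)) with (conv X (sadd (conv p u) (conv q v))) by (rewrite EA, EB; ring).
replace (sadd (conv E u) (conv D v)) with (conv X (sadd (conv r u) (conv t v))) by (rewrite EE, ED; ring).
unfold X. rewrite !vanish_conv_mono, <- (vanish_conv_mono s (m - a) v).
set (f1 := sadd u (conv (conv w q) v)).
assert (F1 : sadd (conv p u) (conv q v) = conv p f1).
{ unfold f1. replace (conv q v) with (conv (conv w p) (conv q v)) by (rewrite Hw; ring). ring. }
assert (F2 : sadd (conv r u) (conv t v) = sadd (conv r f1) (conv de v)) by (unfold f1, de; ring).
rewrite F1, F2. split.
- intros [H1 H2]. split; [now apply vanish_conv_r | ].
  apply vanish_sadd; [now apply vanish_conv_r | ].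
  rewrite Ede. replace (conv (conv (mono s) (drop s de)) v) with (conv (drop s de) (conv (mono s) v)) by ring.
  now apply vanish_conv_r.
- intros [H1 H2].
  assert (G1 : vanish (m - a) f1).
  { replace f1 with (conv w (conv p f1)); [now apply vanish_conv_r | ].
    replace (conv w (conv p f1)) with (conv (conv w p) f1) by ring. rewrite Hw; ring. }
  split; [exact G1 | ].
  replace (conv (mono s) v) with (conv w' (ssub (sadd (conv r f1) (conv de v)) (conv r f1))).
  + apply vanish_conv_r, vanish_ssub; [exact H2 | now apply vanish_conv_r].
  + rewrite Ede.
    replace (conv w' _) with (conv (conv w' (drop s de)) (conv (mono s) v)) by ring. rewrite Hw'. ring.
Qed.

Lemma order_sopp (p : series) (n : nat) : order p n -> order (sopp p) n.
Proof.
intros [H1 H2]. split; unfold sopp.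
- intros k Hk. rewrite H1 by exact Hk. ring.
- intros E. apply H2. replace (p n) with (- - p n)%C by ring. rewrite E. ring.
Qed.

(** Some entry attains the least order [a]; swapping rows or columns moves it to the corner and
    changes the determinant at most by a sign. The dimension min(a, m) + min(n - a, m) is at most a
    + (n - a) = n, with equality as soon as m >= n. *)
Lemma Ker_dim (A B E D : series) (n : nat) : order (sdet A B E D) n ->
  forall m, exists d, kdim m (Ker m A B E D) d /\ (d <= n)%nat /\ ((n <= m)%nat -> d = n).
Proof.
intros Hn m.
assert (He : exists k, A k <> 0 \/ B k <> 0 \/ E k <> 0 \/ D k <> 0).
{ apply NNPP. intros N. destruct Hn as [H1 H2]. apply H2.
  apply (vanish_ssub (S n)); [ | | lia]; apply vanish_conv_r; intros k _; apply NNPP; intros Hk; apply N; exists k; tauto. }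
destruct He as [k0 Hk0].
destruct (least_nat (fun k => A k <> 0 \/ B k <> 0 \/ E k <> 0 \/ D k <> 0) k0 Hk0) as [a [Ha Hl]].
assert (HA : vanish a A) by (intros k Hk; apply NNPP; intros N; apply (Hl k Hk); tauto).
assert (HB : vanish a B) by (intros k Hk; apply NNPP; intros N; apply (Hl k Hk); tauto).
assert (HE : vanish a E) by (intros k Hk; apply NNPP; intros N; apply (Hl k Hk); tauto).
assert (HD : vanish a D) by (intros k Hk; apply NNPP; intros N; apply (Hl k Hk); tauto).
exists (Nat.min a m + Nat.min (n - a) m)%nat.
assert (G : (a <= n - a)%nat /\ kdim m (Ker m A B E D) (Nat.min a m + Nat.min (n - a) m));
  [ | destruct G as [G1 G2]; split; [exact G2 | lia]].
destruct Ha as [Ha | [Ha | [Ha | Ha]]].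
- now apply kdim_Ker_corner.
- destruct (kdim_Ker_corner m n a B A D E) as [G1 G2]; try assumption.
  + replace (sdet B A D E) with (sopp (sdet A B E D)) by (unfold sdet; ring). now apply order_sopp.
  + split; [exact G1 | ]. apply kdim_swap in G2. revert G2. apply kdim_iff. intros u v. unfold Ker.
    replace (sadd (conv B v) (conv A u)) with (sadd (conv A u) (conv B v)) by ring.
    replace (sadd (conv D v) (conv E u)) with (sadd (conv E u) (conv D v)) by ring. tauto.
- destruct (kdim_Ker_corner m n a E D A B) as [G1 G2]; try assumption.
  + replace (sdet E D A B) with (sopp (sdet A B E D)) by (unfold sdet; ring). now apply order_sopp.
  + split; [exact G1 | ]. revert G2. apply kdim_iff. intros u v. unfold Ker. tauto.
- destruct (kdim_Ker_corner m n a D E B A) as [G1 G2]; try assumption.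
  + replace (sdet D E B A) with (sdet A B E D) by (unfold sdet; ring). exact Hn.
  + split; [exact G1 | ]. apply kdim_swap in G2. revert G2. apply kdim_iff. intros u v. unfold Ker.
    replace (sadd (conv B v) (conv A u)) with (sadd (conv A u) (conv B v)) by ring.
    replace (sadd (conv D v) (conv E u)) with (sadd (conv E u) (conv D v)) by ring. tauto.
Qed.

(** * Jordan chains of a quadratic pencil of second-order equations *)

Definition poly3 (x y w : C) : series :=
  sadd (sconst x) (sh (sadd (sconst y) (sh (sconst w)))).

Lemma conv_poly3 (x y w : C) (p : series) (k : nat) :
  conv (poly3 x y w) p k = (x * p k + y * sh p k + w * sh (sh p) k)%C.
Proof.
unfold poly3. rewrite conv_sadd_l, conv_sh_l, conv_sadd_l, conv_sh_l, !conv_sconst_l.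
unfold sadd. destruct k as [ | [ | k]]; cbn [sh]; ring.
Qed.

(* The equation [y'' = (b0 + h b1) y' + (g0 + h g1 + h^2 g2) y], with [h] a formal parameter. *)
Record pencil := Pencil { be0 : C; be1 : C; ga0 : R -> C; ga1 : C; ga2 : C }.

(** Written with products of series so that [ring] shows it to be linear over series in h; [rhs_eq]
    gives the coefficients. *)
Definition rhs (P : pencil) (z : R) (a b : series) : series :=
  sadd (conv (poly3 (be0 P) (be1 P) 0) b) (conv (poly3 (ga0 P z) (ga1 P) (ga2 P)) a).

Lemma rhs_eq (P : pencil) (z : R) (a b : series) (k : nat) :
  rhs P z a b k = (be0 P * b k + be1 P * sh b k
    + (ga0 P z * a k + ga1 P * sh a k + ga2 P * sh (sh a) k))%C.
Proof. unfold rhs, sadd. rewrite !conv_poly3. ring. Qed.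

Definition at_z (a : nat -> R -> C) (z : R) : series := fun k => a k z.

(* Both the Taylor coefficients in [h] of a solution and the Jordan chains of the pencil satisfy this recursion. *)
Definition chain_upto (P : pencil) (T : R) (n : nat) (a b : nat -> R -> C) : Prop :=
  forall k z, (k <= n)%nat -> 0 <= z <= T ->
    rderiv (a k) z (b k z) /\ rderiv (b k) z (rhs P z (at_z a z) (at_z b z) k).

Definition bounded_by (P : pencil) (T M : R) : Prop :=
  Cmod (be0 P) <= M /\ Cmod (be1 P) <= M /\ (forall z, 0 <= z <= T -> Cmod (ga0 P z) <= M) /\
  Cmod (ga1 P) <= M /\ Cmod (ga2 P) <= M.

(** The coefficients are weighted by powers of [r], so that an index shift in the recursion costs
    only a factor [r] and the estimate for all orders up to [n] closes with one constant. *)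
Fixpoint wsum (r : R) (e : nat -> R) (n : nat) : R :=
  match n with O => e O | S n' => wsum r e n' + r ^ n * e n end.

Definition rsh (e : nat -> R) (k : nat) : R := match k with O => 0 | S j => e j end.

Lemma wsum_scal (r c : R) (e : nat -> R) (n : nat) : wsum r (fun k => c * e k) n = c * wsum r e n.
Proof. induction n as [ | n IH]; cbn [wsum]; [reflexivity | rewrite IH; ring]. Qed.

Lemma wsum_plus (r : R) (e f : nat -> R) (n : nat) :
  wsum r (fun k => e k + f k) n = wsum r e n + wsum r f n.
Proof. induction n as [ | n IH]; cbn [wsum]; [reflexivity | rewrite IH; ring]. Qed.

Lemma wsum_rsh (r : R) (e : nat -> R) (n : nat) :
  wsum r (rsh e) n + r ^ S n * e n = r * wsum r e n.
Proof.
induction n as [ | n IH]; [simpl; ring | ].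
cbn [wsum]. rewrite Rmult_plus_distr_l, <- IH. simpl. ring.
Qed.

Lemma wsum_rsh_le (r : R) (e : nat -> R) (n : nat) : 0 <= r -> (forall k, 0 <= e k) ->
  wsum r (rsh e) n <= r * wsum r e n.
Proof.
intros Hr He. rewrite <- wsum_rsh. assert (H := pow_le r (S n) Hr). specialize (He n). nra.
Qed.

Lemma rsh_ge_0 (e : nat -> R) : (forall k, 0 <= e k) -> forall k, 0 <= rsh e k.
Proof. intros H [ | k]; simpl; [lra | apply H]. Qed.

Lemma wsum_ge_term (r : R) (e : nat -> R) (n : nat) : 0 <= r -> (forall k, 0 <= e k) ->
  r ^ n * e n <= wsum r e n.
Proof.
intros Hr He. assert (G : forall n, 0 <= wsum r e n).
{ induction n0 as [ | m IH]; cbn [wsum]; [apply He | ].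
  assert (H := pow_le r (S m) Hr). specialize (He (S m)). nra. }
destruct n as [ | n]; cbn [wsum]; [simpl; lra | specialize (G n); lra].
Qed.

Lemma is_derive_wsum (r : R) (e : nat -> R -> R) (z : R) (n : nat) (f : nat -> R) :
  (forall k, (k <= n)%nat -> exists d, is_derive (e k) z d /\ d <= f k) -> 0 <= r ->
  exists d, is_derive (fun x => wsum r (fun k => e k x) n) z d /\ d <= wsum r f n.
Proof.
intros H Hr. induction n as [ | n IH]; cbn [wsum].
- apply H; lia.
- destruct IH as [d [Hd Ld]]; [intros k Hk; apply H; lia | ].
  destruct (H (S n)) as [d' [Hd' Ld']]; [lia | ].
  exists (d + r ^ S n * d'). split.
  + apply (is_derive_plus (fun x => wsum r (fun k => e k x) n)); [exact Hd | ].
    now apply is_derive_scal.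
  + apply Rplus_le_compat; [exact Ld | ]. apply Rmult_le_compat_l; [now apply pow_le | exact Ld'].
Qed.

Lemma Cmod_sq_sum5 (a b c d e : C) :
  Cmod (a + b + (c + d + e))%C ^ 2 <= 5 * (Cmod a ^ 2 + Cmod b ^ 2 + Cmod c ^ 2 + Cmod d ^ 2 + Cmod e ^ 2).
Proof.
rewrite !Cmod_sq. simpl fst; simpl snd.
assert (G : forall x y z u v : R, (x + y + (z + u + v)) ^ 2 <= 5 * (x ^ 2 + y ^ 2 + z ^ 2 + u ^ 2 + v ^ 2)).
{ intros x y z u v.
  assert (H : 5 * (x ^ 2 + y ^ 2 + z ^ 2 + u ^ 2 + v ^ 2) - (x + y + (z + u + v)) ^ 2 =
    (x - y) ^ 2 + (x - z) ^ 2 + (x - u) ^ 2 + (x - v) ^ 2 + (y - z) ^ 2 + (y - u) ^ 2 + (y - v) ^ 2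
    + (z - u) ^ 2 + (z - v) ^ 2 + (u - v) ^ 2) by ring.
  assert (0 <= 5 * (x ^ 2 + y ^ 2 + z ^ 2 + u ^ 2 + v ^ 2) - (x + y + (z + u + v)) ^ 2); [rewrite H | lra].
  repeat apply Rplus_le_le_0_compat; apply pow2_ge_0. }
assert (G1 := G (fst a) (fst b) (fst c) (fst d) (fst e)).
assert (G2 := G (snd a) (snd b) (snd c) (snd d) (snd e)). lra.
Qed.

Lemma Cmod_mult_sq_le (x a : C) (M : R) : Cmod x <= M -> Cmod (x * a)%C ^ 2 <= M ^ 2 * Cmod a ^ 2.
Proof.
intros H. rewrite Cmod_mult, Rpow_mult_distr.
apply Rmult_le_compat_r; [apply pow2_ge_0 | ].
apply pow_incr. split; [apply Cmod_ge_0 | exact H].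
Qed.

Definition en (a b : series) (k : nat) : R := energy (a k) (b k).

(** Each of the five products in [rhs_eq] is at most [M] times a coefficient. The two unshifted ones
    make up the energy at [k], the two shifted once that at k - 1, and the [ga2] term is bounded by
    the energy at k - 2. *)
Lemma rhs_bound (P : pencil) (T M z : R) (a b : series) (k : nat) :
  bounded_by P T M -> 0 <= z <= T ->
  Cmod (rhs P z a b k) ^ 2 <= 5 * M ^ 2 * (en a b k + rsh (en a b) k + rsh (rsh (en a b)) k).
Proof.
intros [H1 [H2 [H3 [H4 H5]]]] Hz. specialize (H3 z Hz). rewrite rhs_eq.
eapply Rle_trans; [apply Cmod_sq_sum5 | ].
assert (E1 := Cmod_mult_sq_le _ (b k) _ H1). assert (E2 := Cmod_mult_sq_le _ (sh b k) _ H2).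
assert (E3 := Cmod_mult_sq_le _ (a k) _ H3). assert (E4 := Cmod_mult_sq_le _ (sh a k) _ H4).
assert (E5 := Cmod_mult_sq_le _ (sh (sh a) k) _ H5).
assert (F1 : Cmod (sh a k) ^ 2 + Cmod (sh b k) ^ 2 = rsh (en a b) k).
{ destruct k; simpl; [rewrite Cmod_0; ring | reflexivity]. }
assert (F2 : Cmod (sh (sh a) k) ^ 2 <= rsh (rsh (en a b)) k).
{ destruct k as [ | [ | k]]; cbn [sh rsh]; [rewrite Cmod_0; simpl; lra | rewrite Cmod_0; simpl; lra | ].
  unfold en, energy. assert (Hp := pow2_ge_0 (Cmod (b k))). lra. }
assert (HM := pow2_ge_0 M).
assert (F3 : M ^ 2 * Cmod (sh (sh a) k) ^ 2 <= M ^ 2 * rsh (rsh (en a b)) k) by now apply Rmult_le_compat_l.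
rewrite <- F1. unfold en at 1. unfold energy. lra.
Qed.

Lemma en_ge_0 (a b : series) (k : nat) : 0 <= en a b k.
Proof. apply energy_ge_0. Qed.

(* The constant does not depend on [n]: since [r] is arbitrary, the [k]-th coefficients decay faster than any geometric sequence. *)
Lemma chain_bound (P : pencil) (T M r : R) (n : nat) (a b : nat -> R -> C) :
  bounded_by P T M -> 0 <= r -> chain_upto P T n a b ->
  forall z, 0 <= z <= T ->
    wsum r (en (at_z a z) (at_z b z)) n <=
    wsum r (en (at_z a 0) (at_z b 0)) n * exp ((2 + 5 * M ^ 2 * (1 + r + r * r)) * z).
Proof.
intros HM Hr Hch z Hz. set (K := 2 + 5 * M ^ 2 * (1 + r + r * r)).
assert (G := gronwall (fun x => wsum r (fun k => energy (a k x) (b k x)) n) K 0 T).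
rewrite <- (Rplus_0_r (wsum r (en (at_z a z) (at_z b z)) n)),
  <- (Rplus_0_r (wsum r (en (at_z a 0) (at_z b 0)) n)).
apply G; [ | exact Hz]. clear z Hz G. intros z Hz.
set (e := en (at_z a z) (at_z b z)).
destruct (is_derive_wsum r (fun k x => energy (a k x) (b k x)) z n
  (fun k => 2 * e k + 5 * M ^ 2 * (e k + rsh e k + rsh (rsh e) k))) as [d [Hd Ld]].
- intros k Hk. destruct (Hch k z Hk Hz) as [Ha Hb].
  destruct (is_derive_energy (a k) (b k) z _ Ha Hb) as [d [Hd Ld]].
  exists d. split; [exact Hd | ].
  assert (B := rhs_bound P T M z (at_z a z) (at_z b z) k HM Hz). fold e in B.
  apply Rle_trans with (1 := Rle_abs d). apply Rle_trans with (1 := Ld).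
  unfold energy at 2. change (energy (a k z) (b k z)) with (e k).
  assert (Hbe : Cmod (b k z) ^ 2 <= e k).
  { unfold e, en, energy, at_z. assert (Hp := pow2_ge_0 (Cmod (a k z))). lra. }
  lra.
- exact Hr.
- exists d. split; [exact Hd | ]. apply Rle_trans with (1 := Ld).
  rewrite wsum_plus, !wsum_scal, !wsum_plus. rewrite Rplus_0_r.
  change (fun k => energy (a k z) (b k z)) with e.
  assert (He : forall k, 0 <= e k) by (intros k; apply en_ge_0).
  assert (H1 := wsum_rsh_le r e n Hr He).
  assert (H2 := wsum_rsh_le r (rsh e) n Hr (rsh_ge_0 e He)).
  assert (H3 : r * wsum r (rsh e) n <= r * (r * wsum r e n)) by now apply Rmult_le_compat_l.
  assert (HM2 := pow2_ge_0 M). unfold K.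
  assert (H4 : 5 * M ^ 2 * (wsum r e n + wsum r (rsh e) n + wsum r (rsh (rsh e)) n) <=
    5 * M ^ 2 * ((1 + r + r * r) * wsum r e n)) by (apply Rmult_le_compat_l; lra).
  lra.
Qed.

Lemma energy_eq_0 (a b : C) : energy a b <= 0 -> a = 0 /\ b = 0.
Proof.
unfold energy. intros H. assert (H1 := pow2_ge_0 (Cmod a)). assert (H2 := pow2_ge_0 (Cmod b)).
split; apply Cmod_eq_0.
- assert (E : Cmod a ^ 2 = 0) by lra. destruct (Req_dec (Cmod a) 0) as [e | e]; [exact e | ].
  now elim (pow_nonzero _ 2 e).
- assert (E : Cmod b ^ 2 = 0) by lra. destruct (Req_dec (Cmod b) 0) as [e | e]; [exact e | ].
  now elim (pow_nonzero _ 2 e).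
Qed.

Lemma chain_upto_le (P : pencil) (T : R) (n k : nat) (a b : nat -> R -> C) :
  (k <= n)%nat -> chain_upto P T n a b -> chain_upto P T k a b.
Proof. intros Hk H j z Hj Hz. apply H; [lia | exact Hz]. Qed.

(** Uniqueness for the recursion: [chain_bound] with r = 1 and zero initial energy. *)
Lemma chain_zero (P : pencil) (T M : R) (n : nat) (a b : nat -> R -> C) :
  bounded_by P T M -> chain_upto P T n a b ->
  (forall k, (k <= n)%nat -> a k 0 = 0 /\ b k 0 = 0) ->
  forall k z, (k <= n)%nat -> 0 <= z <= T -> a k z = 0 /\ b k z = 0.
Proof.
intros HM Hch H0 k z Hk Hz.
assert (G := chain_bound P T M 1 k a b HM Rle_0_1 (chain_upto_le P T n k a b Hk Hch) z Hz).
assert (Z : forall j, (j <= k)%nat -> wsum 1 (en (at_z a 0) (at_z b 0)) j = 0).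
{ assert (Z0 : forall j, (j <= k)%nat -> en (at_z a 0) (at_z b 0) j = 0).
  { intros j Hj. unfold en, energy, at_z. destruct (H0 j) as [-> ->]; [lia | ]. rewrite Cmod_0. ring. }
  induction j as [ | j IH]; intros Hj; cbn [wsum]; rewrite Z0 by exact Hj; [reflexivity | ].
  rewrite IH by lia. ring. }
rewrite Z, Rmult_0_l in G by lia.
assert (G' := wsum_ge_term 1 (en (at_z a z) (at_z b z)) k Rle_0_1 (en_ge_0 _ _)).
rewrite pow1, Rmult_1_l in G'. apply energy_eq_0. unfold en, at_z in *. lra.
Qed.

Lemma rderiv_conv (a : nat -> R -> C) (l : series) (u : series) (z : R) (k : nat) :
  (forall j, (j <= k)%nat -> rderiv (a j) z (l j)) -> rderiv (fun x => conv (at_z a x) u k) z (conv l u k).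
Proof.
revert a l. induction k as [ | k IH]; intros a l H.
- eapply rderiv_eq; [apply (rderiv_mult (a O) (fun _ => u O)); [apply H; lia | apply rderiv_const] | simpl; ring].
- simpl. apply rderiv_plus.
  + eapply rderiv_eq; [apply (rderiv_mult (a O) (fun _ => u (S k))); [apply H; lia | apply rderiv_const] | simpl; ring].
  + apply (IH (fun j => a (S j)) (fun j => l (S j))). intros j Hj. apply H. lia.
Qed.

Definition act (a : nat -> R -> C) (u : series) : nat -> R -> C := fun k z => conv (at_z a z) u k.

(** The series [u] does not depend on z, and the equation is linear over series in h, so
    multiplication by [u] preserves solutions. *)
Lemma chain_act (P : pencil) (T : R) (n : nat) (a b : nat -> R -> C) (u : series) :
  chain_upto P T n a b -> chain_upto P T n (act a u) (act b u).
Proof.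
intros H k z Hk Hz. split.
- apply rderiv_conv. intros j Hj. apply H; [lia | exact Hz].
- apply rderiv_eq with (conv (rhs P z (at_z a z) (at_z b z)) u k).
  + apply rderiv_conv. intros j Hj. apply H; [lia | exact Hz].
  + change (at_z (act a u) z) with (conv (at_z a z) u). change (at_z (act b u) z) with (conv (at_z b z) u).
    unfold rhs. match goal with |- ?f k = ?g k => replace f with g by ring end. reflexivity.
Qed.

Lemma chain_add (P : pencil) (T : R) (n : nat) (s : C) (a b a' b' : nat -> R -> C) :
  chain_upto P T n a b -> chain_upto P T n a' b' ->
  chain_upto P T n (fun k z => a k z + s * a' k z)%C (fun k z => b k z + s * b' k z)%C.
Proof.
intros H H' k z Hk Hz. destruct (H k z Hk Hz) as [H1 H2]. destruct (H' k z Hk Hz) as [H3 H4]. split.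
- apply rderiv_plus; [exact H1 | now apply rderiv_scal].
- eapply rderiv_eq; [apply rderiv_plus; [exact H2 | apply rderiv_scal; exact H4] | ].
  rewrite !rhs_eq. unfold at_z.
  destruct k as [ | [ | k]]; cbn [sh]; ring.
Qed.

Definition sol (P : pencil) (a b : R -> C) : Prop :=
  forall z, rderiv a z (b z) /\ rderiv b z (be0 P * b z + ga0 P z * a z)%C.

(** Liouville's formula: the determinant has logarithmic derivative [be0 P], so its product with
    exp(-be0 z) keeps its initial value 1. *)
Lemma wronskian (P : pencil) (y1 d1 y2 d2 : R -> C) : sol P y1 d1 -> sol P y2 d2 ->
  y1 0 = 1 -> d1 0 = 0 -> y2 0 = 0 -> d2 0 = 1 ->
  forall z, (y1 z * d2 z - d1 z * y2 z = Cexp (be0 P * z))%C.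
Proof.
intros H1 H2 E1 E2 E3 E4 z.
assert (G : ((y1 z * d2 z - d1 z * y2 z) * Cexp (- be0 P * z) = 1)%C).
{ transitivity ((y1 0 * d2 0 - d1 0 * y2 0) * Cexp (- be0 P * 0))%C.
  - apply (rderiv_zero_const (fun z => (y1 z * d2 z - d1 z * y2 z) * Cexp (- be0 P * z))%C).
    intros x. eapply rderiv_eq.
    + apply rderiv_mult; [apply rderiv_minus; apply rderiv_mult; [apply (proj1 (H1 x)) | apply (proj2 (H2 x)) | apply (proj2 (H1 x)) | apply (proj1 (H2 x))] | apply rderiv_Cexp].
    + cbv beta. ring.
  - rewrite E1, E2, E3, E4. replace (- be0 P * 0)%C with (RtoC 0) by ring. rewrite Cexp_0. ring. }
replace (- be0 P * z)%C with (- (be0 P * z))%C in G by ring. rewrite Cexp_opp in G.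
replace (y1 z * d2 z - d1 z * y2 z)%C with
  ((y1 z * d2 z - d1 z * y2 z) * / Cexp (be0 P * z) * Cexp (be0 P * z))%C by (field; apply Cexp_neq_0).
rewrite G. ring.
Qed.

(** Particular solution with zero initial data; the exponential in the integrands is the inverse of
    the Wronskian. *)
Definition var_a (P : pencil) (y1 y2 f : R -> C) (z : R) : C :=
  (y2 z * antideriv (fun x => y1 x * f x * Cexp (- be0 P * x)) z
   - y1 z * antideriv (fun x => y2 x * f x * Cexp (- be0 P * x)) z)%C.

Definition var_b (P : pencil) (y1 d1 y2 d2 f : R -> C) (z : R) : C :=
  (d2 z * antideriv (fun x => y1 x * f x * Cexp (- be0 P * x)) z
   - d1 z * antideriv (fun x => y2 x * f x * Cexp (- be0 P * x)) z)%C.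

(* Variation of parameters. *)
Lemma var_spec (P : pencil) (y1 d1 y2 d2 f : R -> C) : sol P y1 d1 -> sol P y2 d2 ->
  y1 0 = 1 -> d1 0 = 0 -> y2 0 = 0 -> d2 0 = 1 ->
  (forall z, exists l, rderiv f z l) ->
  var_a P y1 y2 f 0 = 0 /\ var_b P y1 d1 y2 d2 f 0 = 0 /\
  forall z, rderiv (var_a P y1 y2 f) z (var_b P y1 d1 y2 d2 f z) /\
    rderiv (var_b P y1 d1 y2 d2 f) z
      (be0 P * var_b P y1 d1 y2 d2 f z + ga0 P z * var_a P y1 y2 f z + f z)%C.
Proof.
intros H1 H2 E1 E2 E3 E4 Hf.
assert (C1 : forall y d : R -> C, sol P y d ->
  forall z, rderiv (antideriv (fun x => y x * f x * Cexp (- be0 P * x))%C) z (y z * f z * Cexp (- be0 P * z))%C).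
{ intros y d Hy. apply (rderiv_antideriv (fun x => y x * f x * Cexp (- be0 P * x))%C).
  intros z. destruct (Hf z) as [l Hl].
  eapply rderiv_continuous. apply rderiv_mult; [apply rderiv_mult; [apply (proj1 (Hy z)) | exact Hl] | apply rderiv_Cexp]. }
split; [ | split].
- unfold var_a. rewrite !antideriv_0. ring.
- unfold var_b. rewrite !antideriv_0. ring.
- intros z. assert (W := wronskian P y1 d1 y2 d2 H1 H2 E1 E2 E3 E4 z).
  assert (I1 := C1 y1 d1 H1 z). assert (I2 := C1 y2 d2 H2 z). split.
  + eapply rderiv_eq.
    * apply rderiv_minus; apply rderiv_mult; [apply (proj1 (H2 z)) | exact I1 | apply (proj1 (H1 z)) | exact I2].
    * unfold var_b. cbv beta. ring.
  + eapply rderiv_eq.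
    * apply rderiv_minus; apply rderiv_mult; [apply (proj2 (H2 z)) | exact I1 | apply (proj2 (H1 z)) | exact I2].
    * unfold var_b, var_a. cbv beta.
      set (J1 := antideriv _ z). set (J2 := antideriv _ z).
      (* The forcing is multiplied by 1, written as the Wronskian times its inverse; what remains is
         a polynomial identity. *)
      replace (f z) with ((y1 z * d2 z - d1 z * y2 z) * Cexp (- be0 P * z) * f z)%C at 3.
      -- ring.
      -- rewrite W, <- Cexp_plus. replace (be0 P * z + - be0 P * z)%C with (RtoC 0) by ring.
         rewrite Cexp_0. ring.
Qed.

Definition chain (P : pencil) (a b : nat -> R -> C) : Prop :=
  forall k z, rderiv (a k) z (b k z) /\ rderiv (b k) z (rhs P z (at_z a z) (at_z b z) k).

(** The recursion looks back two orders through [ga2], so the third component keeps the preceding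
    [a], with 0 before order zero. *)
Fixpoint chain_state (P : pencil) (y1 d1 y2 d2 y d : R -> C) (n : nat)
    : (R -> C) * (R -> C) * (R -> C) :=
  match n with
  | O => (y, d, fun _ => RtoC 0)
  | S n' =>
      let s := chain_state P y1 d1 y2 d2 y d n' in
      let f := fun z => (be1 P * snd (fst s) z + ga1 P * fst (fst s) z + ga2 P * snd s z)%C in
      (var_a P y1 y2 f, var_b P y1 d1 y2 d2 f, fst (fst s))
  end.

(** Each further order solves the same equation with a forcing made of the earlier orders, and with
    zero data. The initial state thus sits in order zero alone, as for the Taylor coefficients of a
    solution whose data do not depend on h. *)
Lemma chain_exists (P : pencil) (y1 d1 y2 d2 y d : R -> C) : sol P y1 d1 -> sol P y2 d2 ->
  y1 0 = 1 -> d1 0 = 0 -> y2 0 = 0 -> d2 0 = 1 -> sol P y d ->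
  exists a b, chain P a b /\ a O = y /\ b O = d /\ (forall k, a (S k) 0 = 0 /\ b (S k) 0 = 0).
Proof.
intros H1 H2 E1 E2 E3 E4 Hy.
set (st := chain_state P y1 d1 y2 d2 y d).
set (a := fun n => fst (fst (st n))). set (b := fun n => snd (fst (st n))).
set (f := fun n z => (be1 P * b n z + ga1 P * a n z + ga2 P * snd (st n) z)%C).
assert (Ea : forall n, a (S n) = var_a P y1 y2 (f n)) by reflexivity.
assert (Eb : forall n, b (S n) = var_b P y1 d1 y2 d2 (f n)) by reflexivity.
assert (Es : forall n z, snd (st n) z = sh (at_z a z) n) by (intros [ | n] z; reflexivity).
(* Differentiability is carried through the induction because [var_spec] asks it of the forcing, to
   have continuous integrands. *)
assert (D : forall n, (forall z, exists l, rderiv (a n) z l) /\ (forall z, exists l, rderiv (b n) z l) /\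
   (forall z, exists l, rderiv (snd (st n)) z l)).
{ induction n as [ | n [I1 [I2 I3]]].
  - split; [ | split]; intros z; eexists; [apply (proj1 (Hy z)) | apply (proj2 (Hy z)) | apply (rderiv_const 0 z)].
  - assert (Hf : forall z, exists l, rderiv (f n) z l).
    { intros z. destruct (I1 z) as [l1 L1]. destruct (I2 z) as [l2 L2]. destruct (I3 z) as [l3 L3].
      eexists. unfold f. apply rderiv_plus; [apply rderiv_plus | ]; apply rderiv_scal; eassumption. }
    destruct (var_spec P y1 d1 y2 d2 (f n) H1 H2 E1 E2 E3 E4 Hf) as [_ [_ V]].
    split; [ | split]; intros z.
    + rewrite Ea. eexists. apply (proj1 (V z)).
    + rewrite Eb. eexists. apply (proj2 (V z)).
    + destruct (I1 z) as [l L]. exists l. apply (rderiv_ext (a n)); [ | exact L]. intros t. rewrite Es. reflexivity. }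
assert (Hf : forall n z, exists l, rderiv (f n) z l).
{ intros n z. destruct (D n) as [I1 [I2 I3]].
  destruct (I1 z) as [l1 L1]. destruct (I2 z) as [l2 L2]. destruct (I3 z) as [l3 L3].
  eexists. unfold f. apply rderiv_plus; [apply rderiv_plus | ]; apply rderiv_scal; eassumption. }
exists a, b. split; [ | split; [reflexivity | split; [reflexivity | ]]].
- intros [ | n] z.
  + rewrite rhs_eq. simpl. destruct (Hy z) as [G1 G2]. split; [exact G1 | ].
    eapply rderiv_eq; [exact G2 | ]. unfold at_z. change (a O z) with (y z). change (b O z) with (d z). ring.
  + destruct (var_spec P y1 d1 y2 d2 (f n) H1 H2 E1 E2 E3 E4 (Hf n)) as [_ [_ V]].
    rewrite rhs_eq. unfold at_z. cbn [sh]. rewrite Ea, Eb. destruct (V z) as [V1 V2]. split; [exact V1 | ].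
    eapply rderiv_eq; [exact V2 | ]. unfold f at 3. rewrite Es. unfold at_z.
    destruct n as [ | n]; cbn [sh]; ring.
- intros k. rewrite Ea, Eb.
  destruct (var_spec P y1 d1 y2 d2 (f k) H1 H2 E1 E2 E3 E4 (Hf k)) as [V1 [V2 _]]. now split.
Qed.

(** * Power series in the spectral parameter *)

(** The degrees are those below [n], so the remainder after [n] terms is of size |h|^n. *)
Fixpoint psum (p : series) (h : C) (n : nat) : C :=
  match n with O => RtoC 0 | S n' => (psum p h n' + h ^ n' * p n')%C end.

Lemma psum_sadd (p q : series) (h : C) (n : nat) : psum (sadd p q) h n = (psum p h n + psum q h n)%C.
Proof. induction n as [ | n IH]; simpl; [ring | rewrite IH; unfold sadd; ring]. Qed.

Lemma psum_scal (x : C) (p : series) (h : C) (n : nat) :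
  psum (fun k => x * p k)%C h n = (x * psum p h n)%C.
Proof. induction n as [ | n IH]; simpl; [ring | rewrite IH; ring]. Qed.

Lemma psum_S_l (p : series) (h : C) (n : nat) :
  psum p h (S n) = (p O + h * psum (fun j => p (S j)) h n)%C.
Proof.
induction n as [ | n IH]; [simpl; ring | ].
change (psum p h (S (S n))) with (psum p h (S n) + h ^ (S n) * p (S n))%C.
rewrite IH. simpl. ring.
Qed.

Lemma psum_sh (p : series) (h : C) (n : nat) :
  (psum (sh p) h n + h ^ n * sh p n = h * psum p h n)%C.
Proof.
change (psum (sh p) h (S n) = (h * psum p h n)%C). rewrite psum_S_l.
change (fun j => sh p (S j)) with p. cbn [sh]. ring.
Qed.

(** Truncation commutes with multiplication by a quadratic polynomial except for the terms pushed to
    degree [n] or higher; these involve only [sh p n], the coefficient n - 1, and [sh (sh p) n], the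
    coefficient n - 2. *)
Lemma psum_poly3 (x y w : C) (p : series) (h : C) (n : nat) :
  psum (conv (poly3 x y w) p) h n =
  ((x + h * y + h * h * w) * psum p h n
   - h ^ n * (y * sh p n + w * (h * sh p n + sh (sh p) n)))%C.
Proof.
replace (conv (poly3 x y w) p) with
  (sadd (fun k => x * p k)%C (sadd (fun k => y * sh p k)%C (fun k => w * sh (sh p) k)%C)).
- rewrite !psum_sadd, !psum_scal.
  assert (E1 := psum_sh p h n). assert (E2 := psum_sh (sh p) h n).
  replace (psum (sh (sh p)) h n) with (h * psum (sh p) h n - h ^ n * sh (sh p) n)%C by (rewrite <- E2; ring).
  replace (psum (sh p) h n) with (h * psum p h n - h ^ n * sh p n)%C by (rewrite <- E1; ring).
  ring.
- apply functional_extensionality; intros k. rewrite conv_poly3. unfold sadd. ring.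
Qed.

(* [rho] being arbitrary, this says that the power series [p] converges to [f] on the whole plane; unlike mere
   convergence, the estimate passes directly to Cauchy products and to derivatives at [0]. *)
Definition expands (f : C -> C) (p : series) : Prop :=
  forall rho B, 0 < rho -> 0 < B -> exists K, forall n h, Cmod h <= B ->
    Cmod (f h - psum p h n)%C <= K * (rho * Cmod h) ^ n.

(** The formal parameter is frozen at a complex number, so [sol] of it is the actual equation at
    that value. *)
Definition pencil_at (P : pencil) (h : C) : pencil :=
  Pencil (be0 P + h * be1 P)%C 0 (fun z => ga0 P z + h * ga1 P + h * h * ga2 P)%C 0 0.

Lemma sq_le_sqrt (x y E : R) : 0 <= x -> 0 <= y -> 0 <= E -> x ^ 2 <= E * y ^ 2 -> x <= sqrt E * y.
Proof.
intros Hx Hy HE H. assert (HS := sqrt_pos E). assert (E2 := sqrt_sqrt E HE).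
apply Rnot_lt_le. intros L.
assert (0 <= sqrt E * y) by now apply Rmult_le_pos.
assert ((sqrt E * y) * (sqrt E * y) < x * x) by (apply Rmult_le_0_lt_compat; lra).
replace ((sqrt E * y) * (sqrt E * y)) with ((sqrt E * sqrt E) * y ^ 2) in H1 by ring.
rewrite E2 in H1. lra.
Qed.

Lemma en_le (a b : C) (x E : R) : 0 <= x -> 0 <= E -> energy a b <= E * x ^ 2 ->
  Cmod a <= sqrt E * x /\ Cmod b <= sqrt E * x.
Proof.
intros Hx HE H. unfold energy in H.
assert (H1 := pow2_ge_0 (Cmod a)). assert (H2 := pow2_ge_0 (Cmod b)).
split; apply sq_le_sqrt; try apply Cmod_ge_0; try assumption; lra.
Qed.

Lemma chain_coef_bound (P : pencil) (T M rho : R) (a b : nat -> R -> C) :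
  0 <= T -> bounded_by P T M -> (forall n, chain_upto P T n a b) ->
  (forall k, a (S k) 0 = 0 /\ b (S k) 0 = 0) -> 0 < rho ->
  exists K, 0 <= K /\ forall k z, 0 <= z <= T ->
    Cmod (a k z) <= K * rho ^ k /\ Cmod (b k z) <= K * rho ^ k.
Proof.
intros HT HM Hch H0 Hr.
(* The weighted bound gives r^k |a_k|^2 <= E, hence |a_k| <= sqrt(E) rho^k for this weight. *)
set (r := / (rho * rho)). assert (Hr0 : 0 < r) by (apply Rinv_0_lt_compat, Rmult_lt_0_compat; exact Hr).
set (L := 2 + 5 * M ^ 2 * (1 + r + r * r)).
set (E := energy (a O 0) (b O 0) * exp (L * T)).
assert (HE0 := energy_ge_0 (a O 0) (b O 0)).
assert (HL : 0 <= L).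
{ unfold L. assert (HM2 := pow2_ge_0 M). assert (0 <= 1 + r + r * r) by nra. nra. }
assert (HE : 0 <= E) by (apply Rmult_le_pos; [exact HE0 | left; apply exp_pos]).
exists (sqrt E). split; [apply sqrt_pos | ]. intros k z Hz.
apply en_le; [apply pow_le; lra | exact HE | ].
assert (G := chain_bound P T M r k a b HM (Rlt_le _ _ Hr0) (Hch k) z Hz). fold L in G.
assert (W : forall j, wsum r (en (at_z a 0) (at_z b 0)) j = energy (a O 0) (b O 0)).
{ induction j as [ | j IH]; [reflexivity | ]. cbn [wsum]. rewrite IH. unfold en, at_z.
  destruct (H0 j) as [-> ->]. unfold energy. rewrite Cmod_0. ring. }
rewrite W in G.
assert (G1 := wsum_ge_term r (en (at_z a z) (at_z b z)) k (Rlt_le _ _ Hr0) (en_ge_0 _ _)).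
change (en (at_z a z) (at_z b z) k) with (energy (a k z) (b k z)) in G1.
assert (G2 : energy (a O 0) (b O 0) * exp (L * z) <= E).
{ unfold E. apply Rmult_le_compat_l; [exact HE0 | ].
  destruct (Req_dec (L * z) (L * T)) as [-> | N]; [lra | ]. left. apply exp_increasing.
  assert (L * z <= L * T) by (apply Rmult_le_compat_l; lra). lra. }
assert (Er : r ^ k * (rho ^ k) ^ 2 = 1).
{ rewrite <- pow_mult, (Nat.mul_comm k 2), pow_mult, <- Rpow_mult_distr. unfold r.
  replace (/ (rho * rho) * rho ^ 2) with 1 by (field; lra). apply pow1. }
apply Rmult_le_reg_l with (r ^ k); [now apply pow_lt | ].
replace (r ^ k * (E * (rho ^ k) ^ 2)) with (E * (r ^ k * (rho ^ k) ^ 2)) by ring. rewrite Er. lra.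
Qed.

Lemma Cmod_sq_sum3 (a b c : C) : Cmod (a + b + c)%C ^ 2 <= 3 * (Cmod a ^ 2 + Cmod b ^ 2 + Cmod c ^ 2).
Proof.
rewrite !Cmod_sq. simpl fst; simpl snd.
assert (G : forall x y z : R, (x + y + z) ^ 2 <= 3 * (x ^ 2 + y ^ 2 + z ^ 2)).
{ intros x y z. assert (H1 := pow2_ge_0 (x - y)). assert (H2 := pow2_ge_0 (x - z)).
  assert (H3 := pow2_ge_0 (y - z)). nra. }
assert (G1 := G (fst a) (fst b) (fst c)). assert (G2 := G (snd a) (snd b) (snd c)). lra.
Qed.

Lemma rderiv_psum (a l : nat -> R -> C) (h : C) (z : R) (n : nat) :
  (forall k, rderiv (a k) z (l k z)) -> rderiv (fun x => psum (at_z a x) h n) z (psum (at_z l z) h n).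
Proof.
intros H. induction n as [ | n IH]; simpl; [apply rderiv_const | ].
apply rderiv_plus; [exact IH | apply rderiv_scal, H].
Qed.

Lemma exp_mono (x y : R) : x <= y -> exp x <= exp y.
Proof. intros [L | ->]; [left; now apply exp_increasing | right; reflexivity]. Qed.

(** The forcing adds at most 3 X^2 to the derivative of the energy, the 3 coming from the square of
    a sum of three terms; this is the constant [F] of [gronwall]. *)
Lemma forced_bound (P : pencil) (T N X : R) (d dd f : R -> C) : 0 <= T -> 0 <= X ->
  Cmod (be0 P) <= N -> (forall z, 0 <= z <= T -> Cmod (ga0 P z) <= N) ->
  (forall z, 0 <= z <= T -> rderiv d z (dd z) /\ rderiv dd z (be0 P * dd z + ga0 P z * d z + f z)%C /\ Cmod (f z) <= X) ->
  forall z, 0 <= z <= T ->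
    energy (d z) (dd z) <= (energy (d 0) (dd 0) + 3 * X ^ 2) * exp ((2 + 3 * N ^ 2) * T).
Proof.
intros HT HX HN1 HN2 H z Hz.
set (F := 3 * X ^ 2). assert (HF : 0 <= F) by (unfold F; assert (Hp := pow2_ge_0 X); lra).
assert (HNp := pow2_ge_0 N).
assert (G := gronwall (fun x => energy (d x) (dd x)) (2 + 3 * N ^ 2) F T).
assert (G' : energy (d z) (dd z) + F <= (energy (d 0) (dd 0) + F) * exp ((2 + 3 * N ^ 2) * z)).
{ apply G; [ | exact Hz]. clear z Hz G. intros z Hz.
  destruct (H z Hz) as [H1 [H2 H3]].
  destruct (is_derive_energy d dd z _ H1 H2) as [e [He Le]]. exists e. split; [exact He | ].
  apply Rle_trans with (1 := Rle_abs e). apply Rle_trans with (1 := Le).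
  assert (S3 := Cmod_sq_sum3 (be0 P * dd z) (ga0 P z * d z) (f z)).
  assert (S1 := Cmod_mult_sq_le _ (dd z) _ HN1). assert (S2 := Cmod_mult_sq_le _ (d z) _ (HN2 z Hz)).
  assert (S4 : Cmod (f z) ^ 2 <= X ^ 2) by (apply pow_incr; split; [apply Cmod_ge_0 | exact H3]).
  unfold energy at 2. unfold F. assert (Hp := pow2_ge_0 (Cmod (d z))).
  assert (Hd : Cmod (dd z) ^ 2 <= energy (d z) (dd z)) by (unfold energy; lra).
  assert (Es : 3 * N ^ 2 * energy (d z) (dd z) = 3 * (N ^ 2 * Cmod (d z) ^ 2) + 3 * (N ^ 2 * Cmod (dd z) ^ 2))
    by (unfold energy; ring).
  assert (He0 := energy_ge_0 (d z) (dd z)).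
  assert (Hx2 := pow2_ge_0 X).
  assert (0 <= 3 * N ^ 2 * (3 * X ^ 2)) by (apply Rmult_le_pos; lra).
  lra. }
assert (E1 : exp ((2 + 3 * N ^ 2) * z) <= exp ((2 + 3 * N ^ 2) * T)) by (apply exp_mono, Rmult_le_compat_l; lra).
assert (He0 := energy_ge_0 (d 0) (dd 0)).
assert (E2 : (energy (d 0) (dd 0) + F) * exp ((2 + 3 * N ^ 2) * z) <= (energy (d 0) (dd 0) + F) * exp ((2 + 3 * N ^ 2) * T))
  by (apply Rmult_le_compat_l; lra).
lra.
Qed.

Lemma chain_expands (P : pencil) (T M : R) (a b : nat -> R -> C) (y d : C -> R -> C) :
  0 <= T -> bounded_by P T M -> chain P a b ->
  (forall k, a (S k) 0 = 0 /\ b (S k) 0 = 0) ->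
  (forall h, sol (pencil_at P h) (y h) (d h)) ->
  (forall h, y h 0 = a O 0 /\ d h 0 = b O 0) ->
  forall z, 0 <= z <= T ->
    expands (fun h => y h z) (at_z a z) /\ expands (fun h => d h z) (at_z b z).
Proof.
intros HT HM Hch H0 Hsol Hini z Hz.
assert (G : forall rho B, 0 < rho -> 0 < B -> exists K, forall n h, Cmod h <= B ->
    Cmod (y h z - psum (at_z a z) h n)%C <= K * (rho * Cmod h) ^ n /\
    Cmod (d h z - psum (at_z b z) h n)%C <= K * (rho * Cmod h) ^ n).
2: { split; intros rho B Hr HB; destruct (G rho B Hr HB) as [K HK]; exists K; intros n h Hh; now apply HK. }
intros rho B Hr HB.
assert (Hup : forall n, chain_upto P T n a b) by (intros n k x _ _; apply Hch).
destruct (chain_coef_bound P T M rho a b HT HM Hup H0 Hr) as [K [HK Kb]].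
destruct HM as [M1 [M2 [M3 [M4 M5]]]].
assert (HM : 0 <= M) by (eapply Rle_trans; [apply Cmod_ge_0 | exact M1]).
set (N := M * (1 + B + B * B)).
set (X := M * K * (2 / rho + (B / rho + / (rho * rho)))).
assert (Hir : 0 < / rho) by now apply Rinv_0_lt_compat.
assert (Hir2 : 0 < / (rho * rho)) by (apply Rinv_0_lt_compat, Rmult_lt_0_compat; exact Hr).
assert (HX : 0 <= X).
{ unfold X, Rdiv. repeat apply Rmult_le_pos; try assumption.
  assert (0 <= B * / rho) by (apply Rmult_le_pos; lra). lra. }
set (E := (energy (a O 0) (b O 0) + 3 * X ^ 2) * exp ((2 + 3 * N ^ 2) * T)).
assert (He0 := energy_ge_0 (a O 0) (b O 0)). assert (HX2 := pow2_ge_0 X).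
assert (HE : 0 <= E) by (apply Rmult_le_pos; [lra | left; apply exp_pos]).
exists (sqrt E). intros n h Hh.
set (x := (rho * Cmod h) ^ n).
assert (Hh0 := Cmod_ge_0 h).
assert (Hx : 0 <= x) by (apply pow_le, Rmult_le_pos; lra).
apply en_le; [exact Hx | exact HE | ].
set (res := fun z => (h ^ n * (be1 P * sh (at_z b z) n + (ga1 P * sh (at_z a z) n
   + ga2 P * (h * sh (at_z a z) n + sh (sh (at_z a z)) n))))%C).
assert (Hhh : Cmod h * Cmod h <= B * B) by (apply Rmult_le_compat; lra).
assert (F := forced_bound (pencil_at P h) T N (X * x)
  (fun z => y h z - psum (at_z a z) h n)%C (fun z => d h z - psum (at_z b z) h n)%C res HT).
assert (F1 : energy (y h z - psum (at_z a z) h n)%C (d h z - psum (at_z b z) h n)%C <=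
  (energy (y h 0 - psum (at_z a 0) h n)%C (d h 0 - psum (at_z b 0) h n)%C + 3 * (X * x) ^ 2) * exp ((2 + 3 * N ^ 2) * T)).
{ apply F; [now apply Rmult_le_pos | | | | exact Hz]; clear F z Hz.
  - cbn [be0 pencil_at]. eapply Rle_trans; [apply Cmod_triangle | ]. rewrite Cmod_mult.
    assert (Cmod h * Cmod (be1 P) <= B * M) by (apply Rmult_le_compat; try apply Cmod_ge_0; assumption).
    assert (0 <= M * (B * B)) by (apply Rmult_le_pos; nra).
    unfold N. lra.
  - intros z Hz. cbn [ga0 pencil_at]. eapply Rle_trans; [apply Cmod_triangle | ].
    eapply Rle_trans; [apply Rplus_le_compat_r, Cmod_triangle | ]. rewrite !Cmod_mult.
    assert (Cmod h * Cmod (ga1 P) <= B * M) by (apply Rmult_le_compat; try apply Cmod_ge_0; assumption).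
    assert (Cmod h * Cmod h * Cmod (ga2 P) <= B * B * M).
    { apply Rmult_le_compat; try apply Cmod_ge_0; try assumption. nra. }
    specialize (M3 z Hz). unfold N. lra.
  - intros z Hz. split; [ | split].
    + apply rderiv_minus; [apply (proj1 (Hsol h z)) | ]. apply rderiv_psum. intros k. apply (proj1 (Hch k z)).
    + eapply rderiv_eq.
      * apply rderiv_minus; [apply (proj2 (Hsol h z)) | ].
        apply (rderiv_psum b (fun k x => rhs P x (at_z a x) (at_z b x) k)). intros k. apply (proj2 (Hch k z)).
      * change (at_z (fun k x => rhs P x (at_z a x) (at_z b x) k) z) with (rhs P z (at_z a z) (at_z b z)).
        unfold rhs. rewrite psum_sadd, !psum_poly3. unfold res. cbn [be0 ga0 pencil_at]. ring.
    + unfold res. rewrite Cmod_mult, Cmod_pow.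
      assert (Sb : forall f : nat -> R -> C, (forall k, Cmod (f k z) <= K * rho ^ k) ->
        Cmod (sh (at_z f z) n) <= K * / rho * rho ^ n /\ Cmod (sh (sh (at_z f z)) n) <= K * / (rho * rho) * rho ^ n).
      { intros f Hf. assert (Hk1 : 0 <= K * / rho) by (apply Rmult_le_pos; lra).
        assert (Hk2 : 0 <= K * / (rho * rho)) by (apply Rmult_le_pos; lra).
        assert (P1 := pow_lt rho n Hr).
        split.
        - destruct n as [ | k]; cbn [sh].
          + rewrite Cmod_0. apply Rmult_le_pos; lra.
          + eapply Rle_trans; [apply Hf | ]. right. simpl. field. lra.
        - destruct n as [ | [ | k]]; cbn [sh].
          + rewrite Cmod_0. apply Rmult_le_pos; lra.
          + rewrite Cmod_0. apply Rmult_le_pos; lra.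
          + eapply Rle_trans; [apply Hf | ]. right. simpl. field. lra. }
      destruct (Sb a) as [A1 A2]; [intros k; apply Kb, Hz | ].
      destruct (Sb b) as [B1 _]; [intros k; apply Kb, Hz | ].
      set (s1 := sh (at_z a z) n) in *. set (s2 := sh (sh (at_z a z)) n) in *. set (s3 := sh (at_z b z) n) in *.
      replace (X * x) with (Cmod h ^ n * (X * rho ^ n)) by (unfold x; rewrite Rpow_mult_distr; ring).
      apply Rmult_le_compat_l; [now apply pow_le | ].
      eapply Rle_trans; [apply Cmod_triangle | ].
      eapply Rle_trans; [apply Rplus_le_compat_l, Cmod_triangle | ].
      rewrite !Cmod_mult.
      assert (Q0 : Cmod (h * s1 + s2)%C <= B * (K * / rho * rho ^ n) + K * / (rho * rho) * rho ^ n).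
      { eapply Rle_trans; [apply Cmod_triangle | ]. rewrite Cmod_mult. apply Rplus_le_compat; [ | exact A2].
        apply Rmult_le_compat; try apply Cmod_ge_0; assumption. }
      assert (Q1 : Cmod (be1 P) * Cmod s3 <= M * (K * / rho * rho ^ n)) by (apply Rmult_le_compat; try apply Cmod_ge_0; assumption).
      assert (Q2 : Cmod (ga1 P) * Cmod s1 <= M * (K * / rho * rho ^ n)) by (apply Rmult_le_compat; try apply Cmod_ge_0; assumption).
      assert (Q3 : Cmod (ga2 P) * Cmod (h * s1 + s2)%C <= M * (B * (K * / rho * rho ^ n) + K * / (rho * rho) * rho ^ n))
        by (apply Rmult_le_compat; try apply Cmod_ge_0; assumption).
      unfold X, Rdiv. lra. }
(* For n = 0 the truncation is empty, the error is the initial state and [x] is 1; for n >= 1 the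
   initial error is zero because the data sit in order zero. *)
assert (I0 : energy (y h 0 - psum (at_z a 0) h n)%C (d h 0 - psum (at_z b 0) h n)%C <= energy (a O 0) (b O 0) * x ^ 2).
{ destruct (Hini h) as [-> ->]. destruct n as [ | n].
  - unfold x. simpl psum. simpl pow at 1. right.
    replace (a O 0 - 0)%C with (a O 0) by ring. replace (b O 0 - 0)%C with (b O 0) by ring. simpl. ring.
  - rewrite !psum_S_l.
    assert (Z : forall f : nat -> R -> C, (forall k, f (S k) 0 = 0) -> forall m, psum (fun j => at_z f 0 (S j)) h m = 0).
    { intros f Hf m. induction m as [ | m IH]; simpl; [reflexivity | ]. rewrite IH. unfold at_z. rewrite Hf. ring. }
    rewrite (Z a) by (intros k; apply H0). rewrite (Z b) by (intros k; apply H0). unfold at_z.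
    replace (a O 0 - (a O 0 + h * 0))%C with (RtoC 0) by ring.
    replace (b O 0 - (b O 0 + h * 0))%C with (RtoC 0) by ring.
    unfold energy at 1. rewrite Cmod_0. assert (Hp := pow2_ge_0 x).
    assert (0 <= energy (a O 0) (b O 0) * x ^ 2) by (apply Rmult_le_pos; assumption). lra. }
apply Rle_trans with (1 := F1). unfold E.
replace ((energy (a O 0) (b O 0) + 3 * X ^ 2) * exp ((2 + 3 * N ^ 2) * T) * x ^ 2)
  with ((energy (a O 0) (b O 0) * x ^ 2 + 3 * (X * x) ^ 2) * exp ((2 + 3 * N ^ 2) * T)) by ring.
apply Rmult_le_compat_r; [left; apply exp_pos | lra].
Qed.

Lemma expands_ext (f g : C -> C) (p : series) : (forall h, f h = g h) -> expands f p -> expands g p.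
Proof.
intros E H rho B Hr HB. destruct (H rho B Hr HB) as [K HK]. exists K. intros n h Hh.
rewrite <- E. now apply HK.
Qed.

Lemma expands_sconst (a : C) : expands (fun _ => a) (sconst a).
Proof.
intros rho B Hr HB. exists (Cmod a). intros [ | n] h Hh.
- simpl. right. rewrite Rmult_1_r. f_equal. ring.
- rewrite psum_S_l. replace (a - _)%C with (RtoC 0).
  + rewrite Cmod_0. apply Rmult_le_pos; [apply Cmod_ge_0 | ].
    apply pow_le, Rmult_le_pos; [lra | apply Cmod_ge_0].
  + assert (Z : psum (fun j => sconst a (S j)) h n = 0).
    { induction n as [ | n IH]; cbn [psum]; [reflexivity | rewrite IH; simpl; ring]. }
    rewrite Z. simpl. ring.
Qed.

Lemma expands_lincomb (f g : C -> C) (p q : series) (s : C) : expands f p -> expands g q ->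
  expands (fun h => f h + s * g h)%C (fun k => p k + s * q k)%C.
Proof.
intros Hf Hg rho B Hr HB. destruct (Hf rho B Hr HB) as [K HK]. destruct (Hg rho B Hr HB) as [L HL].
exists (K + Cmod s * L). intros n h Hh.
change (fun k => p k + s * q k)%C with (sadd p (fun k => s * q k)%C). rewrite psum_sadd, psum_scal.
replace (f h + s * g h - (psum p h n + s * psum q h n))%C
  with ((f h - psum p h n) + s * (g h - psum q h n))%C by ring.
eapply Rle_trans; [apply Cmod_triangle | ]. rewrite Cmod_mult.
specialize (HK n h Hh). specialize (HL n h Hh).
assert (Cmod s * Cmod (g h - psum q h n)%C <= Cmod s * (L * (rho * Cmod h) ^ n))
  by (apply Rmult_le_compat_l; [apply Cmod_ge_0 | exact HL]).
lra.
Qed.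

(** With x = p(0) + h x1, the remainder of xy after n + 1 terms is p(0) times that of y after n + 1
    terms, plus h times that of x1 y after [n] terms. The tail x1 has remainder constant K rho, and
    every step adds 1 + X to the factor. *)
Lemma conv_remainder (h : C) (rho L X : R) (q : series) (y : C) : 0 < rho -> 0 <= L ->
  rho * Cmod h <= X ->
  (forall n, Cmod (y - psum q h n)%C <= L * (rho * Cmod h) ^ n) ->
  forall n p x K, (forall n, Cmod (x - psum p h n)%C <= K * (rho * Cmod h) ^ n) ->
    Cmod (x * y - psum (conv p q) h n)%C <= K * L * (1 + INR n * (1 + X)) * (rho * Cmod h) ^ n.
Proof.
intros Hr HL HX Hy. assert (Hh := Cmod_ge_0 h).
set (w := rho * Cmod h). fold w in HX, Hy. assert (Hw : 0 <= w) by (apply Rmult_le_pos; lra).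
assert (Y0 := Hy O). simpl in Y0. rewrite Rmult_1_r in Y0. replace (y - 0)%C with y in Y0 by ring.
induction n as [ | n IH]; intros p x K Hx.
- simpl. assert (X0 := Hx O). simpl in X0. rewrite Rmult_1_r in X0. replace (x - 0)%C with x in X0 by ring.
  replace (x * y - 0)%C with (x * y)%C by ring. rewrite Cmod_mult.
  assert (Cmod x * Cmod y <= K * L) by (apply Rmult_le_compat; try apply Cmod_ge_0; assumption). lra.
- assert (X0 := Hx O). simpl in X0. rewrite Rmult_1_r in X0. replace (x - 0)%C with x in X0 by ring.
  assert (HK : 0 <= K) by (eapply Rle_trans; [apply Cmod_ge_0 | exact X0]).
  assert (X1 := Hx 1%nat). simpl in X1. rewrite Rmult_1_r in X1.
  replace (x - (0 + 1 * p O))%C with (x - p O)%C in X1 by ring.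
  assert (P0 : Cmod (p O) <= K * (1 + X)).
  { replace (p O) with (x + - (x - p O))%C by ring. eapply Rle_trans; [apply Cmod_triangle | ].
    rewrite Cmod_opp. assert (K * w <= K * X) by (apply Rmult_le_compat_l; assumption). lra. }
  rewrite psum_S_l.
  change (fun j => conv p q (S j)) with (fun j => (p O * q (S j) + conv (fun i => p (S i)) q j)%C).
  change (fun j => (p O * q (S j) + conv (fun i => p (S i)) q j)%C)
    with (sadd (fun j => p O * q (S j))%C (conv (fun i => p (S i)) q)).
  rewrite psum_sadd, (psum_scal (p O) (fun j => q (S j))).
  (* For h = 0 the estimate with one term forces x = p(0), and any [x1] will do; otherwise [x1] is
     the difference quotient. *)
  assert (D : exists x1, (x - p O = h * x1)%C /\ forall n, Cmod (h * (x1 - psum (fun i => p (S i)) h n))%C <= K * w ^ S n).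
  { destruct (Ceq_dec h 0) as [E | N].
    - exists 0. assert (W0 : w = 0) by (unfold w; rewrite E, Cmod_0; ring).
      rewrite W0, Rmult_0_r in X1. assert (Hc := Cmod_ge_0 (x - p O)%C).
      split.
      + rewrite E. rewrite (Cmod_eq_0 (x - p O)%C) by lra. ring.
      + intros m. rewrite E, Cmult_0_l, Cmod_0. apply Rmult_le_pos; [exact HK | now apply pow_le].
    - exists ((x - p O) / h)%C. split; [now field | ]. intros m. eapply Rle_trans; [ | apply Hx].
      rewrite psum_S_l. right. f_equal. field. exact N. }
  destruct D as [x1 [Ex Hx1]].
  assert (T2 : Cmod (h * (x1 * y - psum (conv (fun i => p (S i)) q) h n))%C <=
     K * w * L * (1 + INR n * (1 + X)) * w ^ n).
  { destruct (Ceq_dec h 0) as [E | N].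
    - rewrite E, Cmult_0_l, Cmod_0. assert (HN := pos_INR n). assert (Hwn := pow_le w n Hw).
      assert (H1X : 0 <= INR n * (1 + X)) by (apply Rmult_le_pos; lra). repeat apply Rmult_le_pos; try assumption; lra.
    - assert (Hp : 0 < Cmod h) by exact (proj1 (Cmod_gt_0 h) N).
      rewrite Cmod_mult.
      assert (G := IH (fun i => p (S i)) x1 (K * rho)).
      replace (K * w * L * (1 + INR n * (1 + X)) * w ^ n)
        with (Cmod h * (K * rho * L * (1 + INR n * (1 + X)) * w ^ n)) by (unfold w; ring).
      apply Rmult_le_compat_l; [lra | ]. apply G. intros m.
      apply Rmult_le_reg_l with (Cmod h); [exact Hp | ]. rewrite <- Cmod_mult.
      eapply Rle_trans; [apply Hx1 | ]. right. unfold w. simpl. ring. }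
  replace (x * y - _)%C with (p O * (y - psum q h (S n)) + h * (x1 * y - psum (conv (fun i => p (S i)) q) h n))%C.
  + eapply Rle_trans; [apply Cmod_triangle | ]. rewrite Cmod_mult.
    assert (T1 : Cmod (p O) * Cmod (y - psum q h (S n))%C <= K * (1 + X) * (L * w ^ S n))
      by (apply Rmult_le_compat; try apply Cmod_ge_0; [exact P0 | apply Hy]).
    rewrite S_INR. simpl in *. lra.
  + rewrite psum_S_l. simpl. replace x with (p O + h * x1)%C by (rewrite <- Ex; ring). ring.
Qed.

Lemma INR_le_pow2 (n : nat) : 1 + INR n <= 2 ^ n.
Proof.
induction n as [ | n IH]; [simpl; lra | ]. rewrite S_INR. simpl.
assert (H := pos_INR n). lra.
Qed.

(** The Cauchy product loses a factor linear in [n]. Expanding both factors at rate rho/2 leaves 2^n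
    to absorb it. *)
Lemma expands_conv (f g : C -> C) (p q : series) : expands f p -> expands g q ->
  expands (fun h => f h * g h)%C (conv p q).
Proof.
intros Hf Hg rho B Hr HB.
destruct (Hf (rho / 2) B) as [K HK]; [lra | exact HB | ].
destruct (Hg (rho / 2) B) as [L HL]; [lra | exact HB | ].
set (X := rho / 2 * B). exists (K * L * (1 + X)). intros n h Hh. assert (Hh0 := Cmod_ge_0 h).
assert (HX : rho / 2 * Cmod h <= X) by (apply Rmult_le_compat_l; lra).
assert (Hw : 0 <= rho / 2 * Cmod h) by (apply Rmult_le_pos; lra).
assert (K0 : 0 <= K).
{ assert (Z := HK O h Hh). simpl in Z. rewrite Rmult_1_r in Z. eapply Rle_trans; [apply Cmod_ge_0 | exact Z]. }
assert (L0 : 0 <= L).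
{ assert (Z := HL O h Hh). simpl in Z. rewrite Rmult_1_r in Z. eapply Rle_trans; [apply Cmod_ge_0 | exact Z]. }
eapply Rle_trans.
- apply (conv_remainder h (rho / 2) L X q (g h)) with (K := K); try assumption; [lra | | ]; intros m.
  + now apply HL.
  + now apply HK.
- assert (E : (rho * Cmod h) ^ n = 2 ^ n * (rho / 2 * Cmod h) ^ n).
  { rewrite <- Rpow_mult_distr. f_equal. field. }
  rewrite E.
  assert (Hp := INR_le_pow2 n). assert (Hn := pos_INR n). assert (Hwn := pow_le _ n Hw).
  assert (HKL : 0 <= K * L) by now apply Rmult_le_pos.
  assert (S1 : 1 + INR n * (1 + X) <= (1 + X) * 2 ^ n).
  { assert ((1 + X) * (1 + INR n) <= (1 + X) * 2 ^ n) by (apply Rmult_le_compat_l; lra). lra. }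
  replace (K * L * (1 + X) * (2 ^ n * (rho / 2 * Cmod h) ^ n)) with (K * L * ((1 + X) * 2 ^ n) * (rho / 2 * Cmod h) ^ n) by ring.
  apply Rmult_le_compat_r; [exact Hwn | ]. now apply Rmult_le_compat_l.
Qed.

(** Takes the place of the identity theorem: [rho] is chosen so that rho |h| <= 1/2, and the bound K
    / 2^n tends to 0. *)
Lemma expands_zero (f : C -> C) (p : series) : expands f p -> (forall k, p k = 0) -> forall h, f h = 0.
Proof.
intros Hf Hp h. set (B := Cmod h + 1). assert (Hh := Cmod_ge_0 h).
set (rho := / (2 * B)). assert (HB : 0 < B) by (unfold B; lra).
assert (Hr : 0 < rho) by (apply Rinv_0_lt_compat; lra).
destruct (Hf rho B Hr HB) as [K HK].
assert (Z : forall n, psum p h n = 0).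
{ induction n as [ | n IH]; simpl; [reflexivity | rewrite IH, Hp; ring]. }
assert (W : 0 <= rho * Cmod h <= / 2).
{ split; [apply Rmult_le_pos; lra | ]. unfold rho. rewrite Rinv_mult.
  apply Rmult_le_reg_l with (2 * B); [lra | ]. replace (2 * B * (/ 2 * / B * Cmod h)) with (Cmod h) by (field; lra).
  unfold B. lra. }
assert (K0 : 0 <= K).
{ assert (G := HK O h). simpl in G. rewrite Rmult_1_r in G. eapply Rle_trans; [apply Cmod_ge_0 | apply G; unfold B; lra]. }
apply Cmod_eq_0. apply Rle_antisym; [ | apply Cmod_ge_0].
apply Rnot_lt_le. intros Hpos.
destruct (pow_lt_1_zero (/ 2)) with (y := Cmod (f h) / (K + 1)) as [n Hn].
- rewrite Rabs_right; lra.
- apply Rdiv_lt_0_compat; lra.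
- specialize (Hn n (le_n n)). rewrite Rabs_right in Hn by (apply Rle_ge, pow_le; lra).
  assert (G := HK n h). rewrite Z in G. replace (f h - 0)%C with (f h) in G by ring.
  assert (G' : Cmod (f h) <= K * (rho * Cmod h) ^ n) by (apply G; unfold B; lra).
  assert (Q : (rho * Cmod h) ^ n <= (/ 2) ^ n) by now apply pow_incr.
  assert (Q1 : K * (rho * Cmod h) ^ n <= K * (/ 2) ^ n) by now apply Rmult_le_compat_l.
  assert (Q2 : (K + 1) * (/ 2) ^ n < Cmod (f h)).
  { apply Rmult_lt_reg_l with (/ (K + 1)); [apply Rinv_0_lt_compat; lra | ].
    replace (/ (K + 1) * ((K + 1) * (/ 2) ^ n)) with ((/ 2) ^ n) by (field; lra).
    replace (/ (K + 1) * Cmod (f h)) with (Cmod (f h) / (K + 1)) by (field; lra). exact Hn. }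
  assert (0 < (/ 2) ^ n) by (apply pow_lt; lra). lra.
Qed.

(** * Complex derivatives from quadratic remainders *)

Definition cderiv (f : C -> C) (z l : C) : Prop :=
  is_derive (K := C_AbsRing) (V := C_NormedModule) f z l.

Lemma cderiv_eps (f : C -> C) (z l : C) :
  (forall eps : posreal, exists delta : posreal, forall y : C,
    Cmod (y - z)%C < delta -> Cmod (f y - f z - (y - z) * l)%C <= eps * Cmod (y - z)%C) -> cderiv f z l.
Proof.
intros H. split; [apply is_linear_scal_l | ].
intros x Hx. apply (is_filter_lim_locally_unique (K := C_AbsRing) (V := AbsRing_NormedModule C_AbsRing)) in Hx. subst x.
intros eps. destruct (H eps) as [d Hd]. exists d. intros y Hy. exact (Hd y Hy).
Qed.

(** All complex derivatives of basic functions go through this criterion. As [K] is any real number,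
    |K| + 1 serves as a positive divisor. *)
Lemma cderiv_quadratic (f : C -> C) (z l : C) (K B : R) : 0 < B ->
  (forall h, Cmod h <= B -> Cmod (f (z + h)%C - f z - h * l)%C <= K * Cmod h ^ 2) -> cderiv f z l.
Proof.
intros HB H. apply cderiv_eps. intros eps.
assert (He := cond_pos eps).
assert (HK : 0 < Rabs K + 1) by (assert (G := Rabs_pos K); lra).
assert (Hd : 0 < Rmin B (eps / (Rabs K + 1))) by (apply Rmin_pos; [exact HB | now apply Rdiv_lt_0_compat]).
exists (mkposreal _ Hd). simpl. intros y Hy.
assert (H1 := Rlt_le_trans _ _ _ Hy (Rmin_l _ _)). assert (H2 := Rlt_le_trans _ _ _ Hy (Rmin_r _ _)).
assert (G := H (y - z)%C (Rlt_le _ _ H1)). replace (z + (y - z))%C with y in G by ring.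
apply Rle_trans with (1 := G). assert (Hc := Cmod_ge_0 (y - z)%C).
simpl. rewrite Rmult_1_r, <- Rmult_assoc. apply Rmult_le_compat_r; [exact Hc | ].
apply Rle_trans with ((Rabs K + 1) * Cmod (y - z)%C).
- apply Rmult_le_compat_r; [exact Hc | ]. assert (G1 := Rle_abs K). lra.
- apply Rmult_le_reg_l with (/ (Rabs K + 1)); [now apply Rinv_0_lt_compat | ].
  replace (/ (Rabs K + 1) * ((Rabs K + 1) * Cmod (y - z)%C)) with (Cmod (y - z)%C) by (field; lra).
  replace (/ (Rabs K + 1) * eps) with (eps / (Rabs K + 1)) by (unfold Rdiv; ring). lra.
Qed.

Lemma expands_value (f : C -> C) (p : series) : expands f p -> f 0 = p O.
Proof.
intros H. destruct (H 1 1) as [K HK]; [lra | lra | ].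
specialize (HK 1%nat 0). rewrite Cmod_0 in HK. simpl in HK. rewrite Rmult_0_r, Rmult_0_l, Rmult_0_r in HK.
assert (G := Cmod_ge_0 (f 0 - (0 + 1 * p O))%C).
apply Ceq_minus. replace (f 0 - p O)%C with (f 0 - (0 + 1 * p O))%C by ring.
apply Cmod_eq_0. lra.
Qed.

Lemma expands_cderiv (f : C -> C) (z0 : C) (p : series) :
  expands (fun h => f (z0 + h)%C) p -> cderiv f z0 (p 1%nat).
Proof.
intros H. destruct (H 1 1) as [K HK]; [lra | lra | ].
apply (cderiv_quadratic f z0 (p 1%nat) K 1); [lra | ]. intros h Hh.
assert (E := expands_value _ _ H). cbv beta in E. replace (z0 + 0)%C with z0 in E by ring.
assert (G := HK 2%nat h Hh). rewrite Rmult_1_l in G.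
replace (f (z0 + h) - f z0 - h * p 1%nat)%C with (f (z0 + h) - psum p h 2)%C; [exact G | ].
rewrite E. simpl. ring.
Qed.

(** Removable singularity by hand: g is f / (z - z0)^n with the value [p n] filled in. The remainder
    of f after n + 2 terms, divided by h^n, is quadratic and gives the derivative p(n + 1) at z0. *)
Lemma expands_shift_order (f : C -> C) (z0 : C) (p : series) (n : nat) :
  expands (fun h => f (z0 + h)%C) p -> order p n ->
  exists g, (forall z, f z = ((z - z0) ^ n * g z)%C) /\ g z0 = p n /\ (exists l, cderiv g z0 l) /\
    (forall z, z <> z0 -> g z = (f z / (z - z0) ^ n)%C).
Proof.
intros H [Hv Hn].
set (g := fun z => if Ceq_dec z z0 then p n else (f z / (z - z0) ^ n)%C).
assert (g1 : forall z, z <> z0 -> g z = (f z / (z - z0) ^ n)%C).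
{ intros z Hz. unfold g. destruct (Ceq_dec z z0); [easy | reflexivity]. }
assert (g0 : g z0 = p n) by (unfold g; destruct (Ceq_dec z0 z0); easy).
exists g. split; [ | split; [exact g0 | split; [ | exact g1]]].
- intros z. destruct (Ceq_dec z z0) as [-> | N].
  + rewrite g0. assert (E := expands_value _ _ H). cbv beta in E. replace (z0 + 0)%C with z0 in E by ring. rewrite E.
    destruct n as [ | n]; [simpl; ring | ]. rewrite (Hv O) by lia. replace (z0 - z0)%C with (RtoC 0) by ring. simpl. ring.
  + rewrite g1 by exact N. field. apply Cpow_nz. intros E. now apply N, Ceq_minus.
- exists (p (S n)). destruct (H 1 1) as [K HK]; [lra | lra | ].
  apply (cderiv_quadratic g z0 (p (S n)) K 1); [lra | ]. intros h Hh. rewrite g0.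
  destruct (Ceq_dec h 0) as [-> | N].
  + replace (z0 + 0)%C with z0 by ring. rewrite g0.
    replace (p n - p n - 0 * p (S n))%C with (RtoC 0) by ring. rewrite Cmod_0. simpl. lra.
  + assert (Nz : (z0 + h)%C <> z0).
    { intros E. apply N. replace h with (z0 + h - z0)%C by ring. rewrite E. ring. }
    rewrite g1 by exact Nz. replace (z0 + h - z0)%C with h by ring.
    assert (G := HK (S (S n)) h Hh). rewrite Rmult_1_l in G.
    assert (Hp : 0 < Cmod h ^ n) by (apply pow_lt; exact (proj1 (Cmod_gt_0 h) N)).
    assert (Z : psum p h n = 0).
    { clear - Hv. induction n as [ | n IH]; simpl; [reflexivity | ].
      rewrite IH by (intros k Hk; apply Hv; lia). rewrite Hv by lia. ring. }
    apply Rmult_le_reg_l with (Cmod h ^ n); [exact Hp | ].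
    rewrite <- Cmod_pow, <- Cmod_mult.
    replace (h ^ n * (f (z0 + h) / h ^ n - p n - h * p (S n)))%C with (f (z0 + h) - psum p h (S (S n)))%C.
    * apply Rle_trans with (1 := G). rewrite Cmod_pow. right. simpl. ring.
    * simpl. rewrite Z. field. now apply Cpow_nz.
Qed.

(** Two mean value estimates along the segment from 0 to h, each with the factor 2 of [rderiv_mvt],
    bound exp(h) - 1 - h by 4 e |h|^2 on the unit disc. *)
Lemma cderiv_Cexp (z : C) : cderiv Cexp z (Cexp z).
Proof.
apply (cderiv_quadratic Cexp z (Cexp z) (Cmod (Cexp z) * (4 * exp 1)) 1); [lra | ]. intros h Hh.
rewrite Cexp_plus.
replace (Cexp z * Cexp h - Cexp z - h * Cexp z)%C with (Cexp z * (Cexp h - 1 - h))%C by ring.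
rewrite Cmod_mult, Rmult_assoc. apply Rmult_le_compat_l; [apply Cmod_ge_0 | ].
assert (Hh0 := Cmod_ge_0 h).
assert (B : forall t s, 0 <= t <= 1 -> 0 <= s <= 1 -> Cmod (Cexp (h * (t * s)%R)%C) <= exp 1).
{ intros t s Ht Hs. rewrite Cmod_Cexp. apply exp_mono. rewrite re_scal_r.
  assert (G := re_le_Cmod h). assert (G' := Rle_abs (Re h)).
  assert (0 <= t * s <= 1) by nra. nra. }
assert (S1 : forall t, 0 <= t <= 1 -> Cmod (Cexp (h * t) - 1)%C <= 2 * (Cmod h * exp 1)).
{ intros t Ht.
  assert (G := rderiv_mvt (fun s => Cexp (h * t * s)%C) (fun s => h * t * Cexp (h * t * s))%C (Cmod h * exp 1)).
  cbv beta in G. replace (h * t * 0)%C with (RtoC 0) in G by ring. rewrite Cexp_0 in G.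
  replace (h * t * 1)%C with (h * t)%C in G by ring. apply G. intros s Hs. split; [apply rderiv_Cexp | ].
  rewrite !Cmod_mult, Cmod_R, Rabs_right, Rmult_assoc by lra. apply Rmult_le_compat_l; [exact Hh0 | ].
  replace (h * t * s)%C with (h * (t * s)%R)%C by (rewrite RtoC_mult; ring).
  assert (Bt := B t s Ht Hs). assert (Ge := Cmod_ge_0 (Cexp (h * (t * s)%R))).
  assert (He := exp_pos 1). nra. }
assert (G := rderiv_mvt (fun t => Cexp (h * t) - h * t)%C (fun t => h * Cexp (h * t) - h)%C (Cmod h * (2 * (Cmod h * exp 1)))).
cbv beta in G. replace (h * 0)%C with (RtoC 0) in G by ring. rewrite Cexp_0 in G. replace (h * 1)%C with h in G by ring.
replace (Cexp h - 1 - h)%C with (Cexp h - h - (1 - 0))%C by ring.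
eapply Rle_trans; [apply G | right; simpl; ring]. intros t Ht. split.
- apply rderiv_minus; [apply rderiv_Cexp | ]. eapply rderiv_eq; [apply rderiv_scal, rderiv_RtoC | ring].
- replace (h * Cexp (h * t) - h)%C with (h * (Cexp (h * t) - 1))%C by ring.
  rewrite Cmod_mult. apply Rmult_le_compat_l; [exact Hh0 | now apply S1].
Qed.

(** The two normed module structures on C share the norm on which the derivative estimate depends;
    the product and chain rules use the second. *)
Lemma cderiv_AbsRing (f : C -> C) (z l : C) :
  cderiv f z l <-> is_derive (K := C_AbsRing) (V := AbsRing_NormedModule C_AbsRing) f z l.
Proof. split; intros [_ H]; (split; [apply is_linear_scal_l | exact H]). Qed.

Lemma cderiv_mult (f g : C -> C) (z l m : C) :
  cderiv f z l -> cderiv g z m -> cderiv (fun z => f z * g z)%C z (l * g z + f z * m)%C.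
Proof.
rewrite !cderiv_AbsRing. intros Hf Hg.
exact (is_derive_mult (K := C_AbsRing) f g z l m Hf Hg Cmult_comm).
Qed.

Lemma cderiv_Cexp_affine (s t z : C) : cderiv (fun w => Cexp (s * w + t)%C) z (s * Cexp (s * z + t))%C.
Proof.
assert (L : is_derive (K := C_AbsRing) (V := AbsRing_NormedModule C_AbsRing) (fun w => s * w + t)%C z s).
{ apply cderiv_AbsRing, (cderiv_quadratic _ z s 0 1); [lra | ]. intros h _.
  replace (s * (z + h) + t - (s * z + t) - h * s)%C with (RtoC 0) by ring. rewrite Cmod_0. lra. }
exact (is_derive_comp (K := C_AbsRing) (V := C_NormedModule) Cexp (fun w => s * w + t)%C z (Cexp (s * z + t)%C) s (cderiv_Cexp _) L).
Qed.

(** * Differentiation on a closed interval and the sine-Gordon pencil *)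

Definition ideriv (T : R) (p : R -> C) (z : R) (l : C) : Prop :=
  filterlim (diff_quot p z) (within (on_I T) (locally' z)) (locally l).

Definition ideriv_eps (T : R) (p : R -> C) (z : R) (l : C) : Prop :=
  forall eps : posreal, exists delta : posreal, forall y : R, on_I T y ->
    Rabs (y - z) < delta -> Cmod (p y - p z - RtoC (y - z) * l)%C <= eps * Rabs (y - z).

Lemma ideriv_of_eps (T : R) (p : R -> C) (z : R) (l : C) : ideriv_eps T p z l -> ideriv T p z l.
Proof.
intros H. apply filterlim_locally. intros eps.
assert (He : 0 < eps / 2) by (assert (G := cond_pos eps); lra).
destruct (H (mkposreal _ He)) as [d Hd]. exists d. intros y Hy Hn Hi.
apply (C_NormedModule_mixin_compat1 l).
change (minus (diff_quot p z y) l) with (diff_quot p z y - l)%C. unfold diff_quot.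
assert (Hyz : y - z <> 0) by lra.
assert (HC : RtoC (y - z) <> 0) by (intros E; apply Hyz; now apply RtoC_inj).
replace ((p y - p z) / RtoC (y - z) - l)%C with ((p y - p z - RtoC (y - z) * l) / RtoC (y - z))%C by (field; exact HC).
rewrite Cmod_div, Cmod_R by exact HC.
specialize (Hd y Hi Hy). simpl in Hd.
assert (Ha : 0 < Rabs (y - z)) by now apply Rabs_pos_lt.
apply Rle_lt_trans with (eps / 2); [ | assert (G := cond_pos eps); lra].
apply Rmult_le_reg_r with (Rabs (y - z)); [exact Ha | ].
unfold Rdiv at 1. rewrite Rmult_assoc, Rinv_l by lra. lra.
Qed.

Lemma ideriv_to_eps (T : R) (p : R -> C) (z : R) (l : C) : ideriv T p z l -> ideriv_eps T p z l.
Proof.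
intros H eps.
(* The balls of C as a product space are squares, so passing to [Cmod] costs sqrt 2 <= 2; halving
   [eps] pays for it. *)
assert (He : 0 < eps / 2) by (assert (G := cond_pos eps); lra).
destruct (proj1 (filterlim_locally _ _) H (mkposreal _ He)) as [d Hd]. exists d. intros y Hi Hy.
destruct (Req_dec y z) as [-> | N].
- replace (p z - p z - RtoC (z - z) * l)%C with (RtoC 0).
  + rewrite Cmod_0, Rminus_diag, Rabs_R0. lra.
  + rewrite Rminus_diag. ring.
- assert (B := C_NormedModule_mixin_compat2 _ _ _ (Hd y Hy N Hi)). simpl in B.
  change (minus (diff_quot p z y) l) with (diff_quot p z y - l)%C in B. unfold diff_quot in B.
  assert (Hyz : y - z <> 0) by lra.
  assert (HC : RtoC (y - z) <> 0) by (intros E; apply Hyz; now apply RtoC_inj).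
  replace (p y - p z - RtoC (y - z) * l)%C with (((p y - p z) / RtoC (y - z) - l) * RtoC (y - z))%C by (field; exact HC).
  rewrite Cmod_mult, Cmod_R. apply Rmult_le_compat_r; [apply Rabs_pos | ].
  assert (S2 : sqrt 2 <= 2).
  { rewrite <- (sqrt_square 2) at 2 by lra. apply sqrt_le_1; lra. }
  assert (sqrt 2 * (eps / 2) <= 2 * (eps / 2)) by (apply Rmult_le_compat_r; lra). lra.
Qed.

Lemma rderiv_ideriv (T : R) (p : R -> C) (z : R) (l : C) : rderiv p z l -> ideriv T p z l.
Proof.
intros H. apply ideriv_of_eps. intros eps. destruct (proj1 (rderiv_eps p z l) H eps) as [d Hd].
exists d. intros y _ Hy. now apply Hd.
Qed.

Lemma ideriv_ext (T : R) (p q : R -> C) (z : R) (l : C) :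
  on_I T z -> (forall y, on_I T y -> p y = q y) -> ideriv T p z l -> ideriv T q z l.
Proof.
intros Hz E H. apply ideriv_of_eps. apply ideriv_to_eps in H. intros eps. destruct (H eps) as [d Hd].
exists d. intros y Hi Hy. rewrite <- !E by assumption. now apply Hd.
Qed.

Definition clamp (T z : R) : R := Rmax 0 (Rmin T z).

Lemma clamp_in (T z : R) : on_I T z -> clamp T z = z.
Proof. intros [H1 H2]. unfold clamp. rewrite Rmin_right by exact H2. now apply Rmax_right. Qed.

(* Turns one-sided derivatives at the ends of [0,T] into two-sided ones. *)
Definition affine_ext (T : R) (p dp : R -> C) (z : R) : C :=
  (p (clamp T z) + RtoC (z - clamp T z) * dp (clamp T z))%C.

Lemma affine_ext_in (T : R) (p dp : R -> C) (z : R) : on_I T z -> affine_ext T p dp z = p z.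
Proof. intros H. unfold affine_ext. rewrite clamp_in by exact H. rewrite Rminus_diag. ring. Qed.

Lemma rderiv_affine_ext (T : R) (p dp : R -> C) (z : R) : 0 < T -> on_I T z ->
  ideriv T p z (dp z) -> rderiv (affine_ext T p dp) z (dp z).
Proof.
intros HT Hz H. apply rderiv_eps. apply ideriv_to_eps in H. intros eps. destruct (H eps) as [d Hd].
(* Within these radii a point outside [0,T] can only lie beyond an endpoint equal to [z], where the
   extension is exactly affine and the error is zero. *)
set (r1 := if Req_dec_T z 0 then T else z). set (r2 := if Req_dec_T z T then T else T - z).
assert (R1 : 0 < r1) by (unfold r1, on_I in *; destruct (Req_dec_T z 0); lra).
assert (R2 : 0 < r2) by (unfold r2, on_I in *; destruct (Req_dec_T z T); lra).
assert (R3 : 0 < Rmin d (Rmin r1 r2)) by (apply Rmin_pos; [apply cond_pos | now apply Rmin_pos]).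
exists (mkposreal _ R3). simpl. intros y Hy.
assert (Y1 := Rlt_le_trans _ _ _ Hy (Rmin_l _ _)).
assert (Y2 := Rlt_le_trans _ _ _ Hy (Rmin_r _ _)).
assert (Y3 := Rlt_le_trans _ _ _ Y2 (Rmin_l _ _)).
assert (Y4 := Rlt_le_trans _ _ _ Y2 (Rmin_r _ _)).
rewrite (affine_ext_in T p dp z Hz).
assert (Zero : forall x : C, x = 0 -> Cmod x <= eps * Rabs (y - z)).
{ intros x ->. rewrite Cmod_0. apply Rmult_le_pos; [left; apply cond_pos | apply Rabs_pos]. }
destruct (Rlt_dec y 0) as [L | L]; [ | destruct (Rlt_dec T y) as [L' | L']].
- assert (z = 0).
  { unfold r1 in Y3. destruct (Req_dec_T z 0); [assumption | ]. apply Rabs_lt_between in Y3. lra. }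
  subst z. apply Zero. unfold affine_ext, clamp. rewrite Rmin_right, Rmax_left by lra. ring.
- assert (z = T).
  { unfold r2 in Y4. destruct (Req_dec_T z T); [assumption | ]. apply Rabs_lt_between in Y4. lra. }
  subst z. apply Zero. unfold affine_ext, clamp. rewrite Rmin_left, Rmax_right by lra. ring.
- assert (Hi : on_I T y) by (unfold on_I; lra).
  rewrite affine_ext_in by exact Hi. now apply Hd.
Qed.

Lemma derivable_ideriv (T : R) (p : R -> C) (z : R) : 0 < T -> on_I T z -> derivable_I T p -> ideriv T p z (derive_I T p z).
Proof.
intros HT Hz H. destruct (H z Hz) as [l Hl]. rewrite (derive_I_unique T p z l HT Hz Hl). exact Hl.
Qed.

Lemma derive_I_rderiv (T : R) (p : R -> C) (z : R) (l : C) : 0 < T -> on_I T z -> rderiv p z l -> derive_I T p z = l.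
Proof. intros HT Hz H. apply derive_I_unique; [exact HT | exact Hz | now apply rderiv_ideriv]. Qed.

Lemma derive_I_I_rderiv (T : R) (p dp : R -> C) (z : R) (l : C) : 0 < T -> on_I T z ->
  (forall y, rderiv p y (dp y)) -> rderiv dp z l -> ideriv T (derive_I T p) z l.
Proof.
intros HT Hz H1 H2. apply (ideriv_ext T dp); [exact Hz | | now apply rderiv_ideriv].
intros y Hy. symmetry. now apply derive_I_rderiv.
Qed.

Lemma C2_I_rderiv (T : R) (p dp ddp : R -> C) : 0 < T ->
  (forall y, rderiv p y (dp y)) -> (forall y, rderiv dp y (ddp y)) -> (forall y, exists l, rderiv ddp y l) ->
  C2_I T p.
Proof.
intros HT H1 H2 H3. split; [ | split].
- intros z Hz. exists (dp z). now apply rderiv_ideriv.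
- intros z Hz. exists (ddp z). now apply (derive_I_I_rderiv T p dp).
- assert (E : forall y, on_I T y -> derive_I T (derive_I T p) y = ddp y).
  { intros y Hy. apply derive_I_unique; [exact HT | exact Hy | now apply (derive_I_I_rderiv T p dp)]. }
  apply (continuous_on_ext (on_I T) ddp).
  + intros y Hy. symmetry. now apply E.
  + apply continuous_on_forall. intros y _. destruct (H3 y) as [l Hl]. exact (rderiv_continuous ddp y l Hl).
Qed.

(** * The sine-Gordon pencil and its chains in coordinates *)

Definition kap (c : R) : C := RtoC (c ^ 2 - 1)%R.

Lemma kap_neq_0 (c : R) : c ^ 2 <> 1 -> kap c <> 0.
Proof. intros H E. apply RtoC_inj in E. lra. Qed.

(** The equation L_SG(zeta + h) p = 0 solved for p'', with zeta + h and (zeta + h)^2 expanded in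
    h. *)
Definition SG (c : R) (U : R -> R) (zeta : C) : pencil :=
  Pencil (2 * Ci * c * zeta / kap c)%C (2 * Ci * c / kap c)%C
    (fun z => zeta ^ 2 / kap c - RtoC (cos (U z) / (c ^ 2 - 1)%R))%C
    (2 * zeta / kap c)%C (/ kap c)%C.

Lemma LSG_coefs (c T : R) (U : R -> R) (zeta : C) (p : R -> C) (z : R) : c ^ 2 <> 1 ->
  LSG c T U zeta p z = (derive_I T (derive_I T p) z
    - (be0 (SG c U zeta) * derive_I T p z + ga0 (SG c U zeta) z * p z))%C /\
  LSG_deriv c T U 1 zeta p z = (- (be1 (SG c U zeta) * derive_I T p z + ga1 (SG c U zeta) * p z))%C /\
  (/ RtoC (INR (fact 2)) * LSG_deriv c T U 2 zeta p z)%C = (- (ga2 (SG c U zeta) * p z))%C.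
Proof.
intros Hc. assert (Hk := kap_neq_0 c Hc). rewrite LSG_deriv_1, LSG_deriv_2.
unfold LSG. cbn [be0 be1 ga0 ga1 ga2 SG]. fold (kap c).
assert (H2 : RtoC 2 <> 0) by (intros E; apply RtoC_inj in E; lra).
split; [ | split].
- field. exact Hk.
- field. exact Hk.
- simpl (INR (fact 2)). replace (RtoC (1 + 1)) with (RtoC 2) by (f_equal; ring). field. repeat split; assumption.
Qed.

Lemma sum_n_three (f : nat -> C) (k : nat) : (forall j, (3 <= j)%nat -> f j = 0) ->
  sum_n f k = (f O + sh (fun _ => f 1%nat) k + sh (sh (fun _ => f 2%nat)) k)%C.
Proof.
intros H. destruct k as [ | [ | k]]; cbn [sh].
- rewrite sum_O. cring.
- rewrite sum_Sn, sum_O. change plus with Cplus. cring.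
- induction k as [ | k IH].
  + rewrite !sum_Sn, sum_O. change plus with Cplus. cring.
  + rewrite sum_Sn, IH, (H (S (S (S k)))) by lia. change plus with Cplus. cring.
Qed.

(** The derivatives of the pencil divided by j! are its coefficients in h and vanish from j = 3 on.
    The Jordan sum is therefore the defect in the chain recursion, [sh] supplying zeros where k - j
    would be negative. *)
Lemma jordan_sum (c T : R) (U : R -> R) (zeta : C) (p : nat -> R -> C) (z : R) (k : nat) : c ^ 2 <> 1 ->
  sum_n (fun j : nat => (/ RtoC (INR (fact j)) * LSG_deriv c T U j zeta (p (k - j)%nat) z)%C) k =
  (derive_I T (derive_I T (p k)) z
   - rhs (SG c U zeta) z (fun j => p j z) (fun j => derive_I T (p j) z) k)%C.
Proof.
intros Hc. rewrite sum_n_three.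
- rewrite rhs_eq.
  replace (/ RtoC (INR (fact 0)) * LSG_deriv c T U 0 zeta (p (k - 0)%nat) z)%C with (LSG c T U zeta (p k) z).
  2: { rewrite Nat.sub_0_r, LSG_deriv_0. change (INR (fact 0)) with 1. field. }
  rewrite (proj1 (LSG_coefs c T U zeta (p k) z Hc)).
  replace (/ RtoC (INR (fact 1)) * LSG_deriv c T U 1 zeta (p (k - 1)%nat) z)%C with (LSG_deriv c T U 1 zeta (p (k - 1)%nat) z).
  2: { change (INR (fact 1)) with 1. field. }
  rewrite (proj1 (proj2 (LSG_coefs c T U zeta (p (k - 1)%nat) z Hc))).
  rewrite (proj2 (proj2 (LSG_coefs c T U zeta (p (k - 2)%nat) z Hc))).
  destruct k as [ | [ | k]]; cbn [sh].
  + cring.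
  + change (1 - 1)%nat with 0%nat. cring.
  + replace (S (S k) - 1)%nat with (S k) by lia. replace (S (S k) - 2)%nat with k by lia. cring.
- intros j Hj. rewrite LSG_deriv_ge3 by exact Hj. apply Cmult_0_r.
Qed.

Lemma SG_bounded (c T : R) (U : R -> R) (zeta : C) : exists M, bounded_by (SG c U zeta) T M.
Proof.
exists (Cmod (be0 (SG c U zeta)) + Cmod (be1 (SG c U zeta)) + (Cmod (zeta ^ 2 / kap c)%C + Rabs (/ (c ^ 2 - 1)))
  + Cmod (ga1 (SG c U zeta)) + Cmod (ga2 (SG c U zeta))).
assert (H1 := Cmod_ge_0 (be0 (SG c U zeta))). assert (H2 := Cmod_ge_0 (be1 (SG c U zeta))).
assert (H3 := Cmod_ge_0 (ga1 (SG c U zeta))). assert (H4 := Cmod_ge_0 (ga2 (SG c U zeta))).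
assert (H5 := Cmod_ge_0 (zeta ^ 2 / kap c)%C). assert (H6 := Rabs_pos (/ (c ^ 2 - 1))).
split; [lra | split; [lra | split; [ | split; lra]]].
intros z _. cbn [ga0 SG] in *.
apply Rle_trans with (Cmod (zeta ^ 2 / kap c)%C + Rabs (/ (c ^ 2 - 1))); [ | lra].
unfold Cminus. eapply Rle_trans; [apply Cmod_triangle | ]. apply Rplus_le_compat_l.
rewrite Cmod_opp, Cmod_R. unfold Rdiv. rewrite Rabs_mult.
assert (Hc : Rabs (cos (U z)) <= 1) by (apply Rabs_le; apply COS_bound).
assert (Rabs (cos (U z)) * Rabs (/ (c ^ 2 - 1)) <= 1 * Rabs (/ (c ^ 2 - 1))) by (apply Rmult_le_compat_r; assumption).
lra.
Qed.

Lemma SG_ga0_rderiv (c : R) (U : R -> R) (zeta : C) (z : R) : (forall x, ex_derive U x) ->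
  exists l, rderiv (ga0 (SG c U zeta)) z l.
Proof.
intros HU. destruct (HU z) as [u Hu].
exists (0 - RtoC (- (u * sin (U z)) / (c ^ 2 - 1)))%C. cbn [ga0 SG].
apply rderiv_minus; [apply rderiv_const | ]. apply rderiv_components. split; simpl.
- evar_last; [apply (is_derive_scal_l (fun x => cos (U x)) z (u * - sin (U z)) (/ (c ^ 2 - 1))) | ].
  + apply (is_derive_comp cos U z (- sin (U z)) u); [ | exact Hu]. apply is_derive_Reals, derivable_pt_lim_cos.
  + unfold scal; simpl; unfold mult; simpl. unfold Rdiv. ring.
- apply (is_derive_const (V := R_NormedModule)).
Qed.

(** Gives continuity of the second derivatives of a chain, as [C2_I] demands. *)
Lemma SG_rhs_rderiv (c : R) (U : R -> R) (zeta : C) (a b : nat -> R -> C) (k : nat) (z : R) :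
  (forall x, ex_derive U x) ->
  (forall j x, exists l, rderiv (a j) x l) -> (forall j x, exists l, rderiv (b j) x l) ->
  exists l, rderiv (fun x => rhs (SG c U zeta) x (at_z a x) (at_z b x) k) z l.
Proof.
intros HU Ha Hb.
assert (S1 : forall f : nat -> R -> C, (forall j x, exists l, rderiv (f j) x l) ->
   forall j, exists l, rderiv (fun x => sh (at_z f x) j) z l).
{ intros f Hf [ | j]; [exists 0; apply (rderiv_const 0 z) | apply Hf]. }
assert (S2 : forall f : nat -> R -> C, (forall j x, exists l, rderiv (f j) x l) ->
   forall j, exists l, rderiv (fun x => sh (sh (at_z f x)) j) z l).
{ intros f Hf [ | [ | j]]; [exists 0; apply (rderiv_const 0 z) | exists 0; apply (rderiv_const 0 z) | apply Hf]. }
destruct (Ha k z) as [l1 L1]. destruct (Hb k z) as [l2 L2].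
destruct (S1 a Ha k) as [l3 L3]. destruct (S1 b Hb k) as [l4 L4]. destruct (S2 a Ha k) as [l5 L5].
destruct (SG_ga0_rderiv c U zeta z HU) as [l6 L6].
eexists. eapply rderiv_ext; [intros x; symmetry; apply rhs_eq | ].
apply rderiv_plus; [apply rderiv_plus | apply rderiv_plus; [apply rderiv_plus | ]]; [apply rderiv_scal; exact L2 | apply rderiv_scal; exact L4
  | apply rderiv_mult; [exact L6 | exact L1] | apply rderiv_scal; exact L3 | apply rderiv_scal; exact L5].
Qed.

Definition mu (theta : R) : C := Cexp (- (Ci * theta)).

(** Kernel of Phi(T) - exp(-i theta) modulo h^m. The multiplier is free of h, so only the constant
    terms of the diagonal change. *)
Definition bc (theta T : R) (a1 b1 a2 b2 : nat -> R -> C) (m : nat) : series -> series -> Prop :=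
  Ker m (ssub (at_z a1 T) (sconst (mu theta))) (at_z a2 T)
        (at_z b1 T) (ssub (at_z b2 T) (sconst (mu theta))).

Definition normalized (a1 b1 a2 b2 : nat -> R -> C) : Prop :=
  at_z a1 0 = sconst 1 /\ at_z b1 0 = szero /\ at_z a2 0 = szero /\ at_z b2 0 = sconst 1.

(** A row of the fundamental matrix of series applied to the vector (u, v); [u] and [v] are then the
    initial values and slopes of all orders. *)
Definition combine (a1 a2 : nat -> R -> C) (u v : series) (k : nat) (z : R) : C :=
  (act a1 u k z + act a2 v k z)%C.

Lemma combine_at_0 (a1 b1 a2 b2 : nat -> R -> C) (u v : series) (k : nat) : normalized a1 b1 a2 b2 ->
  combine a1 a2 u v k 0 = u k /\ combine b1 b2 u v k 0 = v k.
Proof.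
intros [E1 [E2 [E3 E4]]]. unfold combine, act. rewrite E1, E2, E3, E4. split.
- replace (conv (sconst 1) u) with u by ring. replace (conv szero v) with szero by ring. unfold szero. ring.
- replace (conv (sconst 1) v) with v by ring. replace (conv szero u) with szero by ring. unfold szero. ring.
Qed.

Lemma chain_combine (P : pencil) (T : R) (n : nat) (a1 b1 a2 b2 : nat -> R -> C) (u v : series) :
  chain P a1 b1 -> chain P a2 b2 ->
  chain_upto P T n (combine a1 a2 u v) (combine b1 b2 u v).
Proof.
intros H1 H2.
assert (G := chain_add P T n 1 (act a1 u) (act b1 u) (act a2 v) (act b2 v)
  (chain_act P T n a1 b1 u (fun k z _ _ => H1 k z)) (chain_act P T n a2 b2 v (fun k z _ _ => H2 k z))).
replace (combine a1 a2 u v) with (fun k z => act a1 u k z + 1 * act a2 v k z)%C.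
- replace (combine b1 b2 u v) with (fun k z => act b1 u k z + 1 * act b2 v k z)%C; [exact G | ].
  do 2 (apply functional_extensionality; intros ?). unfold combine. ring.
- do 2 (apply functional_extensionality; intros ?). unfold combine. ring.
Qed.

Lemma bc_combine (theta T : R) (a1 b1 a2 b2 : nat -> R -> C) (m : nat) (u v : series) :
  normalized a1 b1 a2 b2 ->
  (bc theta T a1 b1 a2 b2 m u v <->
   forall k, (k < m)%nat ->
     combine a1 a2 u v k T = (mu theta * combine a1 a2 u v k 0)%C /\
     combine b1 b2 u v k T = (mu theta * combine b1 b2 u v k 0)%C).
Proof.
intros Hn.
assert (E1 : forall k, sadd (conv (ssub (at_z a1 T) (sconst (mu theta))) u) (conv (at_z a2 T) v) k =
  (combine a1 a2 u v k T - mu theta * u k)%C).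
{ intros k. unfold combine, act.
  replace (sadd (conv (ssub (at_z a1 T) (sconst (mu theta))) u) (conv (at_z a2 T) v))
    with (ssub (sadd (conv (at_z a1 T) u) (conv (at_z a2 T) v)) (conv (sconst (mu theta)) u)) by ring.
  rewrite conv_sconst_l. reflexivity. }
assert (E2 : forall k, sadd (conv (at_z b1 T) u) (conv (ssub (at_z b2 T) (sconst (mu theta))) v) k =
  (combine b1 b2 u v k T - mu theta * v k)%C).
{ intros k. unfold combine, act.
  replace (sadd (conv (at_z b1 T) u) (conv (ssub (at_z b2 T) (sconst (mu theta))) v))
    with (ssub (sadd (conv (at_z b1 T) u) (conv (at_z b2 T) v)) (conv (sconst (mu theta)) v)) by ring.
  rewrite conv_sconst_l. reflexivity. }
unfold bc, Ker, vanish. split.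
- intros [H1 H2] k Hk. destruct (combine_at_0 a1 b1 a2 b2 u v k Hn) as [-> ->].
  split; apply Ceq_minus; [rewrite <- E1; now apply H1 | rewrite <- E2; now apply H2].
- intros H. split; intros k Hk; destruct (H k Hk) as [H1 H2];
    destruct (combine_at_0 a1 b1 a2 b2 u v k Hn) as [F1 F2]; rewrite F1 in H1; rewrite F2 in H2.
  + rewrite E1, H1. ring.
  + rewrite E2, H2. ring.
Qed.

Lemma jordan_of_bc (c T : R) (U : R -> R) (theta : R) (zeta : C) (a1 b1 a2 b2 : nat -> R -> C) (m : nat) (u v : series) :
  c ^ 2 <> 1 -> 0 < T -> (forall x, ex_derive U x) ->
  chain (SG c U zeta) a1 b1 -> chain (SG c U zeta) a2 b2 -> normalized a1 b1 a2 b2 ->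
  bc theta T a1 b1 a2 b2 m u v ->
  jordan_tuple c T U theta zeta m (combine a1 a2 u v).
Proof.
intros Hc HT HU H1 H2 Hn Hbc.
set (a := combine a1 a2 u v). set (b := combine b1 b2 u v).
assert (Hch : chain (SG c U zeta) a b).
{ intros k z.
  assert (A1 : forall f g : nat -> R -> C, (forall k x, rderiv (f k) x (g k x)) -> forall w k x, rderiv (act f w k) x (act g w k x)).
  { intros f g Hfg w j x. apply (rderiv_conv f (at_z g x)). intros i _. apply Hfg. }
  set (R1 := fun k x => rhs (SG c U zeta) x (at_z a1 x) (at_z b1 x) k).
  set (R2 := fun k x => rhs (SG c U zeta) x (at_z a2 x) (at_z b2 x) k).
  split.
  - apply rderiv_plus; apply A1; intros j x; [apply H1 | apply H2].
  - eapply rderiv_eq.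
    + apply rderiv_plus; [apply (A1 b1 R1) | apply (A1 b2 R2)]; intros j x; [apply H1 | apply H2].
    + unfold act. change (at_z R1 z) with (rhs (SG c U zeta) z (at_z a1 z) (at_z b1 z)).
      change (at_z R2 z) with (rhs (SG c U zeta) z (at_z a2 z) (at_z b2 z)).
      change (at_z a z) with (sadd (conv (at_z a1 z) u) (conv (at_z a2 z) v)).
      change (at_z b z) with (sadd (conv (at_z b1 z) u) (conv (at_z b2 z) v)).
      unfold rhs.
      match goal with |- (?f k + ?g k)%C = ?h k => change (sadd f g k = h k); replace h with (sadd f g) by ring end.
      reflexivity. }
assert (Dd : forall k z, on_I T z -> derive_I T (a k) z = b k z).
{ intros k z Hz. apply derive_I_rderiv; [exact HT | exact Hz | apply Hch]. }
assert (Ddd : forall k z, on_I T z ->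
  derive_I T (derive_I T (a k)) z = rhs (SG c U zeta) z (at_z a z) (at_z b z) k).
{ intros k z Hz. apply derive_I_unique; [exact HT | exact Hz | ].
  apply (derive_I_I_rderiv T (a k) (b k)); [exact HT | exact Hz | intros y; apply Hch | apply Hch]. }
assert (I0 : on_I T 0) by (unfold on_I; lra). assert (IT : on_I T T) by (unfold on_I; lra).
split.
- intros k Hk. split; [ | ].
  + apply (C2_I_rderiv T (a k) (b k) (fun z => rhs (SG c U zeta) z (at_z a z) (at_z b z) k) HT).
    * intros y; apply Hch.
    * intros y; apply Hch.
    * intros y. apply SG_rhs_rderiv; [exact HU | | ]; intros j x; eexists; apply Hch.
  + rewrite !Dd by assumption. apply (bc_combine theta T a1 b1 a2 b2 m u v Hn); assumption.
- intros k Hk z Hz. rewrite jordan_sum by exact Hc. rewrite Ddd by exact Hz.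
  replace (fun j => derive_I T (a j) z) with (at_z b z).
  + change (fun j => a j z) with (at_z a z). cring.
  + apply functional_extensionality; intros j. unfold at_z. now rewrite Dd.
Qed.

(** The series of initial values and slopes determine the tuple: its difference from [combine] is a
    chain with zero data. Affine extension supplies the two-sided derivatives that [chain_upto] asks
    for. *)
Lemma bc_of_jordan (c T : R) (U : R -> R) (theta : R) (zeta : C) (a1 b1 a2 b2 : nat -> R -> C) (m : nat) (p : nat -> R -> C) :
  c ^ 2 <> 1 -> 0 < T ->
  chain (SG c U zeta) a1 b1 -> chain (SG c U zeta) a2 b2 -> normalized a1 b1 a2 b2 ->
  jordan_tuple c T U theta zeta m p ->
  exists u v, bc theta T a1 b1 a2 b2 m u v /\
    forall k z, (k < m)%nat -> on_I T z -> p k z = combine a1 a2 u v k z.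
Proof.
intros Hc HT H1 H2 Hn [Hd He].
(* [chain_upto] with bound n covers the orders 0 to n, that is, m = n + 1 orders; m = 0 is
   vacuous. *)
destruct m as [ | n].
{ exists szero, szero. split; [split; intros k Hk; lia | intros k z Hk; lia]. }
set (u := fun k => p k 0). set (v := fun k => derive_I T (p k) 0).
exists u, v.
set (a := fun k => affine_ext T (p k) (derive_I T (p k))).
set (b := fun k => affine_ext T (derive_I T (p k)) (derive_I T (derive_I T (p k)))).
assert (I0 : on_I T 0) by (unfold on_I; lra). assert (IT : on_I T T) by (unfold on_I; lra).
assert (Ea : forall k z, on_I T z -> a k z = p k z) by (intros; now apply affine_ext_in).
assert (Eb : forall k z, on_I T z -> b k z = derive_I T (p k) z) by (intros; now apply affine_ext_in).
assert (Hch : chain_upto (SG c U zeta) T n a b).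
{ intros k z Hk Hz. destruct (Hd k) as [[Hp1 [Hp2 _]] _]; [lia | ]. split.
  - rewrite Eb by exact Hz. apply rderiv_affine_ext; [exact HT | exact Hz | now apply derivable_ideriv].
  - assert (G : (derive_I T (derive_I T (p k)) z
       - rhs (SG c U zeta) z (fun j => p j z) (fun j => derive_I T (p j) z) k)%C = 0).
    { rewrite <- jordan_sum by exact Hc. apply He; [lia | exact Hz]. }
    apply rderiv_eq with (derive_I T (derive_I T (p k)) z).
    + apply rderiv_affine_ext; [exact HT | exact Hz | now apply derivable_ideriv].
    + assert (Fa : at_z a z = fun j => p j z) by (apply functional_extensionality; intros j; exact (Ea j z Hz)).
      assert (Fb : at_z b z = fun j => derive_I T (p j) z) by (apply functional_extensionality; intros j; exact (Eb j z Hz)).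
      rewrite Fa, Fb. exact (proj2 (Ceq_minus _ _) G). }
assert (Hcc := chain_combine (SG c U zeta) T n a1 b1 a2 b2 u v H1 H2).
destruct (SG_bounded c T U zeta) as [M HM].
assert (Z := chain_zero (SG c U zeta) T M n _ _ HM (chain_add _ T n (-1) _ _ _ _ Hch Hcc)).
assert (Q : forall k z, (k <= n)%nat -> on_I T z -> p k z = combine a1 a2 u v k z /\ derive_I T (p k) z = combine b1 b2 u v k z).
{ intros k z Hk Hz. destruct (Z) with (k := k) (z := z) as [Z1 Z2]; [ | exact Hk | exact Hz | ].
  - intros j Hj. destruct (combine_at_0 a1 b1 a2 b2 u v j Hn) as [F1 F2]. rewrite F1, F2, Ea, Eb by exact I0.
    unfold u, v. split; ring.
  - rewrite Ea in Z1 by exact Hz. rewrite Eb in Z2 by exact Hz.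
    split; apply Ceq_minus; [rewrite <- Z1 | rewrite <- Z2]; ring. }
split.
- apply (bc_combine theta T a1 b1 a2 b2 (S n) u v Hn). intros k Hk.
  destruct (Hd k Hk) as [_ [B1 B2]].
  destruct (Q k T) as [Q1 Q2]; [lia | exact IT | ]. destruct (Q k 0) as [Q3 Q4]; [lia | exact I0 | ].
  rewrite <- Q1, <- Q2, <- Q3, <- Q4. now split.
- intros k z Hk Hz. apply Q; [lia | exact Hz].
Qed.

(** * The monodromy determinant *)

Definition hill_system (c : R) (U : R -> R) (q1 dq1 q2 dq2 : R -> C -> C) : Prop :=
  (forall zeta, hill_solution c U zeta (fun z => q1 z zeta) (fun z => dq1 z zeta)) /\
  (forall zeta, q1 0 zeta = 1 /\ dq1 0 zeta = 0) /\
  (forall zeta, hill_solution c U zeta (fun z => q2 z zeta) (fun z => dq2 z zeta)) /\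
  (forall zeta, q2 0 zeta = 0 /\ dq2 0 zeta = 1).

Definition ial (c : R) (zeta : C) : C := (Ci * (c * zeta / kap c))%C.

Definition gauge (c : R) (zeta : C) (q : R -> C) (z : R) : C := (Cexp (ial c zeta * z) * q z)%C.
Definition dgauge (c : R) (zeta : C) (q dq : R -> C) (z : R) : C :=
  (Cexp (ial c zeta * z) * (ial c zeta * q z + dq z))%C.

Lemma Ci_sq : (Ci * Ci = - (1))%C.
Proof. unfold Ci, Cmult, Copp, RtoC; simpl. apply injective_projections; simpl; ring. Qed.

Lemma RtoC_sq_kap (c : R) : (RtoC c * RtoC c = kap c + 1)%C.
Proof. unfold kap. rewrite <- RtoC_mult, <- RtoC_plus. f_equal. ring. Qed.

(** [ial] is half of [be0], so the exponential produces the first-order term. The zero-order terms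
    match because c^2 = (c^2 - 1) + 1. *)
Lemma hill_gauge (c : R) (U : R -> R) (zeta : C) (q dq : R -> C) : c ^ 2 <> 1 ->
  hill_solution c U zeta q dq -> sol (SG c U zeta) (gauge c zeta q) (dgauge c zeta q dq).
Proof.
intros Hc [H1 H2] z. assert (Hk := kap_neq_0 c Hc).
assert (G1 := rderiv_is_derive _ _ _ (H1 z)). assert (G2 := rderiv_is_derive _ _ _ (H2 z)).
unfold gauge, dgauge. split.
- eapply rderiv_eq; [apply rderiv_mult; [apply rderiv_Cexp | exact G1] | cbv beta; ring].
- eapply rderiv_eq.
  + apply rderiv_mult; [apply rderiv_Cexp | apply rderiv_plus; [apply rderiv_scal; exact G1 | exact G2]].
  + cbv beta. cbn [be0 ga0 SG]. replace (RtoC ((c ^ 2 - 1) ^ 2)) with (kap c * kap c)%C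
      by (unfold kap; rewrite <- RtoC_mult; f_equal; ring).
    set (e := Cexp _). set (w := RtoC (cos (U z) / (c ^ 2 - 1))).
    set (i := ial c zeta).
    assert (Ei : (2 * Ci * c * zeta / kap c)%C = (2 * i)%C) by (unfold i, ial; field; exact Hk).
    assert (Ei2 : (i * i)%C = (- ((kap c + 1) * (zeta * zeta) / (kap c * kap c)))%C).
    { unfold i, ial. rewrite <- RtoC_sq_kap.
      replace (Ci * (c * zeta / kap c) * (Ci * (c * zeta / kap c)))%C with ((Ci * Ci) * (c * c) * (zeta * zeta) / (kap c * kap c))%C by (field; exact Hk).
      rewrite Ci_sq. field. exact Hk. }
    rewrite Ei.
    replace (i * e * (i * q z + dq z) + e * (i * dq z + - ((zeta ^ 2 / (kap c * kap c) + w) * q z)))%C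
      with (e * ((i * i) * q z + 2 * i * dq z - (zeta ^ 2 / (kap c * kap c) + w) * q z))%C by ring.
    replace (2 * i * (e * (i * q z + dq z)) + (zeta ^ 2 / kap c - w) * (e * q z))%C
      with (e * (2 * (i * i) * q z + 2 * i * dq z + (zeta ^ 2 / kap c - w) * q z))%C by ring.
    rewrite Ei2. field. exact Hk.
Qed.

Lemma hill_lincomb (c : R) (U : R -> R) (zeta s : C) (q dq r dr : R -> C) :
  hill_solution c U zeta q dq -> hill_solution c U zeta r dr ->
  hill_solution c U zeta (fun z => q z - s * r z)%C (fun z => dq z - s * dr z)%C.
Proof.
assert (K : forall f z l, rderiv f z l -> is_derive (K := R_AbsRing) (V := C_R_NormedModule) f z l) by (intros f z l H; exact H).
intros [H1 H2] [H3 H4]. split; intros z; apply K.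
- apply rderiv_minus; [apply rderiv_is_derive, H1 | apply rderiv_scal, rderiv_is_derive, H3].
- eapply rderiv_eq; [apply rderiv_minus; [apply rderiv_is_derive, H2 | apply rderiv_scal, rderiv_is_derive, H4] | ring].
Qed.

(** The exponential gives [q1] the slope [ial] at 0; subtracting [ial] times [q2] restores slope
    0. *)
Definition Y1 (c : R) (q1 q2 : R -> C -> C) (zeta : C) : R -> C :=
  gauge c zeta (fun z => q1 z zeta - ial c zeta * q2 z zeta)%C.
Definition dY1 (c : R) (q1 dq1 q2 dq2 : R -> C -> C) (zeta : C) : R -> C :=
  dgauge c zeta (fun z => q1 z zeta - ial c zeta * q2 z zeta)%C (fun z => dq1 z zeta - ial c zeta * dq2 z zeta)%C.
Definition Y2 (c : R) (q2 : R -> C -> C) (zeta : C) : R -> C := gauge c zeta (fun z => q2 z zeta).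
Definition dY2 (c : R) (q2 dq2 : R -> C -> C) (zeta : C) : R -> C :=
  dgauge c zeta (fun z => q2 z zeta) (fun z => dq2 z zeta).

Lemma fundamental (c : R) (U : R -> R) (q1 dq1 q2 dq2 : R -> C -> C) (zeta : C) : c ^ 2 <> 1 ->
  hill_system c U q1 dq1 q2 dq2 ->
  sol (SG c U zeta) (Y1 c q1 q2 zeta) (dY1 c q1 dq1 q2 dq2 zeta) /\
  sol (SG c U zeta) (Y2 c q2 zeta) (dY2 c q2 dq2 zeta) /\
  Y1 c q1 q2 zeta 0 = 1 /\ dY1 c q1 dq1 q2 dq2 zeta 0 = 0 /\
  Y2 c q2 zeta 0 = 0 /\ dY2 c q2 dq2 zeta 0 = 1.
Proof.
intros Hc [H1 [I1 [H2 I2]]]. destruct (I1 zeta) as [A1 A2]. destruct (I2 zeta) as [A3 A4].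
split; [ | split].
- apply hill_gauge; [exact Hc | ]. now apply hill_lincomb.
- now apply hill_gauge.
- unfold Y1, dY1, Y2, dY2, gauge, dgauge. rewrite A1, A2, A3, A4.
  replace (ial c zeta * 0)%C with (RtoC 0) by ring. rewrite Cexp_0.
  split; [ring | split; [ring | split; ring]].
Qed.

(* [- det (Phi(T) - exp(-i theta))], where [Phi] is the fundamental matrix with columns [(Y1, dY1)] and [(Y2, dY2)]. *)
Definition ndet (c T theta : R) (q1 dq1 q2 dq2 : R -> C -> C) (zeta : C) : C :=
  (Y2 c q2 zeta T * dY1 c q1 dq1 q2 dq2 zeta T
   + (- (1)) * ((Y1 c q1 q2 zeta T - mu theta) * (dY2 c q2 dq2 zeta T - mu theta)))%C.

(** With e = exp(ial T), Phi(T) has trace e tr(H) and determinant e^2. Hence [ndet] is mu e tr(H) -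
    e^2 - mu^2, and division by e mu leaves tr(H) - (e/mu + mu/e), whose bracket is twice the
    cosine. *)
Lemma D2_ndet (c T theta : R) (U : R -> R) (q1 dq1 q2 dq2 : R -> C -> C) (zeta : C) : c ^ 2 <> 1 ->
  hill_system c U q1 dq1 q2 dq2 ->
  D2 c T (hill_matrix q1 dq1 q2 dq2 T) zeta theta =
  (Cexp (- (Ci * c * T / kap c) * zeta + Ci * theta) * ndet c T theta q1 dq1 q2 dq2 zeta)%C.
Proof.
intros Hc HH. assert (Hk := kap_neq_0 c Hc).
destruct (fundamental c U q1 dq1 q2 dq2 zeta Hc HH) as [S1 [S2 [E1 [E2 [E3 E4]]]]].
assert (W := wronskian (SG c U zeta) _ _ _ _ S1 S2 E1 E2 E3 E4 T).
set (e := Cexp (ial c zeta * T)).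
assert (We : Cexp (be0 (SG c U zeta) * T) = (e * e)%C).
{ unfold e. rewrite <- Cexp_plus. f_equal. unfold ial. cbn [be0 SG]. field. exact Hk. }
rewrite We in W.
assert (He : e <> 0) by apply Cexp_neq_0.
assert (Hm : mu theta <> 0) by apply Cexp_neq_0.
assert (Tr : (Y1 c q1 q2 zeta T + dY2 c q2 dq2 zeta T)%C = (e * (q1 T zeta + dq2 T zeta))%C).
{ unfold Y1, dY2, gauge, dgauge. fold e. ring. }
assert (Nd : ndet c T theta q1 dq1 q2 dq2 zeta =
  (mu theta * (e * (q1 T zeta + dq2 T zeta)) - e * e - mu theta * mu theta)%C).
{ rewrite <- Tr, <- W. unfold ndet. ring. }
rewrite Nd.
replace (Cexp (- (Ci * c * T / kap c) * zeta + Ci * theta)) with (/ e * / mu theta)%C.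
2: { unfold e, mu. rewrite <- !Cexp_opp, <- Cexp_plus. f_equal. unfold ial. field. exact Hk. }
unfold D2. rewrite trace_2. unfold hill_matrix. rewrite !coeff_mat_bij by lia.
unfold Ccos. fold (kap c).
replace (Cexp (Ci * (c * zeta * T / kap c + theta))) with (e * / mu theta)%C.
2: { unfold e, mu. rewrite <- Cexp_opp, <- Cexp_plus. f_equal. unfold ial. field. exact Hk. }
replace (Cexp (- (Ci * (c * zeta * T / kap c + theta)))) with (/ e * mu theta)%C.
2: { unfold e, mu. rewrite <- Cexp_opp, <- Cexp_plus. f_equal. unfold ial. field. exact Hk. }
field. repeat split; try assumption.
Qed.

Lemma pencil_at_SG (c : R) (U : R -> R) (zeta0 h : C) (y d : R -> C) : c ^ 2 <> 1 ->
  sol (SG c U (zeta0 + h)%C) y d -> sol (pencil_at (SG c U zeta0) h) y d.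
Proof.
intros Hc H z. assert (Hk := kap_neq_0 c Hc). destruct (H z) as [H1 H2]. split; [exact H1 | ].
eapply rderiv_eq; [exact H2 | ]. cbn [be0 ga0 pencil_at SG be1 ga1 ga2]. field. exact Hk.
Qed.

(** The link between both sides of the theorem: the chains returned here define the matrix whose
    kernels count Jordan tuples, and its determinant is, up to sign, the expansion of [ndet] at
    [zeta0]. *)
Lemma monodromy_expansion (c T theta : R) (U : R -> R) (q1 dq1 q2 dq2 : R -> C -> C) (zeta0 : C) :
  c ^ 2 <> 1 -> 0 < T -> hill_system c U q1 dq1 q2 dq2 ->
  exists a1 b1 a2 b2, chain (SG c U zeta0) a1 b1 /\ chain (SG c U zeta0) a2 b2 /\ normalized a1 b1 a2 b2 /\
    expands (fun h => ndet c T theta q1 dq1 q2 dq2 (zeta0 + h)%C)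
      (sopp (sdet (ssub (at_z a1 T) (sconst (mu theta))) (at_z a2 T)
        (at_z b1 T) (ssub (at_z b2 T) (sconst (mu theta))))).
Proof.
intros Hc HT HH.
assert (F := fun zeta => fundamental c U q1 dq1 q2 dq2 zeta Hc HH).
destruct (F zeta0) as [S1 [S2 [E1 [E2 [E3 E4]]]]].
destruct (chain_exists _ _ _ _ _ _ _ S1 S2 E1 E2 E3 E4 S1) as [a1 [b1 [C1 [A1 [B1 Z1]]]]].
destruct (chain_exists _ _ _ _ _ _ _ S1 S2 E1 E2 E3 E4 S2) as [a2 [b2 [C2 [A2 [B2 Z2]]]]].
exists a1, b1, a2, b2. split; [exact C1 | split; [exact C2 | split]].
- repeat split; apply functional_extensionality; intros [ | k]; unfold at_z; simpl; unfold szero;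
    rewrite ?A1, ?B1, ?A2, ?B2; try assumption; first [apply Z1 | apply Z2].
- destruct (SG_bounded c T U zeta0) as [M HM].
  assert (HT0 : 0 <= T) by lra. assert (HTT : 0 <= T <= T) by lra.
  destruct (chain_expands (SG c U zeta0) T M a1 b1 (fun h => Y1 c q1 q2 (zeta0 + h)%C)
    (fun h => dY1 c q1 dq1 q2 dq2 (zeta0 + h)%C) HT0 HM C1 Z1) with (z := T) as [X1 X2]; [ | | exact HTT | ].
  { intros h. apply pencil_at_SG; [exact Hc | apply F]. }
  { intros h. rewrite A1, B1, E1, E2. split; apply F. }
  destruct (chain_expands (SG c U zeta0) T M a2 b2 (fun h => Y2 c q2 (zeta0 + h)%C)
    (fun h => dY2 c q2 dq2 (zeta0 + h)%C) HT0 HM C2 Z2) with (z := T) as [X3 X4]; [ | | exact HTT | ].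
  { intros h. apply pencil_at_SG; [exact Hc | apply F]. }
  { intros h. rewrite A2, B2, E3, E4. split; apply F. }
  assert (Xm := expands_sconst (mu theta)).
  assert (W1 := expands_lincomb _ _ _ _ (- (1))%C X1 Xm).
  assert (W2 := expands_lincomb _ _ _ _ (- (1))%C X4 Xm).
  assert (W3 := expands_conv _ _ _ _ W1 W2).
  assert (W4 := expands_conv _ _ _ _ X3 X2).
  assert (W5 := expands_lincomb _ _ _ _ (- (1))%C W4 W3).
  apply (expands_ext _ (fun h => ndet c T theta q1 dq1 q2 dq2 (zeta0 + h)%C)) in W5.
  + replace (sopp _) with (fun k => conv (at_z a2 T) (at_z b1 T) k + - (1) *
      conv (fun k => at_z a1 T k + - (1) * sconst (mu theta) k)%C (fun k => at_z b2 T k + - (1) * sconst (mu theta) k)%C k)%C;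
      [exact W5 | ].
    assert (Es : forall a : series, (fun k => a k + - (1) * sconst (mu theta) k)%C = ssub a (sconst (mu theta))).
    { intros a. apply functional_extensionality; intros k. unfold ssub. ring. }
    rewrite !Es. apply functional_extensionality; intros k. unfold sopp, sdet. unfold ssub at 3. ring.
  + intros h. unfold ndet. ring.
Qed.

(** Injectivity of the coordinates (u, v): a function vanishing on [0,T] also has slope 0 at 0. *)
Lemma combine_zero (c T : R) (U : R -> R) (zeta : C) (a1 b1 a2 b2 : nat -> R -> C) (u v : series) (k : nat) :
  0 < T -> chain (SG c U zeta) a1 b1 -> chain (SG c U zeta) a2 b2 -> normalized a1 b1 a2 b2 ->
  (forall z, on_I T z -> combine a1 a2 u v k z = 0) -> u k = 0 /\ v k = 0.
Proof.
intros HT H1 H2 Hn H0. assert (I0 : on_I T 0) by (unfold on_I; lra).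
destruct (combine_at_0 a1 b1 a2 b2 u v k Hn) as [E1 E2]. rewrite <- E1, <- E2. split; [now apply H0 | ].
destruct (chain_combine (SG c U zeta) T k a1 b1 a2 b2 u v H1 H2 k 0 (le_n k) I0) as [G _].
assert (Ha := derive_I_rderiv T _ 0 _ HT I0 G). rewrite <- Ha. apply derive_I_unique; [exact HT | exact I0 | ].
apply (ideriv_ext T (fun _ => RtoC 0)); [exact I0 | intros y Hy; symmetry; now apply H0 | ].
apply rderiv_ideriv, rderiv_const.
Qed.

Lemma kernel_2x2 (A B E D : C) : (A * D - B * E = 0)%C ->
  exists u v : C, (u <> 0 \/ v <> 0) /\ (A * u + B * v = 0)%C /\ (E * u + D * v = 0)%C.
Proof.
intros H.
destruct (Ceq_dec A 0) as [HA | HA]; [destruct (Ceq_dec B 0) as [HB | HB] | ].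
- destruct (Ceq_dec E 0) as [HE | HE].
  + exists 1, 0. split; [left; apply C1_nz | ]. rewrite HA, HE. split; ring.
  + exists (- D)%C, E. split; [right; exact HE | ]. rewrite HA, HB. split; ring.
- exists (- B)%C, A. split; [ | split; [ring | rewrite <- H; ring]].
  left. intros Z. apply HB. replace B with (- - B)%C by ring. rewrite Z. ring.
- exists (- B)%C, A. split; [right; exact HA | split; [ring | rewrite <- H; ring]].
Qed.

Lemma kernel_2x2_det (A B E D u v : C) : (u <> 0 \/ v <> 0) ->
  (A * u + B * v = 0)%C -> (E * u + D * v = 0)%C -> (A * D - B * E = 0)%C.
Proof.
intros H H1 H2. apply NNPP. intros N.
assert (Eu : ((A * D - B * E) * u = 0)%C).
{ replace ((A * D - B * E) * u)%C with (D * (A * u + B * v) - B * (E * u + D * v))%C by ring.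
  rewrite H1, H2. ring. }
assert (Ev : ((A * D - B * E) * v = 0)%C).
{ replace ((A * D - B * E) * v)%C with (A * (E * u + D * v) - E * (A * u + B * v))%C by ring.
  rewrite H1, H2. ring. }
destruct H as [H | H]; [now apply (Cmult_neq_0 _ _ N H) | now apply (Cmult_neq_0 _ _ N H)].
Qed.

Lemma characteristic_value_jordan (c T theta : R) (U : R -> R) (zeta : C) :
  characteristic_value c T U theta zeta <->
  exists p, jordan_tuple c T U theta zeta 1 p /\ exists z, on_I T z /\ p O z <> 0.
Proof.
assert (E : forall p z, sum_n (fun j : nat => (/ RtoC (INR (fact j)) * LSG_deriv c T U j zeta (p (0 - j)%nat) z)%C) 0
   = LSG c T U zeta (p O) z).
{ intros p z. rewrite sum_O, LSG_deriv_0. change (INR (fact 0)) with 1. change (0 - 0)%nat with 0%nat. apply Ceq_minus. field. }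
split.
- intros [p [H1 [H2 H3]]]. exists (fun _ => p). split; [ | exact H2]. split.
  + intros _ _. exact H1.
  + intros k Hk z Hz. replace k with 0%nat by lia. rewrite (E (fun _ => p)). now apply H3.
- intros [p [[H1 H2] H3]]. exists (p O). split; [apply H1; lia | split; [exact H3 | ]].
  intros z Hz. rewrite <- E. apply H2; [lia | exact Hz].
Qed.

(** The case m = 1, where only constant terms matter: a nonzero kernel vector of Phi(T) - exp(-i
    theta) exists exactly when its determinant is 0. *)
Lemma characteristic_value_ndet (c T theta : R) (U : R -> R) (q1 dq1 q2 dq2 : R -> C -> C) (zeta : C) :
  c ^ 2 <> 1 -> 0 < T -> (forall x, ex_derive U x) -> hill_system c U q1 dq1 q2 dq2 ->
  (ndet c T theta q1 dq1 q2 dq2 zeta = 0 <-> characteristic_value c T U theta zeta).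
Proof.
intros Hc HT HU HH. rewrite characteristic_value_jordan.
destruct (monodromy_expansion c T theta U q1 dq1 q2 dq2 zeta Hc HT HH) as [a1 [b1 [a2 [b2 [C1 [C2 [Hn He]]]]]]].
assert (E := expands_value _ _ He). cbv beta in E. replace (zeta + 0)%C with zeta in E by ring. rewrite E. clear E He.
unfold sopp, sdet. unfold ssub at 1. cbn [conv].
set (A := ssub (at_z a1 T) (sconst (mu theta)) O). set (B := at_z a2 T O).
set (F := at_z b1 T O). set (D := ssub (at_z b2 T) (sconst (mu theta)) O).
split.
- intros H. assert (H' : (A * D - B * F = 0)%C) by (replace (A * D - B * F)%C with (- - (A * D - B * F))%C by ring; rewrite H; ring).
  destruct (kernel_2x2 A B F D H') as [u [v [Huv [G1 G2]]]].
  assert (Hbc : bc theta T a1 b1 a2 b2 1 (fun _ => u) (fun _ => v)).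
  { split; intros k Hk; replace k with O by lia; unfold sadd; cbn [conv]; assumption. }
  exists (combine a1 a2 (fun _ => u) (fun _ => v)). split.
  + now apply (jordan_of_bc c T U theta zeta a1 b1 a2 b2).
  + apply NNPP. intros N. destruct (combine_zero c T U zeta a1 b1 a2 b2 (fun _ => u) (fun _ => v) O HT C1 C2 Hn) as [Z1 Z2].
    * intros z Hz. apply NNPP. intros M. apply N. now exists z.
    * destruct Huv; contradiction.
- intros [p [Hp [z [Hz Hpz]]]].
  destruct (bc_of_jordan c T U theta zeta a1 b1 a2 b2 1 p Hc HT C1 C2 Hn Hp) as [u [v [[G1 G2] Ep]]].
  rewrite (kernel_2x2_det A B F D (u O) (v O)).
  + ring.
  + apply NNPP. intros N. apply Hpz. rewrite Ep by (assumption || lia).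
    unfold combine, act. cbn [conv].
    assert (Hu : u O = 0) by (apply NNPP; tauto). assert (Hv : v O = 0) by (apply NNPP; tauto).
    rewrite Hu, Hv. ring.
  + apply (G1 O). lia.
  + apply (G2 O). lia.
Qed.

(** * The determinant does not vanish identically *)

(** Gronwall in reverse: energy times exp(K z) is nondecreasing. It carries the vanishing of a state
    at some point back to 0. *)
Lemma energy_backward (P : pencil) (T M : R) (p d : R -> C) : bounded_by P T M -> sol P p d ->
  forall z, 0 <= z <= T -> energy (p 0) (d 0) <= energy (p z) (d z) * exp ((2 + 3 * M ^ 2) * z).
Proof.
intros [M1 [_ [M3 _]]] Hs z Hz. set (K := 2 + 3 * M ^ 2).
assert (L : - (energy (p z) (d z) * exp (K * z)) <= - (energy (p 0) (d 0) * exp (K * 0))).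
{ apply (is_derive_nonpos_le (fun z => - (energy (p z) (d z) * exp (K * z)))
    (fun z => - ((Derive (fun z => energy (p z) (d z)) z + K * energy (p z) (d z)) * exp (K * z)))); [lra | ].
  intros x Hx. destruct (Hs x) as [H1 H2].
  destruct (is_derive_energy p d x _ H1 H2) as [e [He Le]].
  assert (Ed : Derive (fun z => energy (p z) (d z)) x = e) by now apply is_derive_unique. rewrite Ed. split.
  - evar_last.
    + apply (is_derive_opp (fun z => energy (p z) (d z) * exp (K * z))).
      apply is_derive_Rmult with (l := e) (m := K * exp (K * x)); [exact He | ]. auto_derive; [exact I | ring].
    + unfold opp; simpl. ring.
  - assert (S3 := Cmod_sq_sum3 (be0 P * d x) (ga0 P x * p x) 0).
    rewrite Cplus_0_r in S3. rewrite Cmod_0 in S3.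
    assert (S1 := Cmod_mult_sq_le _ (d x) _ M1). assert (S2 := Cmod_mult_sq_le _ (p x) M (M3 x ltac:(lra))).
    assert (Hp := pow2_ge_0 (Cmod (p x))). assert (He0 := energy_ge_0 (p x) (d x)).
    unfold energy at 2 in Le.
    assert (Hd : Cmod (d x) ^ 2 <= energy (p x) (d x)) by (unfold energy; lra).
    assert (Es : 3 * M ^ 2 * energy (p x) (d x) = 3 * (M ^ 2 * Cmod (p x) ^ 2) + 3 * (M ^ 2 * Cmod (d x) ^ 2))
      by (unfold energy; ring).
    assert (Le' : Rabs e <= K * energy (p x) (d x)) by (unfold K; lra).
    apply Rabs_le_between in Le'. assert (Hx0 := exp_pos (K * x)).
    assert (0 <= (e + K * energy (p x) (d x)) * exp (K * x)) by (apply Rmult_le_pos; lra). lra. }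
rewrite Rmult_0_r, exp_0, Rmult_1_r in L. lra.
Qed.

Lemma mu_unit (theta : R) : fst (mu theta) ^ 2 + snd (mu theta) ^ 2 = 1.
Proof.
rewrite <- Cmod_sq. unfold mu. rewrite Cmod_Cexp.
replace (Re (- (Ci * theta))%C) with 0 by (unfold Re; simpl; ring). rewrite exp_0. ring.
Qed.

(* At [zeta = 2i] the equation has real coefficients [p'' = be p' + g p] with [g >= 1], so that
   [Re (conj p * p') - be/2 |p|^2] has derivative [|p'|^2 + g |p|^2], while it takes equal values at [0] and [T]. *)
Lemma subluminal_no_solution (c T theta : R) (U : R -> R) (p d : R -> C) :
  c ^ 2 < 1 -> 0 < T -> sol (SG c U (2 * Ci)%C) p d ->
  p T = (mu theta * p 0)%C -> d T = (mu theta * d 0)%C -> p 0 = 0 /\ d 0 = 0.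
Proof.
intros Hc HT Hs Hp Hd.
assert (Hk : kap c <> 0) by (apply kap_neq_0; lra).
set (be := - 4 * c / (c ^ 2 - 1)). set (g := fun z => - (4 + cos (U z)) / (c ^ 2 - 1)).
assert (Hk' : c ^ 2 - 1 <> 0) by lra.
assert (Eb : be0 (SG c U (2 * Ci)%C) = RtoC be).
{ cbn [be0 SG]. unfold be. rewrite RtoC_div, RtoC_mult by exact Hk'. fold (kap c).
  replace (2 * Ci * c * (2 * Ci) / kap c)%C with (4 * (Ci * Ci) * c / kap c)%C by (field; exact Hk).
  rewrite Ci_sq. replace (RtoC (-4)) with (- (4))%C by (rewrite <- RtoC_opp; reflexivity). field. exact Hk. }
assert (Eg : forall z, ga0 (SG c U (2 * Ci)%C) z = RtoC (g z)).
{ intros z. cbn [ga0 SG]. unfold g. rewrite !RtoC_div, RtoC_opp, RtoC_plus by exact Hk'. fold (kap c).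
  replace ((2 * Ci) ^ 2)%C with (4 * (Ci * Ci))%C by ring. rewrite Ci_sq. field. exact Hk. }
assert (Hg : forall z, 1 <= g z).
{ intros z. unfold g. assert (B := COS_bound (U z)).
  apply Rmult_le_reg_r with (1 - c ^ 2); [lra | ].
  replace (- (4 + cos (U z)) / (c ^ 2 - 1) * (1 - c ^ 2)) with (4 + cos (U z)) by (field; exact Hk').
  assert (Hc2 := pow2_ge_0 c). lra. }
set (F := fun z => fst (p z) * fst (d z) + snd (p z) * snd (d z)
   - be / 2 * (fst (p z) * fst (p z) + snd (p z) * snd (p z))).
set (dF := fun z => fst (d z) ^ 2 + snd (d z) ^ 2 + g z * (fst (p z) ^ 2 + snd (p z) ^ 2)).
assert (HF : forall z, is_derive F z (dF z)).
{ intros z. destruct (Hs z) as [H1 H2]. rewrite Eb, Eg in H2.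
  apply rderiv_components in H1. apply rderiv_components in H2. destruct H1 as [H11 H12]. destruct H2 as [H21 H22].
  simpl in H21, H22. unfold F.
  evar_last.
  - apply (is_derive_minus (fun z => fst (p z) * fst (d z) + snd (p z) * snd (d z))
      (fun z => be / 2 * (fst (p z) * fst (p z) + snd (p z) * snd (p z)))).
    + apply (is_derive_plus (fun z => fst (p z) * fst (d z)) (fun z => snd (p z) * snd (d z)));
        apply is_derive_Rmult; eassumption.
    + apply is_derive_scal.
      apply (is_derive_plus (fun z => fst (p z) * fst (p z)) (fun z => snd (p z) * snd (p z)));
        apply is_derive_Rmult; eassumption.
  - unfold minus, plus, opp, dF; simpl. field. }
assert (EF : F T = F 0).
{ unfold F. rewrite Hp, Hd. assert (Hm := mu_unit theta). destruct (mu theta) as [m1 m2]. simpl in Hm |- *.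
  destruct (p 0) as [x1 x2]. destruct (d 0) as [y1 y2]. simpl.
  transitivity ((m1 * (m1 * 1) + m2 * (m2 * 1)) * (x1 * y1 + x2 * y2 - be / 2 * (x1 * x1 + x2 * x2)));
    [ring | rewrite Hm; ring]. }
destruct (MVT_gen F 0 T dF) as [x [Hx E]].
(* As F(T) = F(0), the mean value theorem gives a point with F' = 0. There the whole state vanishes,
   and [energy_backward] transports this to 0. *)
- intros x _. apply HF.
- intros x _. apply derivable_continuous_pt. exists (dF x). apply is_derive_Reals, HF.
- rewrite Rmin_left, Rmax_right in Hx by lra.
  assert (Z : dF x = 0).
  { rewrite EF, Rminus_diag, Rminus_0_r in E. symmetry in E. apply Rmult_integral in E. destruct E; lra. }
  assert (Ze : energy (p x) (d x) <= 0).
  { unfold energy. rewrite !Cmod_sq. unfold dF in Z.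
    assert (G1 := pow2_ge_0 (fst (p x))). assert (G2 := pow2_ge_0 (snd (p x))). specialize (Hg x).
    assert (0 <= (g x - 1) * (fst (p x) ^ 2 + snd (p x) ^ 2)) by (apply Rmult_le_pos; lra). lra. }
  destruct (SG_bounded c T U (2 * Ci)%C) as [M HM].
  assert (B := energy_backward _ T M p d HM Hs x Hx).
  apply energy_eq_0. apply Rle_trans with (1 := B). assert (Hxp := exp_pos ((2 + 3 * M ^ 2) * x)). nra.
Qed.

Lemma ndet_subluminal (c T theta : R) (U : R -> R) (q1 dq1 q2 dq2 : R -> C -> C) :
  c ^ 2 < 1 -> 0 < T -> hill_system c U q1 dq1 q2 dq2 ->
  ndet c T theta q1 dq1 q2 dq2 (2 * Ci)%C <> 0.
Proof.
intros Hc HT HH N. assert (Hc1 : c ^ 2 <> 1) by lra.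
destruct (fundamental c U q1 dq1 q2 dq2 (2 * Ci)%C Hc1 HH) as [S1 [S2 [E1 [E2 [E3 E4]]]]].
unfold ndet in N. set (y1 := Y1 c q1 q2 (2 * Ci)%C) in *. set (d1 := dY1 c q1 dq1 q2 dq2 (2 * Ci)%C) in *.
set (y2 := Y2 c q2 (2 * Ci)%C) in *. set (d2 := dY2 c q2 dq2 (2 * Ci)%C) in *.
destruct (kernel_2x2 (y1 T - mu theta) (y2 T) (d1 T) (d2 T - mu theta)) as [u [v [Huv [G1 G2]]]].
{ match type of N with ?x = _ => transitivity (- x)%C; [ring | rewrite N; ring] end. }
destruct (subluminal_no_solution c T theta U (fun z => u * y1 z + v * y2 z)%C (fun z => u * d1 z + v * d2 z)%C Hc HT) as [Z1 Z2].
- intros z. split.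
  + apply rderiv_plus; apply rderiv_scal; [apply (proj1 (S1 z)) | apply (proj1 (S2 z))].
  + eapply rderiv_eq; [apply rderiv_plus; apply rderiv_scal; [apply (proj2 (S1 z)) | apply (proj2 (S2 z))] | ring].
- rewrite E1, E3. apply Ceq_minus. match type of G1 with ?x = _ => transitivity x; [ring | exact G1] end.
- rewrite E2, E4. apply Ceq_minus. match type of G2 with ?x = _ => transitivity x; [ring | exact G2] end.
- rewrite E1, E3 in Z1. rewrite E2, E4 in Z2.
  destruct Huv as [Hu | Hv]; [apply Hu; rewrite <- Z1; ring | apply Hv; rewrite <- Z2; ring].
Qed.

(** The weight s^2 balances q and q': by 2s|q||q'| <= |q'|^2 + s^2|q|^2 the energy grows at rate 2s
    + m/s, so q grows essentially like exp(s z). The unweighted energy would only give a rate of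
    order s^2. *)
Lemma hill_growth (w : R -> R) (s m T : R) (q dq : R -> C) : 0 < s -> 0 <= m ->
  (forall z, Rabs (w z) <= m) ->
  (forall z, rderiv q z (dq z) /\ rderiv dq z (RtoC (s ^ 2 - w z) * q z)%C) ->
  0 <= T -> Cmod (dq T) ^ 2 + s ^ 2 * Cmod (q T) ^ 2 <=
    (Cmod (dq 0) ^ 2 + s ^ 2 * Cmod (q 0) ^ 2) * exp ((2 * s + m / s) * T).
Proof.
intros Hs Hm Hw Hq HT.
set (E := fun z => Cmod (dq z) ^ 2 + s ^ 2 * Cmod (q z) ^ 2).
assert (G := gronwall E (2 * s + m / s) 0 T).
assert (G' : E T + 0 <= (E 0 + 0) * exp ((2 * s + m / s) * T)).
{ apply G; [ | lra]. intros z _. destruct (Hq z) as [H1 H2].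
  eexists. split.
  - apply (is_derive_plus (fun z => Cmod (dq z) ^ 2) (fun z => s ^ 2 * Cmod (q z) ^ 2)).
    + apply is_derive_Cmod_sq, H2.
    + apply is_derive_scal, is_derive_Cmod_sq, H1.
  - unfold plus; simpl. rewrite Rplus_0_r.
    assert (B := Cdot_le (q z) (dq z)). set (t := fst (q z) * fst (dq z) + snd (q z) * snd (dq z)) in *.
    assert (Hq0 := Cmod_ge_0 (q z)). assert (Hd0 := Cmod_ge_0 (dq z)).
    set (X := Cmod (q z)) in *. set (Y := Cmod (dq z)) in *.
    assert (W := Hw z). apply Rabs_le_between in W. apply Rabs_le_between in B.
    assert (T1 : 2 * ((2 * s ^ 2 - w z) * t) <= 2 * ((2 * s ^ 2 + m) * (X * Y))).
    { assert (HXY : 0 <= X * Y) by now apply Rmult_le_pos.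
      assert (Hs2 := pow2_ge_0 s).
      assert (Ht : Rabs ((2 * s ^ 2 - w z) * t) <= (2 * s ^ 2 + m) * (X * Y)).
      { rewrite Rabs_mult. apply Rmult_le_compat; try apply Rabs_pos; apply Rabs_le_between; lra. }
      assert (Ha := Rle_abs ((2 * s ^ 2 - w z) * t)). lra. }
    assert (T2 : 2 * ((2 * s ^ 2 + m) * (X * Y)) <= (2 * s + m / s) * (Y ^ 2 + s ^ 2 * X ^ 2)).
    { replace (2 * ((2 * s ^ 2 + m) * (X * Y))) with ((2 * s + m / s) * (2 * s * (X * Y))) by (field; lra).
      apply Rmult_le_compat_l.
      - assert (0 <= m / s) by (apply Rmult_le_pos; [exact Hm | left; now apply Rinv_0_lt_compat]). lra.
      - assert (Hsq := pow2_ge_0 (Y - s * X)). lra. }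
    unfold E. fold X Y. unfold t in *. simpl in *. lra. }
rewrite !Rplus_0_r in G'. exact G'.
Qed.

(** The two exponentials have moduli exp(a) and exp(-a), and the smaller one is at most 1. *)
Lemma Cmod_2Ccos_lower (a theta : R) : exp (Rabs a) - 1 <= Cmod (2 * Ccos (Ci * a + theta))%C.
Proof.
assert (H2 : RtoC 2 <> 0) by (intros E; apply RtoC_inj in E; lra).
assert (E : (2 * Ccos (Ci * a + theta))%C = (Cexp (Ci * (Ci * a + theta)) + Cexp (- (Ci * (Ci * a + theta))))%C)
  by (unfold Ccos; field; exact H2).
rewrite E. set (x := Cexp (Ci * (Ci * a + theta))). set (y := Cexp (- (Ci * (Ci * a + theta)))).
assert (Ex : Cmod x = exp (- a)).
{ unfold x. rewrite Cmod_Cexp. f_equal. unfold Re; simpl. ring. }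
assert (Ey : Cmod y = exp a).
{ unfold y. rewrite Cmod_Cexp. f_equal. unfold Re; simpl. ring. }
assert (Tx : Cmod x <= Cmod (x + y)%C + Cmod y).
{ replace x with (x + y + - y)%C at 1 by ring. eapply Rle_trans; [apply Cmod_triangle | ]. rewrite Cmod_opp. lra. }
assert (Ty : Cmod y <= Cmod (x + y)%C + Cmod x).
{ replace y with (x + y + - x)%C at 1 by ring. eapply Rle_trans; [apply Cmod_triangle | ]. rewrite Cmod_opp. lra. }
rewrite Ex, Ey in *. rewrite <- exp_0.
destruct (Rle_dec 0 a) as [Ha | Ha].
- rewrite Rabs_right by lra. assert (exp (- a) <= exp 0) by (apply exp_mono; lra). lra.
- rewrite Rabs_left by lra. assert (exp a <= exp 0) by (apply exp_mono; lra). lra.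
Qed.

(** At zeta = i k s, with k = c^2 - 1, the trace is at most 2 exp((s + m/2) T), while twice the
    cosine is at least exp(|c| s T) - 1. Since |c| > 1, a large s separates them. *)
Lemma D2_superluminal (c T theta : R) (U : R -> R) (q1 dq1 q2 dq2 : R -> C -> C) :
  1 < c ^ 2 -> 0 < T -> hill_system c U q1 dq1 q2 dq2 ->
  exists zeta, D2 c T (hill_matrix q1 dq1 q2 dq2 T) zeta theta <> 0.
Proof.
intros Hc HT [H1 [I1 [H2 I2]]].
set (k := c ^ 2 - 1). assert (Hk : 0 < k) by (unfold k; lra).
set (m := / k). assert (Hm : 0 < m) by now apply Rinv_0_lt_compat.
assert (Hd : 0 < Rabs c - 1).
{ assert (Ha := Rabs_pos c). assert (E := pow2_abs c). assert (1 < Rabs c); [ | lra].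
  apply Rnot_le_lt. intros L. nra. }
(* Chosen so that (|c| - 1) s T exceeds m T/2 + 2, that is, |c| s T >= X + 2; the summand 1 gives s
   > 1 and thus m/s <= m. *)
set (s := 1 + (m / 2 + 2 / T) / (Rabs c - 1)).
assert (HmT : 0 < m / 2 + 2 / T) by (apply Rplus_lt_0_compat; apply Rdiv_lt_0_compat; lra).
assert (Hs1 : 1 < s).
{ unfold s. assert (0 < (m / 2 + 2 / T) / (Rabs c - 1)) by now apply Rdiv_lt_0_compat. lra. }
set (zeta := (Ci * RtoC (k * s))%C). exists zeta.
assert (HkC : RtoC k <> 0) by (intros E; apply RtoC_inj in E; lra).
assert (Hsol : forall q dq, hill_solution c U zeta q dq ->
  forall z, rderiv q z (dq z) /\ rderiv dq z (RtoC (s ^ 2 - cos (U z) / k) * q z)%C).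
{ intros q dq [Q1 Q2] z. split; [apply rderiv_is_derive, Q1 | ].
  eapply rderiv_eq; [apply rderiv_is_derive, Q2 | ]. fold k.
  replace (zeta ^ 2)%C with (- RtoC ((k * s) ^ 2))%C.
  - rewrite <- RtoC_opp, <- RtoC_div, <- RtoC_plus by (apply pow_nonzero; lra).
    match goal with |- (- (RtoC ?x * ?y))%C = _ => replace (- (RtoC x * y))%C with (RtoC (- x) * y)%C by (rewrite RtoC_opp; ring) end.
    f_equal. f_equal. field. lra.
  - unfold zeta. replace ((Ci * RtoC (k * s)) ^ 2)%C with ((Ci * Ci) * (RtoC (k * s) * RtoC (k * s)))%C by ring.
    rewrite Ci_sq, <- RtoC_mult. replace ((k * s) ^ 2) with (k * s * (k * s)) by ring. ring. }
assert (Hw : forall z, Rabs (cos (U z) / k) <= m).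
{ intros z. unfold Rdiv. rewrite Rabs_mult, (Rabs_right (/ k)) by (fold m; lra). fold m.
  assert (Rabs (cos (U z)) <= 1) by (apply Rabs_le, COS_bound).
  assert (Rabs (cos (U z)) * m <= 1 * m) by (apply Rmult_le_compat_r; lra). lra. }
set (X := (s + m / 2) * T).
assert (HX : 0 <= X) by (apply Rmult_le_pos; lra).
assert (HE : exp ((2 * s + m / s) * T) <= exp X ^ 2).
{ replace (exp X ^ 2) with (exp (X + X)) by (rewrite exp_plus; ring). apply exp_mono. unfold X.
  assert (m / s <= m).
  { apply Rmult_le_reg_r with s; [lra | ]. unfold Rdiv. rewrite Rmult_assoc, Rinv_l by lra.
    assert (m * 1 <= m * s) by (apply Rmult_le_compat_l; lra). lra. }
  assert ((2 * s + m / s) * T <= (2 * s + m) * T) by (apply Rmult_le_compat_r; lra). lra. }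
assert (Sq : forall x, 0 <= x -> x ^ 2 <= exp X ^ 2 -> x <= exp X).
{ intros x Hx L. assert (Hp := exp_pos X). apply Rnot_lt_le. intros N.
  assert (exp X * exp X < x * x) by (apply Rmult_le_0_lt_compat; lra). simpl in L. lra. }
assert (G1 := hill_growth (fun z => cos (U z) / k) s m T _ _ ltac:(lra) ltac:(lra) Hw (Hsol _ _ (H1 zeta)) ltac:(lra)).
assert (G2 := hill_growth (fun z => cos (U z) / k) s m T _ _ ltac:(lra) ltac:(lra) Hw (Hsol _ _ (H2 zeta)) ltac:(lra)).
cbv beta in G1, G2. destruct (I1 zeta) as [A1 A2]. destruct (I2 zeta) as [A3 A4].
rewrite A1, A2, Cmod_0, Cmod_1 in G1. rewrite A3, A4, Cmod_0, Cmod_1 in G2.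
assert (B1 : Cmod (q1 T zeta) <= exp X).
{ apply Sq; [apply Cmod_ge_0 | ]. assert (Hp := pow2_ge_0 (Cmod (dq1 T zeta))).
  apply Rmult_le_reg_l with (s ^ 2); [apply pow_lt; lra | ].
  assert (Hs2 := pow2_ge_0 s). assert (s ^ 2 * exp ((2 * s + m / s) * T) <= s ^ 2 * exp X ^ 2) by now apply Rmult_le_compat_l.
  simpl in *. lra. }
assert (B2 : Cmod (dq2 T zeta) <= exp X).
{ apply Sq; [apply Cmod_ge_0 | ].
  assert (Hp : 0 <= s ^ 2 * Cmod (q2 T zeta) ^ 2) by (apply Rmult_le_pos; apply pow2_ge_0).
  simpl in *. lra. }
intros N. unfold D2 in N. rewrite trace_2 in N. unfold hill_matrix in N. rewrite !coeff_mat_bij in N by lia.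
apply Ceq_minus in N.
assert (L := Cmod_2Ccos_lower (c * s * T) theta).
replace (Ci * (c * s * T)%R + theta)%C with (c * zeta * T / (c ^ 2 - 1)%R + theta)%C in L.
2: { fold k. unfold zeta. rewrite !RtoC_mult. field. exact HkC. }
rewrite <- N in L.
assert (Tr := Cmod_triangle (q1 T zeta) (dq2 T zeta)).
assert (Ea : Rabs (c * s * T) = Rabs c * s * T).
{ rewrite !Rabs_mult, (Rabs_right s), (Rabs_right T) by lra. reflexivity. }
rewrite Ea in L.
assert (Q : X + 2 <= Rabs c * s * T).
{ assert (Eq : (Rabs c - 1) * s * T = (Rabs c - 1) * T + (m / 2 * T + 2)) by (unfold s; field; lra).
  assert (0 < (Rabs c - 1) * T) by now apply Rmult_lt_0_compat. unfold X. lra. }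
apply exp_mono in Q. rewrite exp_plus in Q.
(* The margin 2 suffices: exp(X + 2) - 1 > 3 exp(X) - 1 >= 2 exp(X). *)
assert (E2 : 1 + 2 < exp 2) by (apply exp_ineq1; lra).
assert (EX : 1 <= exp X) by (rewrite <- exp_0; now apply exp_mono).
assert (3 * exp X < exp X * exp 2) by (rewrite Rmult_comm; apply Rmult_lt_compat_l; lra).
lra.
Qed.

Lemma ndet_not_zero (c T theta : R) (U : R -> R) (q1 dq1 q2 dq2 : R -> C -> C) :
  c ^ 2 <> 1 -> 0 < T -> hill_system c U q1 dq1 q2 dq2 ->
  exists zeta, ndet c T theta q1 dq1 q2 dq2 zeta <> 0.
Proof.
intros Hc HT HH. destruct (Rlt_dec (c ^ 2) 1) as [L | L].
- exists (2 * Ci)%C. now apply (ndet_subluminal c T theta U).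
- destruct (D2_superluminal c T theta U q1 dq1 q2 dq2) as [zeta Hz]; [lra | exact HT | exact HH | ].
  exists zeta. intros E. apply Hz. rewrite (D2_ndet c T theta U) by assumption. rewrite E. ring.
Qed.

(** * Transfer of dimensions, local factorisation and conclusion *)

Lemma conv_sum_r (p : series) (a : nat -> C) (e : nat -> series) (d k : nat) :
  conv p (fun j => sum_n_m (fun i => (a i * e i j)%C) 1 d) k =
  sum_n_m (fun i => (a i * conv p (e i) k)%C) 1 d.
Proof.
induction d as [ | d IH].
- rewrite (sum_n_m_zero _ 1 0) by lia. apply (vanish_conv_r (S k)); [ | lia].
  intros j _. apply (sum_n_m_zero (G := C_AbelianMonoid) _ 1 0). lia.
- rewrite sum_n_m_C_Sm, <- IH.
  replace (fun j => sum_n_m (fun i => (a i * e i j)%C) 1 (S d))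
    with (sadd (fun j => sum_n_m (fun i => (a i * e i j)%C) 1 d) (conv (sconst (a (S d))) (e (S d)))).
  + replace (conv p (sadd _ _)) with (sadd (conv p (fun j => sum_n_m (fun i => (a i * e i j)%C) 1 d))
      (conv (sconst (a (S d))) (conv p (e (S d))))) by ring.
    rewrite (conv_sconst_l _ (conv p (e (S d)))). reflexivity.
  + apply functional_extensionality; intros j. rewrite conv_sconst_l, sum_n_m_C_Sm. reflexivity.
Qed.

Lemma conv_ext_upto (p q q' : series) (k : nat) : (forall j, (j <= k)%nat -> q j = q' j) -> conv p q k = conv p q' k.
Proof.
intros H. apply Ceq_minus. change (ssub (conv p q) (conv p q') k = 0).
replace (ssub (conv p q) (conv p q')) with (conv p (ssub q q')) by ring.
apply (vanish_conv_r (S k)); [ | lia]. intros j Hj. unfold ssub. rewrite H by lia. ring.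
Qed.

Lemma combine_sum (a1 a2 : nat -> R -> C) (a : nat -> C) (e1 e2 : nat -> series) (d k : nat) (z : R) :
  combine a1 a2 (fun j => sum_n_m (fun i => (a i * e1 i j)%C) 1 d) (fun j => sum_n_m (fun i => (a i * e2 i j)%C) 1 d) k z =
  sum_n_m (fun i => (a i * combine a1 a2 (e1 i) (e2 i) k z)%C) 1 d.
Proof.
unfold combine, act. rewrite !conv_sum_r.
rewrite <- (sum_n_m_plus (G := C_AbelianMonoid)). apply sum_n_m_ext_loc. intros i _. change plus with Cplus. cring.
Qed.

(** [combine] is linear, injective modulo h^m by [combine_zero] and onto the Jordan tuples by
    [bc_of_jordan], so it carries a basis to a basis. *)
Lemma has_dim_jordan (c T theta : R) (U : R -> R) (zeta : C) (a1 b1 a2 b2 : nat -> R -> C) (m d : nat) :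
  c ^ 2 <> 1 -> 0 < T -> (forall x, ex_derive U x) ->
  chain (SG c U zeta) a1 b1 -> chain (SG c U zeta) a2 b2 -> normalized a1 b1 a2 b2 ->
  kdim m (bc theta T a1 b1 a2 b2 m) d ->
  has_dim T m (jordan_tuple c T U theta zeta m) d.
Proof.
intros Hc HT HU H1 H2 Hn [e1 [e2 [K1 [K2 K3]]]].
exists (fun i => combine a1 a2 (e1 i) (e2 i)). split; [ | split].
- intros i Hi. apply (jordan_of_bc c T U theta zeta a1 b1 a2 b2); try assumption. now apply K1.
- intros p Hp.
  destruct (bc_of_jordan c T U theta zeta a1 b1 a2 b2 m p Hc HT H1 H2 Hn Hp) as [u [v [Hbc Ep]]].
  destruct (K2 u v Hbc) as [a Ha]. exists a. intros k z Hk Hz.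
  rewrite Ep by assumption. rewrite <- combine_sum. unfold combine, act. f_equal.
  + apply conv_ext_upto. intros j Hj. apply Ha. lia.
  + apply conv_ext_upto. intros j Hj. apply Ha. lia.
- intros a Ha. apply K3. intros k Hk.
  apply (combine_zero c T U zeta a1 b1 a2 b2 (fun j => sum_n_m (fun i => (a i * e1 i j)%C) 1 d)
    (fun j => sum_n_m (fun i => (a i * e2 i j)%C) 1 d) k HT H1 H2 Hn).
  intros z Hz. rewrite combine_sum. now apply Ha.
Qed.

(** For |h| <= |z|/2 the point z + h stays at distance at least |z|/2 from 0, which yields the
    constant 2/|z|^3. *)
Lemma cderiv_Cinv (z : C) : z <> 0 -> cderiv Cinv z (- / (z * z))%C.
Proof.
intros Hz. assert (Hp : 0 < Cmod z) by exact (proj1 (Cmod_gt_0 z) Hz).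
apply (cderiv_quadratic Cinv z (- / (z * z))%C (2 / Cmod z ^ 3) (Cmod z / 2)); [lra | ]. intros h Hh.
assert (Hzh : Cmod z / 2 <= Cmod (z + h)%C).
{ assert (T := Cmod_triangle (z + h) (- h)). replace (z + h + - h)%C with z in T by ring. rewrite Cmod_opp in T. lra. }
assert (Nz : (z + h)%C <> 0) by (intros E; rewrite E, Cmod_0 in Hzh; lra).
replace (/ (z + h) - / z - h * - / (z * z))%C with ((h * h) / (z * z * (z + h)))%C by (field; split; assumption).
rewrite Cmod_div by (repeat apply Cmult_neq_0; assumption). rewrite !Cmod_mult.
replace (2 / Cmod z ^ 3 * Cmod h ^ 2) with ((Cmod h * Cmod h) / (Cmod z * Cmod z * (Cmod z / 2))) by (field; lra).
unfold Rdiv at 1 2. apply Rmult_le_compat_l; [apply Rmult_le_pos; apply Cmod_ge_0 | ].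
apply Rinv_le_contravar.
- repeat apply Rmult_lt_0_compat; lra.
- apply Rmult_le_compat_l; [apply Rmult_le_pos; lra | exact Hzh].
Qed.

Lemma cderiv_inv_pow (z0 z : C) (n : nat) : z <> z0 -> exists l, cderiv (fun w => / (w - z0) ^ n)%C z l.
Proof.
intros Hz. induction n as [ | n [l Hl]].
- exists 0. apply (cderiv_quadratic _ z 0 0 1); [lra | ]. intros h _. simpl.
  replace (/ 1 - / 1 - h * 0)%C with (RtoC 0) by ring. rewrite Cmod_0. lra.
- assert (Hz' : (z - z0)%C <> 0) by (intros E; now apply Hz, Ceq_minus).
  assert (L : is_derive (K := C_AbsRing) (V := AbsRing_NormedModule C_AbsRing) (fun w => w - z0)%C z (RtoC 1)).
  { apply cderiv_AbsRing, (cderiv_quadratic _ z 1 0 1); [lra | ]. intros h _.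
    replace (z + h - z0 - (z - z0) - h * 1)%C with (RtoC 0) by ring. rewrite Cmod_0. lra. }
  assert (I := is_derive_comp (K := C_AbsRing) (V := C_NormedModule) Cinv (fun w => w - z0)%C z _ (RtoC 1) (cderiv_Cinv _ Hz') L).
  eexists. assert (P := cderiv_mult _ _ _ _ _ I Hl).
  apply (is_derive_ext_loc (K := C_AbsRing) (V := C_NormedModule) _ (fun w => / (w - z0) ^ S n)%C) in P; [exact P | ].
  exists (mkposreal _ (proj1 (Cmod_gt_0 _) Hz')). intros w Hw.
  change (Cmod (w - z)%C < Cmod (z - z0)%C) in Hw.
  assert (Nw : (w - z0)%C <> 0).
  { intros E. replace (w - z)%C with (- (z - z0))%C in Hw; [rewrite Cmod_opp in Hw; lra | ].
    replace w with (w - z0 + z0)%C by ring. rewrite E. ring. }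
  simpl. field. split; [now apply Cpow_nz | exact Nw].
Qed.

Lemma cderiv_ext_neq (f g : C -> C) (z0 z l : C) : z <> z0 -> (forall w, w <> z0 -> f w = g w) -> cderiv f z l -> cderiv g z l.
Proof.
intros Hz E H. assert (Hz' : (z - z0)%C <> 0) by (intros F; now apply Hz, Ceq_minus).
apply (is_derive_ext_loc (K := C_AbsRing) (V := C_NormedModule) f g); [ | exact H].
exists (mkposreal _ (proj1 (Cmod_gt_0 _) Hz')). intros w Hw.
change (Cmod (w - z)%C < Cmod (z - z0)%C) in Hw. apply E. intros F. subst w.
replace (z0 - z)%C with (- (z - z0))%C in Hw by ring. rewrite Cmod_opp in Hw. lra.
Qed.

(** The quotient by (z - zeta0)^n is differentiable at [zeta0] by [expands_shift_order] and
    elsewhere as a quotient; the zero-free exponential of [D2_ndet] leaves the order unchanged. *)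
Lemma vanishing_order_D2 (c T theta : R) (U : R -> R) (q1 dq1 q2 dq2 : R -> C -> C) (zeta0 : C) (p : series) (n : nat) :
  c ^ 2 <> 1 -> 0 < T -> hill_system c U q1 dq1 q2 dq2 ->
  (forall z, exists l, cderiv (ndet c T theta q1 dq1 q2 dq2) z l) ->
  expands (fun h => ndet c T theta q1 dq1 q2 dq2 (zeta0 + h)%C) p -> order p n ->
  vanishing_order (fun zeta => D2 c T (hill_matrix q1 dq1 q2 dq2 T) zeta theta) zeta0 n.
Proof.
intros Hc HT HH Hdiff He Hn.
destruct (expands_shift_order _ zeta0 p n He Hn) as [g [G1 [G2 [[l0 L0] G3]]]].
set (e := fun w => Cexp (- (Ci * c * T / kap c) * w + Ci * theta)%C).
assert (Ge : forall z, exists l, cderiv g z l).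
{ intros z. destruct (Ceq_dec z zeta0) as [-> | N]; [now exists l0 | ].
  destruct (Hdiff z) as [l Hl]. destruct (cderiv_inv_pow zeta0 z n N) as [l' Hl'].
  eexists. apply (cderiv_ext_neq (fun w => ndet c T theta q1 dq1 q2 dq2 w * / (w - zeta0) ^ n)%C g zeta0 z _ N).
  - intros w Hw. now rewrite G3.
  - apply cderiv_mult; eassumption. }
exists (fun w => e w * g w)%C. split.
- exists (mkposreal 1 Rlt_0_1). intros z _. split.
  + destruct (Ge z) as [l Hl]. eexists. apply (cderiv_mult e g); [apply cderiv_Cexp_affine | exact Hl].
  + rewrite (D2_ndet c T theta U) by assumption. rewrite G1. unfold e. ring.
- apply Cmult_neq_0; [apply Cexp_neq_0 | rewrite G2; apply Hn].
Qed.

Theorem theorem1 (c T : R) (U : R -> R) (q1 dq1 q2 dq2 : R -> C -> C)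
  (hc : c ^ 2 <> 1)
  (hU : standing_wave c U)
  (hT : fundamental_period_mod_2PI U T)
  (hq1 : forall zeta : C,
     hill_solution c U zeta (fun z => q1 z zeta) (fun z => dq1 z zeta))
  (hq1_0 : forall zeta : C, q1 0 zeta = 1 /\ dq1 0 zeta = 0)
  (hq2 : forall zeta : C,
     hill_solution c U zeta (fun z => q2 z zeta) (fun z => dq2 z zeta))
  (hq2_0 : forall zeta : C, q2 0 zeta = 0 /\ dq2 0 zeta = 1) :
  forall theta : R, 0 <= theta < 2 * PI ->
    let D := fun zeta : C => D2 c T (hill_matrix q1 dq1 q2 dq2 T) zeta theta in
    entire D /\
    (forall zeta : C, D zeta = 0 <-> characteristic_value c T U theta zeta) /\
    (forall zeta0 : C, characteristic_value c T U theta zeta0 ->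
       exists n : nat,
         vanishing_order D zeta0 n /\
         algebraic_multiplicity c T U theta zeta0 n).
Proof.
intros theta _ D.
assert (HT : 0 < T) by apply hT.
assert (HU : forall x, ex_derive U x) by apply hU.
assert (HH : hill_system c U q1 dq1 q2 dq2) by (split; [exact hq1 | split; [exact hq1_0 | split; [exact hq2 | exact hq2_0]]]).
(* The derivative at each point is read off from the expansion centred there. *)
assert (Hdiff : forall z, exists l, cderiv (ndet c T theta q1 dq1 q2 dq2) z l).
{ intros z. destruct (monodromy_expansion c T theta U q1 dq1 q2 dq2 z hc HT HH) as [a1 [b1 [a2 [b2 [_ [_ [_ He]]]]]]].
  eexists. exact (expands_cderiv _ z _ He). }
assert (HD : forall zeta, D zeta = (Cexp (- (Ci * c * T / kap c) * zeta + Ci * theta) * ndet c T theta q1 dq1 q2 dq2 zeta)%C).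
{ intros zeta. now apply (D2_ndet c T theta U). }
split; [ | split].
- intros z. destruct (Hdiff z) as [l Hl].
  eexists. apply (is_derive_ext (K := C_AbsRing) (V := C_NormedModule) (fun zeta =>
    (Cexp (- (Ci * c * T / kap c) * zeta + Ci * theta) * ndet c T theta q1 dq1 q2 dq2 zeta)%C)).
  + intros w. symmetry. apply HD.
  + apply (cderiv_mult (fun zeta => Cexp (- (Ci * c * T / kap c) * zeta + Ci * theta)%C)); [apply cderiv_Cexp_affine | exact Hl].
- intros zeta. rewrite <- (characteristic_value_ndet c T theta U q1 dq1 q2 dq2 zeta hc HT HU HH), HD. split.
  + intros H. apply NNPP. intros N. exact (Cmult_neq_0 _ _ (Cexp_neq_0 _) N H).
  + intros ->. ring.
- intros zeta0 _.
  destruct (monodromy_expansion c T theta U q1 dq1 q2 dq2 zeta0 hc HT HH) as [a1 [b1 [a2 [b2 [C1 [C2 [Hn He]]]]]]].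
  set (S := sdet _ _ _ _) in He.
  (* If all coefficients vanished, [expands_zero] would make the determinant zero on the whole
     plane, against [ndet_not_zero]. *)
  assert (Hk : exists k, S k <> 0).
  { apply NNPP. intros N. destruct (ndet_not_zero c T theta U q1 dq1 q2 dq2 hc HT HH) as [zeta Hz]. apply Hz.
    assert (E := expands_zero _ _ He). replace zeta with (zeta0 + (zeta - zeta0))%C by ring. apply E.
    intros k. unfold sopp. assert (S k = 0) as -> by (apply NNPP; intros M; apply N; now exists k). ring. }
  destruct Hk as [k Hk]. destruct (order_exists S k Hk) as [n On].
  exists n. split.
  + apply (vanishing_order_D2 c T theta U q1 dq1 q2 dq2 zeta0 (sopp S) n hc HT HH Hdiff He). now apply order_sopp.
  + assert (Dim := Ker_dim _ _ _ _ n On).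
    assert (J := fun m d => has_dim_jordan c T theta U zeta0 a1 b1 a2 b2 m d hc HT HU C1 C2 Hn).
    split.
    * intros m _. destruct (Dim m) as [d [Kd [Ld _]]]. exists d. split; [now apply J | exact Ld].
    (* The length must be at least 1 by definition and at least [n] for the supremum to be
       attained. *)
    * exists (Nat.max 1 n). split; [lia | ]. destruct (Dim (Nat.max 1 n)) as [d [Kd [_ Ed]]].
      assert (G := J _ _ Kd). rewrite (Ed (Nat.le_max_r 1 n)) in G. exact G.
Qed.
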